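(* Let $1 < p < 2$. There exist a compact set $E \subset \mathbb{T}$ and a function $g \in C(\mathbb{T}) \cap A_p(\mathbb{T})$ such that: (a) $\{t \in \mathbb{T} : g(t) = 0\} = E$; (b) the set $\{P(t) g(t) : P \text{ is a trigonometric polynomial}\}$ is dense in $A_p(\mathbb{T})$; (c) there is a non-zero Schwartz distribution $S$ on $\mathbb{T}$, supported by $E$, which belongs to $A_q(\mathbb{T})$, where $q = p/(p-1)$.
   Context: $\mathbb{T} = \mathbb{R}/2\pi\mathbb{Z}$ is the circle. For $1 \leq r < \infty$, $A_r(\mathbb{T})$ is the Banach space of Schwartz distributions (or functions) $S$ on $\mathbb{T}$ whose sequence of Fourier coefficients $\widehat{S} = (\widehat{S}(n))_{n \in \mathbb{Z}}$ belongs to $\ell_r(\mathbb{Z})$, with norm $\|S\|_{A_r} = \|\widehat{S}\|_{\ell_r}$. A distribution is supported by a closed set $E$ if its support is contained in $E$. *)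

(* Defs.v *)
From HB Require Import structures.
From mathcomp Require Import all_boot all_order all_algebra.
From mathcomp Require Import complex.
From mathcomp Require Import all_classical all_reals all_analysis.
From mathcomp Require Import ring.

Set Implicit Arguments.
Unset Strict Implicit.
Unset Printing Implicit Defensive.

Import Order.TTheory GRing.Theory Num.Theory.
Import numFieldNormedType.Exports.

Local Open Scope classical_set_scope.
Local Open Scope complex_scope.
Local Open Scope ring_scope.
Local Open Scope quotient_scope.

(* The topology of the complex numbers is the one given by the modulus. *)
HB.instance Definition _ (R : realType) := NormedModule.copy R[i] (R[i]^o).

Section Circle.
Variable R : realType.
Implicit Types (x y a b c : R) (k n : int).

Definition circle_rel : rel R :=
  fun x y => `[< exists k : int, x - y = k%:~R * (2 * pi) >].

Lemma circle_rel_refl : reflexive circle_rel.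
Proof. by move=> x; apply/asboolP; exists 0; rewrite subrr mul0r. Qed.

Lemma circle_rel_sym : symmetric circle_rel.
Proof.
move=> x y; apply/asboolP/asboolP => -[k hk]; exists (- k);
  by rewrite mulrNz mulNr -hk opprB.
Qed.

Lemma circle_rel_trans : transitive circle_rel.
Proof.
move=> y x z /asboolP[k hk] /asboolP[l hl]; apply/asboolP; exists (k + l).
by rewrite intrD mulrDl -hk -hl addrA subrK.
Qed.

Canonical circle_equiv :=
  EquivRel circle_rel circle_rel_refl circle_rel_sym circle_rel_trans.

Definition circle : Type := quotient_topology {eq_quot circle_equiv}.
HB.instance Definition _ := Topological.on circle.
HB.instance Definition _ := Quotient.on circle.

Lemma repr_pi_circle x :
  exists k : int, repr (\pi_circle x) = x + k%:~R * (2 * pi).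
Proof.
have : \pi_{eq_quot circle_equiv} (repr (\pi_circle x)) =
       \pi_{eq_quot circle_equiv} x :> {eq_quot circle_equiv}.
  exact: (reprK (\pi_circle x)).
move=> /eqmodP/asboolP[k hk]; exists k.
by rewrite -hk addrC subrK.
Qed.

(* [repull f] and [impull f] are the real and imaginary parts of [f] read as a
   2 pi-periodic function on the line. *)
Definition repull (f : circle -> R[i]) x : R := complex.Re (f (\pi_circle x)).
Definition impull (f : circle -> R[i]) x : R := complex.Im (f (\pi_circle x)).

Definition smoothR (h : R -> R) : Prop :=
  forall (j : nat) x, derivable (derive1n j h) x 1.

Definition smooth (f : circle -> R[i]) : Prop :=
  smoothR (repull f) /\ smoothR (impull f).

Definition smooth_pred : {pred circle -> R[i]} := fun f => `[< smooth f >].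

Lemma derive1n_lin a b (h h' : R -> R) : smoothR h -> smoothR h' ->
  forall j, derive1n j (fun x => a * h x + b * h' x) =
            (fun x => a * derive1n j h x + b * derive1n j h' x).
Proof.
move=> sh sh'; elim=> [//|j IH]; rewrite derive1nS IH; apply/funext => x.
have dh := sh j x; have dh' := sh' j x.
rewrite !derive1nS !derive1E.
rewrite (_ : (fun y => _) =
  (a *: derive1n j h + b *: derive1n j h' : R -> R^o)); last by [].
rewrite deriveD; [|exact: derivableZ|exact: derivableZ].
by rewrite !(deriveZ _ dh, deriveZ _ dh').
Qed.

Lemma smoothR_lin a b (h h' : R -> R) : smoothR h -> smoothR h' ->
  smoothR (fun x => a * h x + b * h' x).
Proof.
move=> sh sh' j x; rewrite derive1n_lin //.
rewrite (_ : (fun y => _) =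
  (a *: derive1n j h + b *: derive1n j h' : R -> R^o)); last by [].
by apply: derivableD; apply: derivableZ; [exact: sh|exact: sh'].
Qed.

Lemma smoothR_cst0 : smoothR (fun=> 0).
Proof.
move=> j x; have -> : derive1n j (fun=> 0 : R) = fun=> 0.
  elim: j => [//|j IH]; rewrite derive1nS IH.
  by apply/funext => y; rewrite derive1_cst.
exact: derivable_cst.
Qed.

Lemma smooth_closed : submod_closed smooth_pred.
Proof.
split; first by apply/asboolP; split; exact: smoothR_cst0.
move=> u f g /asboolP[fr fi] /asboolP[gr gi]; apply/asboolP; split.
- rewrite (_ : repull _ = fun x => 1 * (complex.Re u * repull f x +
      (- complex.Im u) * impull f x) + 1 * repull g x).
    by apply: smoothR_lin; [apply: smoothR_lin|]; assumption.
  apply/funext => x; rewrite /repull /impull !mul1r.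
  change ((u *: f + g) (\pi_circle x))
    with (u * f (\pi_circle x) + g (\pi_circle x)).
  case: u (f _) (g _) => [u1 u2] [f1 f2] [g1 g2] /=.
  by rewrite mulNr.
- rewrite (_ : impull _ = fun x => 1 * (complex.Re u * impull f x +
      complex.Im u * repull f x) + 1 * impull g x).
    by apply: smoothR_lin; [apply: smoothR_lin|]; assumption.
  apply/funext => x; rewrite /repull /impull !mul1r.
  change ((u *: f + g) (\pi_circle x))
    with (u * f (\pi_circle x) + g (\pi_circle x)).
  by case: u (f _) (g _) => [u1 u2] [f1 f2] [g1 g2] /=.
Qed.
HB.instance Definition _ :=
  GRing.isSubmodClosed.Build R[i] (circle -> R[i]) smooth_pred smooth_closed.

Record testfun := Testfun {
  testfun_val :> circle -> R[i];
  testfun_smooth : testfun_val \in smooth_pred }.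
HB.instance Definition _ := [isSub for testfun_val].
HB.instance Definition _ := [Choice of testfun by <:].
HB.instance Definition _ := [SubChoice_isSubLmodule of testfun by <:].

(* [chi n t = exp (i n t)]; the value does not depend on the representative,
   see [chi_pi]. *)
Definition chi (n : int) (t : circle) : R[i] :=
  cos (n%:~R * repr t) +i* sin (n%:~R * repr t).

Lemma cos_sin_periodz k x :
  cos (x + k%:~R * (2 * pi)) = cos x /\ sin (x + k%:~R * (2 * pi)) = sin x.
Proof.
have P (m : nat) y :
    cos (y + m%:R * (2 * pi)) = cos y /\ sin (y + m%:R * (2 * pi)) = sin y.
  elim: m => [|m [IHc IHs]]; first by rewrite mul0r addr0.
  rewrite -addn1 natrD mulrDl mul1r addrA [X in _ + X]mulr_natl.
  by split; rewrite (cosD2pi, sinD2pi).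
case: k => m; first exact: P.
rewrite NegzE mulrNz mulNr -pmulrn.
by have [hc hs] := P m.+1 (x - m.+1%:R * (2 * pi)); rewrite subrK in hc hs.
Qed.

Lemma chi_pi n x :
  chi n (\pi_circle x) = cos (n%:~R * x) +i* sin (n%:~R * x).
Proof.
have [k hk] := repr_pi_circle x; rewrite /chi hk mulrDr mulrA -intrM.
by have [-> ->] := cos_sin_periodz (n * k) (n%:~R * x).
Qed.

Lemma smoothR_cos_sin a b c :
  smoothR (fun x => a * cos (c * x) + b * sin (c * x)).
Proof.
have D a' b' x : is_derive x 1 (fun x => a' * cos (c * x) + b' * sin (c * x))
    ((b' * c) * cos (c * x) + (- (a' * c)) * sin (c * x)).
  have dl : is_derive x 1 (fun x => c * x) c.
    by apply: is_derive_eq; rewrite /GRing.scale /=; ring.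
  have dc := is_derive1_comp (is_derive_cos (c * x)) dl.
  have ds := is_derive1_comp (is_derive_sin (c * x)) dl.
  have h := is_deriveD (is_deriveZ a' dc) (is_deriveZ b' ds).
  by apply: (is_derive_eq h); rewrite /GRing.scale /=; ring.
have DN j a' b' : exists a1 b1,
    derive1n j (fun x => a' * cos (c * x) + b' * sin (c * x)) =
    (fun x => a1 * cos (c * x) + b1 * sin (c * x)).
  elim: j => [|j [a1 [b1 IH]]]; first by exists a', b'.
  exists (b1 * c), (- (a1 * c)); rewrite derive1nS IH; apply/funext => x.
  by rewrite derive1E; exact: (@derive_val _ _ _ _ _ _ _ (D a1 b1 x)).
by move=> j x; have [a1 [b1 ->]] := DN j a b; exact: (@ex_derive _ _ _ _ _ _ _ (D a1 b1 x)).
Qed.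

Lemma chi_smooth n : chi n \in smooth_pred.
Proof.
apply/asboolP; split.
- rewrite (_ : repull _ = fun x => 1 * cos (n%:~R * x) + 0 * sin (n%:~R * x)).
    exact: smoothR_cos_sin.
  by apply/funext => x; rewrite /repull chi_pi /= mul1r mul0r addr0.
- rewrite (_ : impull _ = fun x => 0 * cos (n%:~R * x) + 1 * sin (n%:~R * x)).
    exact: smoothR_cos_sin.
  by apply/funext => x; rewrite /impull chi_pi /= mul1r mul0r add0r.
Qed.

Definition chi_test n : testfun := Testfun (chi_smooth n).

Definition trigpoly : set (circle -> R[i]) :=
  [set P | exists (s : seq int) (c : int -> R[i]),
             P = fun t => \sum_(n <- s) c n * chi n t].

(* The seminorms, indexed by [N], that define the topology of C^oo. *)
Definition test_seminorm (N : nat) (phi : testfun) : R :=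
  \sum_(j < N.+1) sup [set Normc.normc
    (derive1n j (repull phi) x +i* derive1n j (impull phi) x) | x in [set: R]].

Definition schwartz_distribution : set (testfun -> R[i]) :=
  [set S | scalar S /\
    exists (N : nat) (M : R), forall phi,
      Normc.normc (S phi) <= M * test_seminorm N phi].

(* The integral of [f] over the circle, for Lebesgue measure of total mass
   2 pi. *)
Definition circle_integral (f : circle -> R[i]) : R[i] :=
  Rintegral lebesgue_measure `[0, 2 * pi] (repull f) +i*
  Rintegral lebesgue_measure `[0, 2 * pi] (impull f).

(* A function is identified with the distribution given by integration against
   normalized Lebesgue measure, so that [fourier (dist_of f) n] is the usual
   n-th Fourier coefficient of [f]. *)
Definition dist_of (f : circle -> R[i]) : testfun -> R[i] :=
  fun phi => ((2 * pi)^-1)%:C * circle_integral (fun t => f t * phi t).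

Definition fourier (S : testfun -> R[i]) (n : int) : R[i] := S (chi_test (- n)).

Definition vanishes_on (S : testfun -> R[i]) (U : set circle) : Prop :=
  forall phi : testfun, closure [set t | phi t != 0] `<=` U -> S phi = 0.

Definition dist_support (S : testfun -> R[i]) : set circle :=
  ~` \bigcup_(U in [set U : set circle | open U /\ vanishes_on S U]) U.

Definition A_norm (r : R) (S : testfun -> R[i]) : \bar R :=
  ((\esum_(n in [set: int]) (Normc.normc (fourier S n) `^ r)%:E) `^ r^-1)%E.

Definition A_space (r : R) : set (testfun -> R[i]) :=
  [set S | schwartz_distribution S /\ (A_norm r S < +oo)%E].

Definition A_dense (r : R) (D : set (testfun -> R[i])) : Prop :=
  D `<=` A_space r /\
  forall S, A_space r S -> forall e : R, 0 < e ->
    exists2 T, D T & (A_norm r (S - T)%R < e%:E)%E.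

End Circle.

(* Main.v *)
Require Import Defs.
From mathcomp Require Import all_boot all_order all_algebra.
From mathcomp Require Import complex.
From mathcomp Require Import all_classical all_reals all_analysis.
From mathcomp Require finmap.
From mathcomp Require Import qpoly ring lra zify.
Import Order.TTheory GRing.Theory Num.Theory.
Import numFieldNormedType.Exports.
Local Open Scope classical_set_scope.
Local Open Scope complex_scope.
Local Open Scope ring_scope.
Set Implicit Arguments.
Unset Strict Implicit.
Unset Printing Implicit Defensive.

(** Everything is built from trigonometric polynomials. One constructs positive
polynomials g_k and polynomials S_k such that g_k tends to g uniformly and in A_p,
S_k tends to S in A_q, S_0 = 1, and S_k tends to 0 uniformly wherever g does not
vanish; hence S is supported by the zero set of g. Since each g_k is positive, its
inverse is a norm limit of polynomials P (Neumann series), and g_{k+1}, g_{k+2}, ...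
can be kept so close to g_k in A_p that P g is still close to 1: so g is cyclic.

The step from k to k+1 uses two polynomials dilated by a large integer: F, small in
A_p and bounded by 3/4, and a density phi close to 1 in A_q, such that F >= c0
except on a set where phi is small in L^2. One multiplies g_k by 1 - T(g_k) F, with a
polynomial T that cuts off the region where g_k is not small, and S_k by
X(g_k) phi, with a polynomial X that is so small where g_k is large that it beats the
sup norm of phi. Such a pair exists for p < 2 < q: with c_j = cos(9^j t), F is half the
imaginary part of prod_j (1 + i b c_j), close to sin(b sum_j c_j), and phi is a
combination of the Riesz products prod_j (1 + a s c_j), 1 <= a <= 2, whose signed
weights annihilate all moments a^k, 1 <= k <= K. This kills the low order
coefficients of phi - 1, while each Riesz product concentrates where sum_j c_j is
about a s m / 2, by a Chernoff bound. *)

(** By duality, density of the multiples [P g] forbids a nonzero [S] in A_q that annihilates all of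
    them. A measure carried by the zero set of [g] would annihilate them, so [S] cannot be a
    measure. The obstacle is already visible in one block: smallness of [F] in A_p and of [phi - 1]
    in A_q makes the mean of [F phi] small, whereas a nonnegative [phi] would make it at least about
    [c0], since [F >= c0] wherever [phi] is not negligible. Hence a single Riesz product cannot
    serve, and signed weights enter.

    The exponents fit as follows. With b of order 1 / (s m), the p-th power of the A_p norm of [F]
    is about m (s m)^(-p) = (m s^q)^(-(p - 1)), because q (p - 1) = p. The q-th power of the A_q
    norm of [phi - 1] is at most 2^(-K) exp(C m s^q). So m s^q is held near a large constant L,
    which makes [F] small, and K then makes [phi - 1] small. The Chernoff bounds need s^2 m large in
    order to beat the weights, of total size up to 8^K. With m s^q near L, s^2 m is of order L s^(2
    - q), which tends to infinity as s tends to 0 because q > 2: this is where p < 2 enters. *)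

Arguments Normc.normc : simpl never.
Arguments chi : simpl never.

(** * Means over the circle *)

Section ComplexModulus.
Variable R : realType.
Implicit Types (x y : R) (z w : R[i]).
Local Notation nc := Normc.normc.

Lemma nc_normr z : (nc z)%:C = `|z|.
Proof. by []. Qed.

Lemma nc_ge0 z : 0 <= nc z.
Proof. by rewrite -lecR nc_normr normr_ge0. Qed.

Lemma ncD z w : nc (z + w) <= nc z + nc w.
Proof. exact: le_normcD. Qed.

Lemma ncN z : nc (- z) = nc z.
Proof. exact: normcN. Qed.

Lemma ncB z w : nc (z - w) <= nc z + nc w.
Proof. by rewrite -(ncN w); exact: ncD. Qed.

Lemma ncM z w : nc (z * w) = nc z * nc w.
Proof. exact: Normc.normcM. Qed.

Lemma nc0 : nc 0 = 0 :> R.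
Proof. exact: Normc.normc0. Qed.

Lemma nc1 : nc 1 = 1 :> R.
Proof. exact: Normc.normc1. Qed.

Lemma ncX z n : nc (z ^+ n) = nc z ^+ n.
Proof. by elim: n => [|n IH]; rewrite ?expr0 ?nc1// !exprS ncM IH. Qed.

Lemma ncR x : nc x%:C = `|x|.
Proof. by rewrite /Normc.normc /= expr0n /= addr0 sqrtr_sqr. Qed.

Lemma nc_eq0 z : (nc z == 0) = (z == 0).
Proof.
by apply/eqP/eqP => [/Normc.eq0_normc//|->]; rewrite nc0.
Qed.

Lemma nc_sqr z : nc z ^+ 2 = complex.Re z ^+ 2 + complex.Im z ^+ 2.
Proof. by case: z => a b; rewrite /Normc.normc sqr_sqrtr// addr_ge0// sqr_ge0. Qed.

Lemma nc_conj z : nc z^*%C = nc z.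
Proof. by case: z => a b; rewrite /Normc.normc /= sqrrN. Qed.

Lemma mul_conjc z : z * z^*%C = (nc z ^+ 2)%:C.
Proof.
rewrite nc_sqr; case: z => a b; apply/eqP; rewrite eq_complex /=.
by apply/andP; split; apply/eqP; ring.
Qed.

Lemma nc_Re z : `|complex.Re z| <= nc z.
Proof.
rewrite -(ler_pXn2r (n := 2)) ?nnegrE ?nc_ge0// nc_sqr real_normK ?num_real//.
by rewrite lerDl sqr_ge0.
Qed.

Lemma nc_Im z : `|complex.Im z| <= nc z.
Proof.
rewrite -(ler_pXn2r (n := 2)) ?nnegrE ?nc_ge0// nc_sqr real_normK ?num_real//.
by rewrite lerDr sqr_ge0.
Qed.

Lemma nc_ReIm z : nc z <= `|complex.Re z| + `|complex.Im z|.
Proof.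
rewrite -(ler_pXn2r (n := 2)) ?nnegrE ?nc_ge0 ?addr_ge0// nc_sqr.
by rewrite sqrrD !real_normK ?num_real// lerD2r lerDl mulrn_wge0 // mulr_ge0.
Qed.

Lemma nc_sum (I : Type) (s : seq I) (P : pred I) (F : I -> R[i]) :
  nc (\sum_(i <- s | P i) F i) <= \sum_(i <- s | P i) nc (F i).
Proof.
elim/big_rec2: _ => [|i y x _ IH]; first by rewrite nc0.
by apply: le_trans (ncD _ _) _; rewrite lerD2l.
Qed.

Lemma ReDc z w : complex.Re (z + w) = complex.Re z + complex.Re w.
Proof. by case: z w => [? ?] [? ?]. Qed.
Lemma ImDc z w : complex.Im (z + w) = complex.Im z + complex.Im w.
Proof. by case: z w => [? ?] [? ?]. Qed.
Lemma ReMc z w : complex.Re (z * w) =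
  complex.Re z * complex.Re w - complex.Im z * complex.Im w.
Proof. by case: z w => [? ?] [? ?]. Qed.
Lemma ImMc z w : complex.Im (z * w) =
  complex.Re z * complex.Im w + complex.Im z * complex.Re w.
Proof. by case: z w => [? ?] [? ?]. Qed.

Lemma conjcD z w : (z + w)^*%C = z^*%C + w^*%C.
Proof. exact: rmorphD. Qed.
Lemma conjcM z w : (z * w)^*%C = z^*%C * w^*%C.
Proof. exact: rmorphM. Qed.
Lemma conjcB z w : (z - w)^*%C = z^*%C - w^*%C.
Proof. exact: rmorphB. Qed.
Lemma conjc_sum (I : Type) (s : seq I) (F : I -> R[i]) :
  (\sum_(i <- s) F i)^*%C = \sum_(i <- s) (F i)^*%C.
Proof. exact: rmorph_sum. Qed.

End ComplexModulus.

(** * Characters and dilations of the circle *)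

Section Characters.
Variable R : realType.
Local Notation T := (circle R).
Local Notation C := R[i].
Local Notation nc := Normc.normc.
Local Notation qpi := (\pi_(circle R))%qT.

Lemma circleP (t : T) : exists x : R, t = qpi x.
Proof. by exists (repr t); rewrite reprK. Qed.

Lemma chiD m n (t : T) : chi (m + n) t = chi m t * chi n t.
Proof.
apply/eqP; rewrite eq_complex /chi /= intrD mulrDl cosD sinD.
by apply/andP; split; apply/eqP; ring.
Qed.

Lemma chi0 (t : T) : chi 0 t = 1.
Proof. by rewrite /chi mulr0z mul0r cos0 sin0. Qed.

Lemma nc_chi n (t : T) : nc (chi n t) = 1.
Proof. by rewrite /Normc.normc /chi cos2Dsin2 sqrtr1. Qed.

Lemma chi_conj n (t : T) : (chi n t)^*%C = chi (- n) t.
Proof. by rewrite /chi /= mulrNz mulNr cosN sinN. Qed.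

Definition dil (D : nat) (t : T) : T := qpi (D%:R * repr t).

Lemma chi_dil n D (t : T) : chi n (dil D t) = chi (D%:Z * n) t.
Proof. by rewrite /dil chi_pi /chi intrM [D%:~R * _]mulrC mulrA. Qed.

End Characters.

Section Integral.
Variable R : realType.
Local Notation T := (circle R).
Local Notation C := R[i].
Local Notation nc := Normc.normc.
Local Notation qpi := (\pi_(circle R))%qT.
Local Notation mu := (@lebesgue_measure R).
Implicit Types (f g : T -> C) (h : R -> R).

(** Continuity is tested on the periodic lift to the line, where differentiation and integration
    take place; for real values [continuous_cpx] carries it over to the quotient topology. *)
Definition ct f := continuous (repull f : R -> R^o) /\
                   continuous (impull f : R -> R^o).

Lemma ctD f g : ct f -> ct g -> ct (fun t => f t + g t).
Proof.
move=> [fr fi] [gr gi]; split.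
  rewrite (_ : repull _ = repull f \+ repull g).
    by move=> x; apply: continuousD; [exact: fr|exact: gr].
  by apply/funext => x; rewrite /repull ReDc.
rewrite (_ : impull _ = impull f \+ impull g).
  by move=> x; apply: continuousD; [exact: fi|exact: gi].
by apply/funext => x; rewrite /impull ImDc.
Qed.

Lemma ctM f g : ct f -> ct g -> ct (fun t => f t * g t).
Proof.
move=> [fr fi] [gr gi]; split.
  rewrite (_ : repull _ = (repull f \* repull g) \- (impull f \* impull g)).
    move=> x; apply: continuousB; apply: continuousM;
      [exact: fr|exact: gr|exact: fi|exact: gi].
  by apply/funext => x; rewrite /repull ReMc.
rewrite (_ : impull _ = (repull f \* impull g) \+ (impull f \* repull g)).
  move=> x; apply: continuousD; apply: continuousM;
    [exact: fr|exact: gi|exact: fi|exact: gr].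
by apply/funext => x; rewrite /impull ImMc.
Qed.

Lemma ct_cst (c : C) : ct (fun=> c).
Proof. by split => x; exact: cst_continuous. Qed.

Lemma ct_conj f : ct f -> ct (fun t => (f t)^*%C).
Proof.
move=> [fr fi]; split.
  rewrite (_ : repull _ = repull f)//; apply/funext => x.
  by rewrite /repull; case: (f _).
rewrite (_ : impull _ = \- impull f); first by move=> x; exact/continuousN/fi.
by apply/funext => x; rewrite /impull /=; case: (f _).
Qed.

Lemma ct_chi n : ct (chi n : T -> C).
Proof.
have := chi_smooth R n; move=> /asboolP[sr si]; split => x.
  exact/differentiable_continuous/derivable1_diffP/(sr 0%N).
exact/differentiable_continuous/derivable1_diffP/(si 0%N).
Qed.

Lemma ct_test (phi : testfun R) : ct phi.
Proof.
have /asboolP[sr si] := testfun_smooth phi; split => x.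
  exact/differentiable_continuous/derivable1_diffP/(sr 0%N).
exact/differentiable_continuous/derivable1_diffP/(si 0%N).
Qed.

Lemma ct_sum (I : Type) (s : seq I) (F : I -> T -> C) :
  (forall i, ct (F i)) -> ct (fun t => \sum_(i <- s) F i t).
Proof.
move=> cF; elim: s => [|i s IH].
  rewrite (_ : (fun t => _) = fun=> 0); first exact: ct_cst.
  by apply/funext => t; rewrite big_nil.
rewrite (_ : (fun t => _) = fun t => F i t + \sum_(j <- s) F j t).
  exact: ctD.
by apply/funext => t; rewrite big_cons.
Qed.

Definition IR h := Rintegral mu `[0, 2 * pi] h.

Lemma ct_integrable h : continuous (h : R -> R^o) ->
  mu.-integrable `[0, 2 * pi]%classic (EFin \o h).
Proof.
move=> ch; apply: continuous_compact_integrable; first exact: segment_compact.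
exact: continuous_subspaceT.
Qed.

Lemma IR_lin a b h h' : continuous (h : R -> R^o) -> continuous (h' : R -> R^o) ->
  IR (fun x => a * h x + b * h' x) = a * IR h + b * IR h'.
Proof.
move=> ch ch'.
have Z c k : continuous (k : R -> R^o) -> continuous ((fun x => c * k x) : R -> R^o).
  by move=> ck x; apply: continuousM; [exact: cst_continuous|exact: ck].
rewrite /IR RintegralD//; [|exact/ct_integrable/Z..].
by rewrite !RintegralZl//; exact: ct_integrable.
Qed.

Lemma IR_cst a : IR (fun=> a) = a * (2 * pi).
Proof.
rewrite /IR Rintegral_cst//= lebesgue_measure_itv /= lte_fin ifT ?oppr0 ?adde0//.
by rewrite mulr_gt0// pi_gt0.
Qed.

Lemma IR_le h h' : continuous (h : R -> R^o) -> continuous (h' : R -> R^o) ->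
  (forall x, h x <= h' x) -> IR h <= IR h'.
Proof.
move=> ch ch' le; apply: le_Rintegral => //; exact: ct_integrable.
Qed.

Lemma twopi_gt0 : 0 < 2 * pi :> R.
Proof. by rewrite mulr_gt0// pi_gt0. Qed.

Lemma IR_derive (F f : R -> R) : (forall x : R, is_derive x 1 F (f x)) ->
  continuous (f : R -> R^o) -> F (2 * pi) = F 0 -> IR f = 0.
Proof.
move=> dF cf E; rewrite /IR /Rintegral.
rewrite (@continuous_FTC2 _ f F).
- by rewrite -EFinD E subrr.
- exact: twopi_gt0.
- exact: continuous_subspaceT.
- have cF x : F y @[y --> x] --> F x.
    exact/differentiable_continuous/derivable1_diffP/(@ex_derive _ _ _ _ _ _ _ (dF x)).
  split; first by move=> x _; exact: (@ex_derive _ _ _ _ _ _ _ (dF x)).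
    by apply: cvg_at_right_filter.
  by apply: cvg_at_left_filter.
- by move=> x _; rewrite derive1E; exact: (@derive_val _ _ _ _ _ _ _ (dF x)).
Qed.

Definition mean f : C := ((2 * pi)^-1)%:C * circle_integral f.

Arguments mean : simpl never.

Lemma mean_lin a b f g : ct f -> ct g ->
  mean (fun t => a * f t + b * g t) = a * mean f + b * mean g.
Proof.
move=> [fr fi] [gr gi].
have Er : repull (fun t => a * f t + b * g t) = fun x =>
   1 * (1 * (complex.Re a * repull f x + (- complex.Im a) * impull f x)
  + 1 * (complex.Re b * repull g x + (- complex.Im b) * impull g x)) + 0 * 0.
  by apply/funext => x; rewrite /repull /impull ReDc !ReMc; ring.
have Ei : impull (fun t => a * f t + b * g t) = fun x =>
   1 * (1 * (complex.Re a * impull f x + complex.Im a * repull f x)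
  + 1 * (complex.Re b * impull g x + complex.Im b * repull g x)) + 0 * 0.
  by apply/funext => x; rewrite /repull /impull ImDc !ImMc; ring.
have cl c d h k : continuous (h : R -> R^o) -> continuous (k : R -> R^o) ->
    continuous ((fun x => c * h x + d * k x) : R -> R^o).
  move=> ch ck x; apply: (continuousD (f := fun x => c * h x : R^o));
    apply: continuousM;
    [exact: cst_continuous|exact: ch|exact: cst_continuous|exact: ck].
rewrite /mean /circle_integral Er Ei -![Rintegral _ _ _]/(IR _).
have c0 : continuous ((fun=> 0) : R -> R^o) by move=> x; exact: cst_continuous.
rewrite !IR_lin; do ?[exact: c0|exact: fr|exact: fi|exact: gr|exact: gi|apply: (cl _ _)].
apply/eqP; rewrite eq_complex !(ReDc, ImDc, ReMc, ImMc) /=.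
by apply/andP; split; apply/eqP; ring.
Qed.

Lemma mean0 : mean (fun=> 0) = 0.
Proof.
have := mean_lin 0 0 (ct_cst 0) (ct_cst 0).
by under eq_fun do rewrite !mul0r addr0; rewrite !mul0r addr0.
Qed.

Lemma meanD f g : ct f -> ct g -> mean (fun t => f t + g t) = mean f + mean g.
Proof.
move=> cf cg; have := mean_lin 1 1 cf cg.
by under eq_fun do rewrite !mul1r; rewrite !mul1r.
Qed.

Lemma meanZ a f : ct f -> mean (fun t => a * f t) = a * mean f.
Proof.
move=> cf; have := mean_lin a 0 cf cf.
by under eq_fun do rewrite mul0r addr0; rewrite mul0r addr0.
Qed.

Lemma meanB f g : ct f -> ct g -> mean (fun t => f t - g t) = mean f - mean g.
Proof.
move=> cf cg; have := mean_lin 1 (-1) cf cg.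
by under eq_fun do rewrite mul1r mulN1r; rewrite mul1r mulN1r.
Qed.

Lemma mean_sum (I : Type) (s : seq I) (F : I -> T -> C) :
  (forall i, ct (F i)) -> mean (fun t => \sum_(i <- s) F i t) = \sum_(i <- s) mean (F i).
Proof.
move=> cF; elim: s => [|i s IH].
  by rewrite big_nil -[RHS]mean0; congr mean; apply/funext => t; rewrite big_nil.
rewrite big_cons -IH -meanD//; last exact: ct_sum.
by congr mean; apply/funext => t; rewrite big_cons.
Qed.

Lemma mean_real (u : T -> R) : ct (fun t => (u t)%:C) ->
  mean (fun t => (u t)%:C) = ((2 * pi)^-1 * IR (fun x => u (qpi x)))%:C.
Proof.
move=> cu; rewrite /mean /circle_integral rmorphM /=; congr (_ * _).
have -> : impull (fun t => (u t)%:C) = fun=> 0 by [].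
have -> : repull (fun t => (u t)%:C) = fun x => u (qpi x) by [].
by rewrite -![Rintegral _ _ _]/(IR _) IR_cst mul0r.
Qed.

Lemma mean_cst c : mean (fun=> c) = c.
Proof.
have -> : (fun=> c : C) = (fun t : T => c * ((fun=> 1) t)%:C).
  by apply/funext => t; rewrite mulr1.
rewrite meanZ; last exact: (ct_cst 1).
rewrite (mean_real (u := fun=> 1)); last exact: (ct_cst 1).
by rewrite IR_cst mul1r mulVf ?mulr1// gt_eqF// twopi_gt0.
Qed.

Lemma mean_le (u v : T -> R) :
  ct (fun t => (u t)%:C) -> ct (fun t => (v t)%:C) -> (forall t, u t <= v t) ->
  complex.Re (mean (fun t => (u t)%:C)) <= complex.Re (mean (fun t => (v t)%:C)).
Proof.
move=> cu cv le; rewrite !mean_real//= ler_pM2l ?invr_gt0 ?twopi_gt0//.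
by apply: IR_le => //; [exact: cu.1|exact: cv.1].
Qed.

Lemma nc_mean f M : ct f -> (forall t, nc (f t) <= M) -> nc (mean f) <= M.
Proof.
move=> cf fM.
have [->|z0] := eqVneq (mean f) 0.
  by rewrite nc0; apply: le_trans (fM (qpi 0)); exact: nc_ge0.
(* Rotate [f] so that its mean becomes the nonnegative number [nc (mean f)]. *)
set z := mean f in z0 *.
pose w := z^*%C * ((nc z)^-1)%:C.
have nz0 : nc z != 0 by rewrite nc_eq0.
have nw : nc w = 1.
  by rewrite ncM nc_conj ncR ger0_norm ?invr_ge0 ?nc_ge0// divff.
have E : mean (fun t => w * f t) = (nc z)%:C.
  rewrite meanZ// -/z /w mulrAC [_ * z]mulrC mul_conjc -rmorphM /=.
  by congr (_ %:C); field.
have cu : ct (fun t => (complex.Re (w * f t))%:C).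
  have cwf := ctM (ct_cst w) cf; split; first exact: cwf.1.
  by move=> x; exact: cst_continuous.
have -> : nc z = complex.Re (mean (fun t => (complex.Re (w * f t))%:C)).
  rewrite mean_real// -[LHS]/(complex.Re (nc z)%:C) -E /mean ReMc /=.
  by rewrite mul0r subr0.
rewrite (_ : M = complex.Re (mean (fun=> M%:C))); last by rewrite mean_cst.
apply: mean_le => //; first exact: ct_cst.
move=> t; apply: le_trans (ler_norm _) _; apply: le_trans (nc_Re _) _.
by rewrite ncM nw mul1r.
Qed.

Lemma mean_chi n : mean (chi n) = (n == 0)%:R.
Proof.
have [->|n0] := eqVneq n 0.
  rewrite (_ : chi 0 = fun=> 1) ?mean_cst//.
  by apply/funext => t; rewrite chi0.
have nR : (n%:~R : R) != 0 by rewrite intr_eq0.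
have dl (x : R) : is_derive x 1 (fun x : R => n%:~R * x) n%:~R.
  by apply: is_derive_eq; rewrite /GRing.scale /=; ring.
have [cr ci] := ct_chi n.
have er : repull (chi n) = (fun x : R => cos (n%:~R * x)).
  by apply/funext => x; rewrite /repull chi_pi.
have ei : impull (chi n) = (fun x : R => sin (n%:~R * x)).
  by apply/funext => x; rewrite /impull chi_pi.
have [hc hs] := cos_sin_periodz n (0 : R); rewrite add0r in hc hs.
have -> : mean (chi n) = ((2 * pi)^-1)%:C * (IR (repull (chi n)) +i* IR (impull (chi n))) by [].
rewrite [IR (repull _)](@IR_derive (fun x => n%:~R^-1 * sin (n%:~R * x))); last 3 first.
- move=> x; rewrite er.
  have ds := is_derive1_comp (is_derive_sin (n%:~R * x)) (dl x).
  have h := is_deriveZ (n%:~R^-1) ds.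
  by apply: (is_derive_eq h); rewrite /GRing.scale /=; field.
- exact: cr.
- by rewrite /= mulr0 hs.
rewrite [IR (impull _)](@IR_derive (fun x => - n%:~R^-1 * cos (n%:~R * x))); last 3 first.
- move=> x; rewrite ei.
  have ds := is_derive1_comp (is_derive_cos (n%:~R * x)) (dl x).
  have h := is_deriveZ (- n%:~R^-1) ds.
  by apply: (is_derive_eq h); rewrite /GRing.scale /=; field.
- exact: ci.
- by rewrite /= mulr0 hc.
by rewrite -[0 +i* 0]/(0 : C) mulr0.
Qed.

End Integral.

(** * l_r norms of Fourier coefficients *)

Section SequenceNorms.
Variable R : realType.
Local Notation C := R[i].
Local Notation nc := Normc.normc.
Implicit Types (r M A B : R) (c d : int -> C).

(* The norm of [c] in l_r is at most [M]. *)
Definition bd r c M := 0 <= M /\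
  forall s : seq int, uniq s -> \sum_(n <- s) nc (c n) `^ r <= M `^ r.

Lemma bd_le r c M A : 0 <= r -> M <= A -> bd r c M -> bd r c A.
Proof.
move=> r0 MA [M0 h]; split; first exact: le_trans MA.
move=> s us; apply: le_trans (h s us) _.
by rewrite ge0_ler_powR// nnegrE (le_trans M0).
Qed.

Lemma bd0 r : 0 < r -> bd r (fun=> 0) 0.
Proof.
move=> r0; split => // s us; rewrite big1 ?powR_ge0// => n _.
by rewrite nc0 powR0// gt_eqF.
Qed.

Lemma bd_coef r c M n : 0 < r -> bd r c M -> nc (c n) <= M.
Proof.
move=> r0 [M0 /(_ [:: n] isT)]; rewrite big_seq1 => h.
rewrite leNgt; apply/negP => lt; move: h; apply/negP; rewrite -ltNge.
by rewrite gt0_ltr_powR// nnegrE ?nc_ge0.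
Qed.

Lemma bd_zero r c : 0 < r -> bd r c 0 -> c = fun=> 0.
Proof.
move=> r0 h; apply/funext => n; apply/eqP; rewrite -nc_eq0 eq_le nc_ge0 andbT.
exact: bd_coef h.
Qed.

Lemma powR_convex r (t a b : R) : 1 <= r -> 0 <= t <= 1 -> 0 <= a -> 0 <= b ->
  (t * a + (1 - t) * b) `^ r <= t * a `^ r + (1 - t) * b `^ r.
Proof.
move=> r1 t01 a0 b0.
case/andP: t01 => t0 t1.
have := @convex_powR R r r1 (Itv01 t0 t1) a b.
by rewrite !inE /= !in_itv /= !andbT => /(_ a0 b0); rewrite !convRE.
Qed.

(* Minkowski: the unit ball of l_r is convex. *)
Lemma bdD r c d A B : 1 <= r -> bd r c A -> bd r d B ->
  bd r (fun n => c n + d n) (A + B).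
Proof.
move=> r1 hc hd; have r0 : 0 < r by apply: lt_le_trans r1.
have [A0 cA] := hc; have [B0 dB] := hd.
have [AB0|ABn0] := eqVneq (A + B) 0.
  have [a0 b0] : A = 0 /\ B = 0 by split; lra.
  rewrite a0 in hc; rewrite b0 in hd; rewrite (bd_zero r0 hc) (bd_zero r0 hd) AB0.
  by under eq_fun do rewrite addr0; exact: bd0.
have AB : 0 < A + B by rewrite lt_neqAle eq_sym ABn0 addr_ge0.
have [a0|an0] := eqVneq A 0.
  rewrite a0 in hc *; rewrite (bd_zero r0 hc) add0r.
  by under eq_fun do rewrite add0r.
have [b0|bn0] := eqVneq B 0.
  rewrite b0 in hd *; rewrite (bd_zero r0 hd) addr0.
  by under eq_fun do rewrite addr0.
have Ap : 0 < A by rewrite lt_neqAle eq_sym an0.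
have Bp : 0 < B by rewrite lt_neqAle eq_sym bn0.
split; first exact: ltW.
move=> s us; pose t := A / (A + B).
have t01 : 0 <= t <= 1.
  by rewrite divr_ge0 ?(ltW AB)//= ler_pdivrMr// mul1r lerDl.
have t1 : 1 - t = B / (A + B) by rewrite /t; field.
have key n : nc (c n + d n) `^ r <=
    (A + B) `^ r * (t * (nc (c n) `^ r / A `^ r) + (1 - t) * (nc (d n) `^ r / B `^ r)).
  have q k x : 0 <= x -> 0 < k -> x `^ r / k `^ r = (x / k) `^ r.
    move=> x0 k0; have kr0 : k `^ r != 0 by rewrite gt_eqF ?powR_gt0.
    apply: (mulIf kr0); rewrite divfK// -powRM ?divr_ge0 ?(ltW k0)//.
    by rewrite divfK// gt_eqF.
  rewrite !q ?nc_ge0//.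
  apply: (@le_trans _ _ ((A + B) `^ r * ((t * (nc (c n) / A) + (1 - t) * (nc (d n) / B)) `^ r))).
    rewrite -powRM ?(ltW AB)//; last first.
      by rewrite addr_ge0// mulr_ge0 ?divr_ge0 ?nc_ge0// ?(ltW Ap) ?(ltW Bp)//; lra.
    rewrite ge0_ler_powR ?nnegrE ?nc_ge0// ?(ltW r0)//.
      by rewrite mulr_ge0 ?(ltW AB)// addr_ge0// mulr_ge0 ?divr_ge0 ?nc_ge0// ?(ltW Ap) ?(ltW Bp)//; lra.
    apply: le_trans (ncD _ _) _; rewrite t1 /t le_eqVlt; apply/orP; left; apply/eqP.
    by field; rewrite ABn0 an0 bn0.
  rewrite ler_pM2l ?powR_gt0//; apply: powR_convex => //; by rewrite divr_ge0 ?nc_ge0 ?ltW.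
apply: le_trans (ler_sum _ (fun n _ => key n)) _.
rewrite -mulr_sumr -[leRHS]mulr1 ler_pM2l ?powR_gt0// big_split /=.
rewrite -!mulr_sumr -!mulr_suml.
have ub k (u : int -> C) : 0 < k -> (\sum_(n <- s) nc (u n) `^ r <= k `^ r) ->
    \sum_(n <- s) nc (u n) `^ r / k `^ r <= 1.
  by move=> k0 h; rewrite -mulr_suml ler_pdivrMr ?powR_gt0// mul1r.
have h1 := ub _ _ Ap (cA s us); have h2 := ub _ _ Bp (dB s us).
rewrite -mulr_suml in h1; rewrite -mulr_suml in h2.
case/andP: t01 => t0 t1'; nra.
Qed.

Lemma bdZ r a c A : 0 <= r -> bd r c A -> bd r (fun n => a * c n) (nc a * A).
Proof.
move=> r0 [A0 h]; split; first by rewrite mulr_ge0 ?nc_ge0.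
move=> s us; rewrite powRM ?nc_ge0//.
under eq_bigr do rewrite ncM powRM ?nc_ge0//.
by rewrite -mulr_sumr ler_wpM2l ?powR_ge0 ?h.
Qed.

Lemma bdN r c A : bd r c A -> bd r (fun n => - c n) A.
Proof. by move=> [A0 h]; split => // s us; under eq_bigr do rewrite ncN; exact: h. Qed.

Lemma bdB r c d A B : 1 <= r -> bd r c A -> bd r d B ->
  bd r (fun n => c n - d n) (A + B).
Proof. by move=> r1 hc /bdN hd; exact: (bdD r1 hc hd). Qed.

Lemma bd_shift r c A k : bd r c A -> bd r (fun n => c (n - k)) A.
Proof.
move=> [A0 h]; split => // s us; rewrite -(big_map (fun n => n - k) xpredT (fun n => nc (c n) `^ r)).
by apply: h; rewrite map_inj_uniq// => x y /addIr.
Qed.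

Lemma powR2 (x : R) : 0 <= x -> x `^ 2 = x ^+ 2.
Proof. by move=> x0; rewrite powR_mulrn. Qed.

(** Every coefficient is at most A in modulus, so |c|^q <= A^(q - 2) |c|^2. This is how L^2
    estimates become A_q estimates. *)
Lemma bd2q q c A : 2 <= q -> bd 2 c A -> bd q c A.
Proof.
move=> q2 hc; have [A0 h] := hc; split => // s us.
have q0 : 0 < q by apply: lt_le_trans q2.
have E x : 0 <= x -> x `^ q = x `^ (q - 2) * x `^ 2.
  by move=> x0; rewrite -powRD ?subrK// gt_eqF ?implyTb //= gt_eqF.
rewrite E//; apply: (@le_trans _ _ (\sum_(n <- s) A `^ (q - 2) * nc (c n) `^ 2)).
  apply: ler_sum => n _; rewrite E ?nc_ge0// ler_wpM2r ?powR_ge0//.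
  rewrite ge0_ler_powR ?nnegrE ?nc_ge0 ?subr_ge0//.
  exact: bd_coef hc.
by rewrite -mulr_sumr ler_wpM2l ?powR_ge0// h.
Qed.

Lemma bd_closed r c M : 0 < r -> 0 <= M -> (forall e, 0 < e -> bd r c (M + e)) ->
  bd r c M.
Proof.
move=> r0 M0 h; split => // s us; rewrite leNgt; apply/negP => lt.
set X := \sum_(n <- s) _ in lt.
have X0 : 0 <= X by apply: sumr_ge0 => *; exact: powR_ge0.
have lt' : M < X `^ r^-1.
  have := gt0_ltr_powR _ _ _ lt => /(_ r^-1); rewrite -powRrM divff ?gt_eqF// powRr1//.
  by apply; rewrite ?invr_gt0 ?nnegrE ?powR_ge0.
pose e := (X `^ r^-1 - M) / 2.
have e0 : 0 < e by rewrite divr_gt0 ?subr_gt0.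
have [_ /(_ s us)] := h _ e0; apply/negP; rewrite -ltNge -/X.
have -> : X = (X `^ r^-1) `^ r by rewrite -powRrM mulVf ?powRr1// gt_eqF.
by rewrite gt0_ltr_powR ?nnegrE ?powR_ge0// /e; lra.
Qed.

(** Only finite sums have to be bounded. On a finite set of indices a sufficiently small uniform
    error has l_r norm at most e, and Minkowski gives M + e there. All limits in A_p and A_q pass
    through this lemma. *)
Lemma bd_approx r c M : 1 <= r -> 0 <= M ->
  (forall e, 0 < e -> exists d, bd r d M /\ forall n, nc (c n - d n) <= e) ->
  bd r c M.
Proof.
move=> r1 M0 h; have r0 : 0 < r by apply: lt_le_trans r1.
apply: bd_closed => // e e0; split; first by rewrite addr_ge0// ltW.
move=> s us; pose k := (size s).+1%:R : R.
have k0 : 0 < k by rewrite ltr0n.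
have [d [hd cd]] := h (e / k) (divr_gt0 e0 k0).
pose u n := if n \in s then c n - d n else 0.
have hu : bd r u e.
  split; first exact: ltW.
  move=> s' us'.
  apply: (@le_trans _ _ (\sum_(n <- [seq n <- s' | n \in s]) (e / k) `^ r)).
    rewrite big_filter [leRHS]big_mkcond /=; apply: ler_sum => n _; rewrite /u.
    case: ifP => _; last by rewrite nc0 powR0// gt_eqF.
    by rewrite ge0_ler_powR ?nnegrE ?nc_ge0// ?(ltW r0)// divr_ge0// ltW.
  rewrite big_tnth sumr_const -mulr_natr card_ord.
  have sz : (size [seq n <- s' | n \in s] <= size s)%N.
    by apply: uniq_leq_size; [exact: filter_uniq|move=> n; rewrite mem_filter => /andP[]].
  apply: (@le_trans _ _ ((e / k) `^ r * k)).
    by rewrite ler_wpM2l ?powR_ge0// ler_nat ltnW// ltnS.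
  rewrite powRM ?invr_ge0 ?(ltW e0) ?(ltW k0)// -mulrA -[leRHS]mulr1 ler_wpM2l ?powR_ge0//.
  have -> : k^-1 `^ r = k^-1 * k^-1 `^ (r - 1).
    have kn : k^-1 != 0 by rewrite invr_eq0 gt_eqF.
    have := @powRD _ k^-1 1 (r - 1); rewrite kn implybT addrC subrK => /(_ isT) ->.
    by rewrite powRr1// invr_ge0 ltW.
  rewrite mulrAC mulVf ?gt_eqF// mul1r.
  apply: (@le_trans _ _ (1 `^ (r - 1))); last by rewrite powR1.
  rewrite ge0_ler_powR ?nnegrE ?invr_ge0 ?subr_ge0 ?(ltW k0)//.
  by rewrite invf_le1 // /k ler1n.
have [_ /(_ s us)] := bdD r1 hd hu.
rewrite [X in X <= _ -> _](_ : _ = \sum_(n <- s) nc (c n) `^ r)//.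
by apply: eq_big_seq => n ns; rewrite /u ns addrC subrK.
Qed.

Lemma bd_supp r (l : seq int) c M : 0 < r -> 0 <= M -> uniq l ->
  (forall n, n \notin l -> c n = 0) -> \sum_(n <- l) nc (c n) `^ r <= M `^ r ->
  bd r c M.
Proof.
move=> r0 M0 ul c0 h; split => // s us; apply: le_trans h.
rewrite (bigID (mem l)) /= [X in _ + X]big1 ?addr0; last first.
  by move=> n nl; rewrite c0// nc0 powR0// gt_eqF.
have P : perm_eq [seq n <- s | n \in l] [seq n <- l | n \in s].
  apply: uniq_perm; rewrite ?filter_uniq// => n.
  by rewrite !mem_filter andbC.
rewrite -big_filter (perm_big _ P) /= big_filter big_mkcond /=.
by apply: ler_sum => n _; case: ifP => // _; exact: powR_ge0.
Qed.

End SequenceNorms.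

(** * Trigonometric polynomials: degrees, multipliers, dilations *)

Section TrigPolynomials.
Variable R : realType.
Local Notation T := (circle R).
Local Notation C := R[i].
Local Notation nc := Normc.normc.
Implicit Types (f g h : T -> C).

Definition hat f (n : int) : C := mean (fun t => f t * chi (- n) t).

Arguments hat : simpl never.

Lemma hat_0 f : hat f 0 = mean f.
Proof.
by congr mean; apply/funext => t; rewrite oppr0 chi0 mulr1.
Qed.

Lemma hatD f g n : ct f -> ct g -> hat (fun t => f t + g t) n = hat f n + hat g n.
Proof.
move=> cf cg; rewrite /hat -meanD; try exact: ctM (ct_chi _ _).
by congr mean; apply/funext => t; rewrite mulrDl.
Qed.

Lemma hatZ a f n : ct f -> hat (fun t => a * f t) n = a * hat f n.
Proof.
move=> cf; rewrite /hat -meanZ; try exact: ctM (ct_chi _ _).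
by congr mean; apply/funext => t; rewrite mulrA.
Qed.

Lemma ctZ a f : ct f -> ct (fun t => a * f t).
Proof. by move=> cf; exact: ctM (ct_cst a) cf. Qed.

Lemma hatB f g n : ct f -> ct g -> hat (fun t => f t - g t) n = hat f n - hat g n.
Proof.
move=> cf cg; have := hatD n cf (ctZ (-1) cg); rewrite hatZ// mulN1r => <-.
by congr (hat _ n); apply/funext => t; rewrite mulN1r.
Qed.

Lemma ctB f g : ct f -> ct g -> ct (fun t => f t - g t).
Proof.
move=> cf cg; have := ctD cf (ctZ (-1) cg).
by under eq_fun do rewrite mulN1r.
Qed.

Lemma hat_sum (I : Type) (s : seq I) (F : I -> T -> C) n :
  (forall i, ct (F i)) -> hat (fun t => \sum_(i <- s) F i t) n = \sum_(i <- s) hat (F i) n.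
Proof.
move=> cF; rewrite /hat -mean_sum.
  by congr mean; apply/funext => t; rewrite mulr_suml.
by move=> i; exact: ctM (ct_chi _ _).
Qed.

Lemma hat_chiM k f n : hat (fun t => chi k t * f t) n = hat f (n - k).
Proof.
by congr mean; apply/funext => t; rewrite opprB addrC chiD; ring.
Qed.

Lemma hat_chi k n : hat (chi k) n = (k == n)%:R.
Proof.
rewrite -[RHS]/((k == n)%:R) -subr_eq0 -mean_chi; congr mean.
by apply/funext => t; rewrite -chiD.
Qed.

Lemma mean_conj f : ct f -> mean (fun t => (f t)^*%C) = (mean f)^*%C.
Proof.
move=> [cr ci]; rewrite /mean /circle_integral.
have -> : repull (fun t => (f t)^*%C) = repull f.
  by apply/funext => x; rewrite /repull; case: (f _).
have -> : impull (fun t => (f t)^*%C) = fun x => (-1) * impull f x + 0 * impull f x.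
  by apply/funext => x; rewrite /impull; case: (f _) => a b /=; ring.
rewrite -![Rintegral _ _ _]/(IR _) IR_lin//.
by apply/eqP; rewrite eq_complex /=; apply/andP; split; apply/eqP; ring.
Qed.

Lemma nc_hat f n M : ct f -> (forall t, nc (f t) <= M) -> nc (hat f n) <= M.
Proof.
move=> cf fM; apply: nc_mean; first exact: ctM (ct_chi _ _).
by move=> t; rewrite ncM nc_chi mulr1.
Qed.

Lemma ct_nc2 f : ct f -> ct (fun t => (nc (f t) ^+ 2)%:C).
Proof.
move=> cf; have := ctM cf (ct_conj cf).
by under eq_fun do rewrite mul_conjc.
Qed.

(** The mean of |f - P|^2 is nonnegative for the partial sum P over [s], and it equals the mean of
    |f|^2 minus the sum Q of the squared coefficients. *)
Lemma bessel f M : ct f -> 0 <= M ->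
  complex.Re (mean (fun t => (nc (f t) ^+ 2)%:C)) <= M ^+ 2 -> bd 2 (hat f) M.
Proof.
move=> cf M0 fM; split => // s us; rewrite powR2//.
under eq_bigr do rewrite powR2 ?nc_ge0//.
apply: le_trans fM.
pose P t := \sum_(n <- s) hat f n * chi n t.
have cc n : ct (chi n : T -> C) by exact: ct_chi.
have cP : ct P by apply: ct_sum => n; exact: ctZ.
set Q := \sum_(n <- s) _.
have H0 : mean (fun t => (nc (f t - P t) ^+ 2)%:C) =
    mean (fun t => (nc (f t) ^+ 2)%:C) - Q%:C.
  have fP : mean (fun t => f t * (P t)^*%C) = Q%:C.
    have -> : (fun t => f t * (P t)^*%C) =
        fun t => \sum_(n <- s) (hat f n)^*%C * (f t * chi (- n) t).
      apply/funext => t; rewrite /P conjc_sum mulr_sumr; apply: eq_bigr => n _.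
      by rewrite conjcM chi_conj; ring.
    rewrite mean_sum; last by move=> n; apply/ctZ/ctM.
    rewrite /Q rmorph_sum; apply: eq_bigr => n _ /=.
    by rewrite meanZ ?[_ * mean _]mulrC -/(hat f n) ?mul_conjc//; exact: ctM.
  have Pf : mean (fun t => P t * (f t)^*%C) = Q%:C.
    have -> : (fun t => P t * (f t)^*%C) = fun t => (f t * (P t)^*%C)^*%C.
      by apply/funext => t; rewrite conjcM conjcK mulrC.
    by rewrite mean_conj ?fP ?conjc_real//; exact: ctM (ct_conj _).
  have PP : mean (fun t => P t * (P t)^*%C) = Q%:C.
    have -> : (fun t => P t * (P t)^*%C) =
        fun t => \sum_(n <- s) (hat f n)^*%C * (P t * chi (- n) t).
      apply/funext => t; rewrite {2}/P conjc_sum mulr_sumr; apply: eq_bigr => n _.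
      by rewrite conjcM chi_conj; ring.
    rewrite mean_sum; last by move=> n; apply/ctZ/ctM.
    rewrite /Q rmorph_sum; apply: eq_big_seq => n ns /=.
    rewrite meanZ -/(hat P n); last exact: ctM.
    rewrite [RHS](_ : _ = (hat f n)^*%C * hat f n); last by rewrite [RHS]mulrC mul_conjc.
    congr (_ * _); rewrite /P hat_sum; last by move=> m; exact: ctZ.
    under eq_bigr do rewrite hatZ// hat_chi.
    rewrite (bigD1_seq n)//= eqxx mulr1 big1 ?addr0// => m /negPf ->.
    by rewrite mulr0.
  have -> : (fun t => (nc (f t - P t) ^+ 2)%:C) = (fun t =>
     ((nc (f t) ^+ 2)%:C - f t * (P t)^*%C) - (P t * (f t)^*%C - P t * (P t)^*%C)).
    by apply/funext => t; rewrite -!mul_conjc conjcB; ring.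
  have c1 := ct_nc2 cf; have c2 := ctM cf (ct_conj cP).
  have c3 := ctM cP (ct_conj cf); have c4 := ctM cP (ct_conj cP).
  rewrite meanB; [|exact: ctB|exact: ctB].
  by rewrite !meanB// fP Pf PP subrr subr0.
have H1 : 0 <= complex.Re (mean (fun t => (nc (f t - P t) ^+ 2)%:C)).
  have := @mean_le R (fun=> 0) (fun t => nc (f t - P t) ^+ 2).
  rewrite mean_cst; apply; [exact: ct_cst|exact/ct_nc2/ctB|].
  by move=> t; rewrite sqr_ge0.
move: H1; rewrite H0 ReDc -[complex.Re (- _)]/(- Q) subr_ge0; apply.
Qed.

(** Degree at most N, generated one term at a time (frequencies may repeat) so that properties
    follow by induction; [tp_expand] recovers the Fourier expansion. *)
Inductive tp (N : nat) : (T -> C) -> Prop :=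
| Tp0 : tp N (fun=> 0)
| TpS f a n : tp N f -> (absz n <= N)%N -> tp N (fun t => f t + a * chi n t).

Lemma tp_ct N f : tp N f -> ct f.
Proof.
elim=> [|{}f a n _ IH _]; first exact: ct_cst.
exact: ctD (ctZ _ (ct_chi _ _)).
Qed.

Lemma tp_le N N' f : (N <= N')%N -> tp N f -> tp N' f.
Proof.
move=> le; elim=> [|{}f a n _ IH nN]; first exact: Tp0.
by apply: TpS => //; exact: leq_trans le.
Qed.

Lemma tpD N f g : tp N f -> tp N g -> tp N (fun t => f t + g t).
Proof.
move=> hf; elim=> [|{}g a n _ IH nN]; first by under eq_fun do rewrite addr0.
by under eq_fun do rewrite addrA; exact: TpS.
Qed.

Lemma tpZ N a f : tp N f -> tp N (fun t => a * f t).
Proof.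
elim=> [|{}f b n _ IH nN]; first by under eq_fun do rewrite mulr0; exact: Tp0.
by under eq_fun do rewrite mulrDr mulrA; exact: TpS.
Qed.

Lemma tp_chi n : tp (absz n) (chi n).
Proof.
have := TpS 1 (Tp0 (absz n)) (leqnn (absz n)).
by under eq_fun do rewrite add0r mul1r.
Qed.

Lemma tp_cst a : tp 0 (fun=> a).
Proof.
have := tpZ a (tp_chi 0).
by under eq_fun do rewrite chi0 mulr1.
Qed.

Lemma tpM N N' f g : tp N f -> tp N' g -> tp (N + N') (fun t => f t * g t).
Proof.
move=> hf; elim=> [|{}g a n _ IH nN'].
  by under eq_fun do rewrite mulr0; exact: Tp0.
under eq_fun do rewrite mulrDr; apply: tpD => {IH}//.
elim: hf => [|{}f b k _ IH' kN]; first by under eq_fun do rewrite mul0r; exact: Tp0.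
rewrite (_ : (fun t => _) = fun t => f t * (a * chi n t) + (b * a) * chi (k + n) t).
  by apply: TpS => //; lia.
by apply/funext => t; rewrite chiD; ring.
Qed.

Lemma tp_dil N D f : tp N f -> tp (D * N) (fun t => f (dil D t)).
Proof.
elim=> [|{}f a n _ IH nN]; first exact: Tp0.
by under eq_fun do rewrite chi_dil; apply: TpS => //; rewrite abszM leq_mul.
Qed.

Lemma tp_hat0 N f n : tp N f -> (N < absz n)%N -> hat f n = 0.
Proof.
move=> hf Nn; elim: hf => [|{}f a k hf IH kN].
  by rewrite /hat; under eq_fun do rewrite mul0r; exact: mean0.
have ck : ct (chi k : T -> C) by exact: ct_chi.
rewrite hatD ?hatZ ?IH ?add0r ?hat_chi//; [|exact: tp_ct hf|exact: ctZ].
by case: eqP => [kn|_]; rewrite ?mulr0//; lia.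
Qed.

Definition rng (N : nat) : seq int := [seq i%:Z - N%:Z | i <- iota 0 (N.*2.+1)].

Lemma rng_uniq N : uniq (rng N).
Proof. by rewrite map_inj_uniq ?iota_uniq// => i j /addIr []. Qed.

Lemma mem_rng N n : (n \in rng N) = (absz n <= N)%N.
Proof.
apply/mapP/idP => [[j]|nN].
  by rewrite mem_iota => /andP[_ h] ->; lia.
by exists (absz (n + N%:Z)); rewrite ?mem_iota; lia.
Qed.

Lemma tp_expand N f : tp N f -> f = fun t => \sum_(n <- rng N) hat f n * chi n t.
Proof.
elim=> [|{}f a k hf IH kN].
  apply/funext => t; rewrite big1// => n _.
  by rewrite /hat; under eq_fun do rewrite mul0r; rewrite mean0 mul0r.
apply/funext => t; rewrite {1}IH.
have ck : ct (chi k : T -> C) by exact: ct_chi.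
under [in RHS]eq_bigr do
  rewrite (hatD _ (tp_ct hf) (ctZ a ck)) hatZ// hat_chi mulrDl.
rewrite big_split /=; congr (_ + _).
rewrite (bigD1_seq k) ?rng_uniq ?mem_rng//= eqxx mulr1 big1 ?addr0// => m mk.
by rewrite eq_sym (negPf mk) mulr0 mul0r.
Qed.

Lemma tp_trigpoly N f : tp N f -> trigpoly f.
Proof. by move=> hf; exists (rng N), (hat f); exact: tp_expand hf. Qed.

Lemma trigpoly_tp f : trigpoly f -> exists N, tp N f.
Proof.
move=> [s [c ->]]; elim: s => [|n s [N IH]].
  by exists 0%N; under eq_fun do rewrite big_nil; exact: Tp0.
exists (N + absz n)%N; under eq_fun do rewrite big_cons.
by apply: tpD; [apply: tpZ; apply: tp_le (tp_chi n)|apply: tp_le IH]; lia.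
Qed.

Lemma tp_bounded N f : tp N f -> exists2 M, 0 <= M & forall t, nc (f t) <= M.
Proof.
elim=> [|{}f a n _ [M M0 IH] _]; first by exists 0 => // t; rewrite nc0.
exists (M + nc a); first by rewrite addr_ge0 ?nc_ge0.
by move=> t; apply: le_trans (ncD _ _) _; rewrite ncM nc_chi mulr1 lerD.
Qed.

(* Young's inequality for convolution with a trigonometric polynomial. *)
Lemma tp_multiplier N P : tp N P -> exists2 L, 0 <= L &
  forall r g M, 1 <= r -> ct g -> bd r (hat g) M -> bd r (hat (fun t => P t * g t)) (L * M).
Proof.
elim=> [|{}P a n hP [L L0 IH] nN].
  exists 0 => // r g M r1 cg _; rewrite mul0r.
  rewrite (_ : hat _ = fun=> 0); first by apply: bd0; exact: lt_le_trans r1.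
  apply/funext => n; rewrite /hat (_ : (fun t => _) = fun=> 0) ?mean0//.
  by apply/funext => t; rewrite !mul0r.
exists (L + nc a); first by rewrite addr_ge0 ?nc_ge0.
move=> r g M r1 cg hg; rewrite mulrDl.
have r0 : 0 < r by apply: lt_le_trans r1.
have cc : ct (chi n : T -> C) by exact: ct_chi.
rewrite (_ : hat _ = fun m => hat (fun t => P t * g t) m + a * hat g (m - n)).
  by apply: bdD => //; [exact: IH|apply: bdZ; [exact: ltW|exact: bd_shift]].
apply/funext => m; rewrite -hat_chiM -hatZ; last exact: ctM.
rewrite -hatD; [|exact: ctM (tp_ct hP) cg|exact/ctZ/ctM].
by congr (hat _ m); apply/funext => t; ring.
Qed.

Lemma hat_tensor N N' D f h n : tp N f -> tp N' h ->
  hat (fun t => f t * h (dil D t)) n =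
  \sum_(k <- rng N') hat h k * hat f (n - D%:Z * k).
Proof.
move=> hf hh; have cc k : ct (chi k : T -> C) by exact: ct_chi.
rewrite {1}(tp_expand hh).
rewrite (_ : (fun t => _) =
  fun t => \sum_(k <- rng N') hat h k * (chi (D%:Z * k) t * f t)); last first.
  apply/funext => t; rewrite mulr_sumr; apply: eq_bigr => k _.
  by rewrite chi_dil; ring.
have cf := tp_ct hf.
rewrite hat_sum => [|k]; last exact/ctZ/ctM.
by apply: eq_bigr => k _; rewrite hatZ ?hat_chiM//; exact: ctM.
Qed.

(* Since 2N < D, every frequency of the product is m + Dk for a unique pair of
   frequencies m of f and k of h. *)
Lemma bd_tensor r N N' D f h A B : 1 <= r -> tp N f -> tp N' h -> (N.*2 < D)%N ->
  bd r (hat f) A -> bd r (hat h) B ->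
  bd r (hat (fun t => f t * h (dil D t))) (A * B).
Proof.
move=> r1 hf hh ND [A0 hA] [B0 hB].
have r0 : 0 < r by apply: lt_le_trans r1.
split; first exact: mulr_ge0.
move=> s us; rewrite powRM//.
apply: (@le_trans _ _ (\sum_(n <- s) \sum_(k <- rng N')
    nc (hat h k) `^ r * nc (hat f (n - D%:Z * k)) `^ r)).
  apply: ler_sum => n _; rewrite (hat_tensor _ _ hf hh).
  have [[k kN' hk]|none] :=
      pselect (exists2 k, k \in rng N' & hat f (n - D%:Z * k) != 0).
    have uk j : j != k -> hat f (n - D%:Z * j) = 0.
      move=> jk; apply: (tp_hat0 hf).
      have kN : (absz (n - D%:Z * k)%R <= N)%N.
        by rewrite leqNgt; apply: contra hk => /(tp_hat0 hf) ->.
      have : (absz (D%:Z * (k - j))%R <= N + absz (n - D%:Z * j)%R)%N.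
        by rewrite mulrBr; lia.
      rewrite abszM absz_nat; move/eqP: jk; nia.
    rewrite (bigD1_seq k) ?rng_uniq//= big1 ?addr0; last first.
      by move=> j /uk ->; rewrite mulr0.
    rewrite ncM powRM ?nc_ge0// [leRHS](bigD1_seq k) ?rng_uniq//= lerDl.
    by apply: sumr_ge0 => *; rewrite mulr_ge0 ?powR_ge0.
  rewrite big1_seq ?nc0 ?powR0 ?gt_eqF//.
    by apply: sumr_ge0 => *; rewrite mulr_ge0 ?powR_ge0.
  move=> k /= kN'; have [->|hk] := eqVneq (hat f (n - D%:Z * k)) 0; first by rewrite mulr0.
  by exfalso; apply: none; exists k.
rewrite exchange_big /=.
apply: (@le_trans _ _ (\sum_(k <- rng N') nc (hat h k) `^ r * A `^ r)).
  apply: ler_sum => k _; rewrite -mulr_sumr ler_wpM2l ?powR_ge0//.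
  by have [_] := bd_shift (D%:Z * k) (conj A0 hA); apply.
by rewrite -mulr_suml mulrC ler_wpM2l ?powR_ge0// hB// rng_uniq.
Qed.

(** For k != 0 the frequency D k lies outside the spectrum of [p], so only the constant term of [h]
    contributes. *)
Lemma mean_tensor N N' D p h : tp N p -> tp N' h -> (N < D)%N ->
  mean (fun t => p t * h (dil D t)) = mean p * mean h.
Proof.
move=> hp hh ND; rewrite -!hat_0 (hat_tensor _ _ hp hh).
rewrite (bigD1_seq 0) ?rng_uniq ?mem_rng//= mulr0 subr0 mulrC big1 ?addr0//.
move=> k k0; rewrite (tp_hat0 hp) ?mulr0// sub0r abszN abszM absz_nat.
by move/eqP: k0; nia.
Qed.

Lemma mean_dil N D f : tp N f -> (0 < D)%N -> mean (fun t => f (dil D t)) = mean f.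
Proof.
move=> hf D0; have := mean_tensor (tp_cst 1) hf D0.
by rewrite mean_cst mul1r; under eq_fun do rewrite mul1r.
Qed.

Lemma bd_dil r N D f A : 1 <= r -> tp N f -> (0 < D)%N -> bd r (hat f) A ->
  bd r (hat (fun t => f (dil D t))) A.
Proof.
move=> r1 hf D0 hA; have r0 : 0 < r by apply: lt_le_trans r1.
have h1 : bd r (hat (fun=> 1 : C)) 1.
  apply: (@bd_supp _ _ [:: 0]) => //.
    move=> n; rewrite inE => n0; apply: (tp_hat0 (tp_cst 1)).
    by rewrite lt0n absz_eq0.
  by rewrite big_seq1 hat_0 mean_cst nc1.
have := bd_tensor r1 (tp_cst 1) hf D0 h1 hA; rewrite mul1r.
by under eq_fun do rewrite mul1r.
Qed.

End TrigPolynomials.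

(** * Elementary inequalities and interpolation weights *)

Section ElementaryInequalities.
Variable R : realType.
Implicit Types x y : R.

Lemma sin_abs_le y : `|sin y| <= `|y|.
Proof.
wlog y0 : y / 0 <= y => [W|].
  have [|/ltW y0] := leP 0 y; first exact: W.
  by rewrite -normrN -sinN -[leRHS]normrN; apply: W; rewrite oppr_ge0.
have [|c _] := @MVT_segment R sin cos 0 y y0 (fun x _ => is_derive_sin x).
  by apply: continuous_subspaceT; exact: continuous_sin.
rewrite sin0 !subr0 => ->; rewrite normrM ler_piMl//.
by rewrite ler_norml cos_geN1 cos_le1.
Qed.

Lemma cos_sub1_le y : 1 - cos y <= y ^+ 2 / 2.
Proof.
have -> : cos y = 1 - 2 * sin (y / 2) ^+ 2.
  have {1}-> : y = y / 2 + y / 2 by field.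
  by rewrite cosD -!expr2 cos2sin2; ring.
have : sin (y / 2) ^+ 2 <= (y / 2) ^+ 2.
  by rewrite -real_normK ?num_real// -[leRHS]real_normK ?num_real// ler_pXn2r ?nnegrE// sin_abs_le.
by rewrite expr_div_n; lra.
Qed.

Lemma sin_sub_le y : `|sin y - y| <= `|y| ^+ 3 / 2.
Proof.
wlog y0 : y / 0 <= y => [W|].
  have [|/ltW y0] := leP 0 y; first exact: W.
  have -> : sin y - y = - (sin (- y) - (- y)) by rewrite sinN; ring.
  by rewrite normrN -[`|y|]normrN; apply: W; rewrite oppr_ge0.
have dh (x : R) : is_derive x 1 (fun x => sin x - x) (cos x - 1).
  by apply: is_deriveB.
have [|c] := @MVT_segment R (fun x => sin x - x) (fun x => cos x - 1) 0 y y0 (fun x _ => dh x).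
  apply: continuous_subspaceT => x.
  exact/differentiable_continuous/derivable1_diffP/(@ex_derive _ _ _ _ _ _ _ (dh x)).
rewrite in_itv /= sin0 !subr0 => /andP[c0 cy] ->.
rewrite normrM (ger0_norm y0) distrC ger0_norm ?subr_ge0 ?cos_le1//.
rewrite exprSr mulrAC ler_wpM2r//; apply: le_trans (cos_sub1_le c) _.
by rewrite ler_pM2r// ler_pXn2r ?nnegrE.
Qed.

(* [expR (- y / 2) >= 1 - y / 2], squared and inverted. *)
Lemma expR_le_quad y : `|y| <= 1 / 5 -> expR y <= 1 + y + 7 / 8 * y ^+ 2.
Proof.
rewrite ler_norml => /andP[y1 y2].
have h : 1 - y / 2 <= expR (- (y / 2)) by apply: le_trans (expR_ge1Dx _); lra.
have e : expR y * expR (- (y / 2)) ^+ 2 = 1.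
  by rewrite expr2 -!expRD -[RHS]expR0; congr expR; field.
have h2 : (1 - y / 2) ^+ 2 <= expR (- (y / 2)) ^+ 2.
  by rewrite ler_pXn2r ?nnegrE ?expR_ge0//; lra.
have p0 : 0 < (1 - y / 2) ^+ 2 by rewrite exprn_gt0//; lra.
rewrite -(ler_pM2r p0); apply: (@le_trans _ _ 1).
  by rewrite -[leRHS]e ler_pM2l ?expR_gt0.
nra.
Qed.

(** The weights may be negative, so the sign goes into the square: the sum of |w_i| (z_i - l
    sg(w_i))^2 is nonnegative, and l = B / W gives the inequality. *)
Lemma weighted_cauchy_schwarz (I : finType) (w z : I -> R) :
  (\sum_i w i * z i) ^+ 2 <= (\sum_i `|w i|) * \sum_i `|w i| * z i ^+ 2.
Proof.
set W := \sum_i `|w i|; set A := \sum_i `|w i| * _; set B := \sum_i _.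
have W0 : 0 <= W by exact: sumr_ge0.
have P l : 0 <= A - 2 * l * B + l ^+ 2 * W.
  have -> : A - 2 * l * B + l ^+ 2 * W = \sum_i `|w i| * (z i - l * Num.sg (w i)) ^+ 2.
    rewrite /A /B /W !mulr_sumr -sumrB -big_split /=; apply: eq_bigr => i _.
    have [w0|w0|->] := ltgtP (w i) 0; last by rewrite normr0; ring.
      by rewrite ltr0_norm// ltr0_sg//; ring.
    by rewrite gtr0_norm// gtr0_sg//; ring.
  by apply: sumr_ge0 => i _; rewrite mulr_ge0// sqr_ge0.
have [W00|Wn0] := eqVneq W 0.
  have w0 i : w i = 0.
    apply/eqP; rewrite -normr_eq0; apply/eqP.
    by have := @psumr_eq0P _ _ xpredT (fun i => `|w i|) (fun i _ => normr_ge0 _) W00 i isT.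
  by rewrite /B big1 ?expr0n ?W00 ?mul0r// => i _; rewrite w0 mul0r.
have Wp : 0 < W by rewrite lt_neqAle eq_sym Wn0.
have := P (B / W).
rewrite [X in 0 <= X -> _](_ : _ = (W * A - B ^+ 2) / W); last by field.
by rewrite pmulr_lge0 ?invr_gt0// subr_ge0.
Qed.

Lemma bernoulli x n : 0 <= x <= 1 -> 1 - n%:R * x <= (1 - x) ^+ n.
Proof.
move=> /andP[x0 x1]; elim: n => [|n IH]; first by rewrite mul0r subr0 expr0.
rewrite exprS; apply: (@le_trans _ _ ((1 - x) * (1 - n%:R * x))).
  have : 0 <= n%:R :> R by []. rewrite -addn1 natrD; nra.
by rewrite ler_wpM2l// subr_ge0.
Qed.

Lemma pow_1subx_le x n : 0 < x <= 1 -> (0 < n)%N -> (1 - x) ^+ n <= (n%:R * x)^-1.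
Proof.
move=> /andP[x0 x1] n0; have nx : 0 < n%:R * x by rewrite mulr_gt0 ?ltr0n.
suff : (1 - x) ^+ n * (1 + n%:R * x) <= 1.
  move=> h; rewrite -[leRHS]mul1r ler_pdivlMr//; apply: le_trans h.
  by rewrite ler_wpM2l ?exprn_ge0 ?subr_ge0//; lra.
elim: n {n0 nx} => [|n IH]; first by rewrite expr0 mul0r addr0 mul1r.
rewrite exprS; apply: le_trans IH.
have p : 0 <= (1 - x) ^+ n by rewrite exprn_ge0// subr_ge0.
have n0 : 0 <= n%:R :> R by [].
have nx2 : 0 <= n%:R * x ^+ 2 by rewrite mulr_ge0 ?sqr_ge0.
rewrite mulrAC mulrC ler_wpM2l// -addn1 natrD; nra.
Qed.

Lemma expn_unbounded x (M : R) : 1 < x -> exists n, M <= x ^+ n.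
Proof.
move=> x1; have [n hn] : exists n : nat, M / (x - 1) <= n%:R.
  exists (Num.truncn `|M / (x - 1)|).+1.
  by apply: le_trans (ler_norm _) _; rewrite ltW// truncnS_gt.
exists n; have : 1 + n%:R * (x - 1) <= x ^+ n.
  elim: n {hn} => [|n IH]; first by rewrite expr0 mul0r addr0.
  rewrite exprS; apply: (@le_trans _ _ (x * (1 + n%:R * (x - 1)))).
    have nx2 : 0 <= n%:R * (x - 1) ^+ 2 by rewrite mulr_ge0 ?sqr_ge0.
    by rewrite -addn1 natrD; lra.
  by rewrite ler_wpM2l//; lra.
move: hn; rewrite ler_pdivrMr ?subr_gt0//; lra.
Qed.

Lemma exprn_small x (e : R) : 0 <= x < 1 -> 0 < e -> exists n, x ^+ n <= e.
Proof.
move=> /andP[x0 x1] e0; have [->|xn0] := eqVneq x 0; first by exists 1%N; rewrite expr1 ltW.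
have xp : 0 < x by rewrite lt_neqAle eq_sym xn0.
have [n hn] := @expn_unbounded x^-1 e^-1 (ltac:(by rewrite invf_gt1)).
by exists n; rewrite -[leLHS]invrK -exprVn invf_ple ?posrE ?invr_gt0 ?exprn_gt0 ?invr_gt0.
Qed.

(* The polynomial [(1 - (x / B) ^ n) ^ m] is close to 1 below [x1] and close to
   0 above [x2] when [m] is about [y ^ n] with [1 / x2 < y / B < 1 / x1]. *)
Lemma cutoff_polynomial (x1 x2 B d : R) : 0 < x1 -> x1 < x2 -> x2 <= B -> 0 < d ->
  exists n m : nat, let p x := (1 - (x / B) ^+ n) ^+ m in
    [/\ forall x, 0 <= x <= B -> 0 <= p x <= 1,
        forall x, 0 <= x <= x1 -> 1 - d <= p x
      & forall x, x2 <= x <= B -> p x <= d].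
Proof.
move=> x10 x12 x2B d0.
have B0 : 0 < B by lra.
(* y / B is the inverse of the midpoint of x1 and x2, so that y x1 / B < 1 < y x2 / B. *)
pose y := 2 * B / (x1 + x2).
have y1 : 1 <= y by rewrite /y ler_pdivlMr; lra.
have a1 : 0 <= y * (x1 / B) < 1.
  have -> : y * (x1 / B) = 2 * x1 / (x1 + x2) by rewrite /y; field; lra.
  by rewrite divr_ge0//= ?ltr_pdivrMr; lra.
have a2 : 1 < y * (x2 / B).
  have -> : y * (x2 / B) = 2 * x2 / (x1 + x2) by rewrite /y; field; lra.
  by rewrite ltr_pdivlMr; lra.
have d2 : 0 < d / 2 by lra.
have [n1 h1] := exprn_small a1 d2.
have [n2 h2] := expn_unbounded d^-1 a2.
pose n := (maxn n1 n2).+1; pose m := (Num.truncn (y ^+ n)).+1.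
have yn1 : 1 <= y ^+ n by exact: exprn_ege1.
have m1 : y ^+ n <= m%:R by rewrite ltW// truncnS_gt.
have m2 : m%:R <= 2 * y ^+ n.
  have : (Num.truncn (y ^+ n))%:R <= y ^+ n by rewrite truncn_le; lra.
  by rewrite /m -addn1 natrD; lra.
exists n, m => p.
have u01 x : 0 <= x <= B -> 0 <= (x / B) ^+ n <= 1.
  move=> /andP[x0 xB]; rewrite exprn_ge0 ?divr_ge0 ?(ltW B0)//=.
  by apply: exprn_ile1; rewrite ?divr_ge0 ?(ltW B0)// ler_pdivrMr// mul1r.
split.
- move=> x /u01/andP[v0 v1]; rewrite /p exprn_ge0 ?subr_ge0//=.
  by apply: exprn_ile1; lra.
- move=> x /andP[x0 xx1]; have xB : 0 <= x <= B by lra.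
  apply: le_trans (bernoulli m (u01 _ xB)); rewrite lerD2l lerN2.
  apply: (@le_trans _ _ (2 * (y * (x1 / B)) ^+ n)).
    rewrite [in leRHS]exprMn mulrA ler_pM//; first by rewrite exprn_ge0 ?divr_ge0 ?(ltW B0).
    rewrite ler_pXn2r ?nnegrE ?divr_ge0 ?(ltW B0)// ?(ltW x10)//.
    by rewrite ler_pM2r ?invr_gt0.
  rewrite mulrC -ler_pdivlMr//; apply: le_trans h1; case/andP: a1 => a10 a11.
  by apply: ler_wiXn2l; rewrite ?(leqW (leq_maxl _ _))// ltW.
- move=> x /andP[xx2 xB]; have xx : 0 <= x <= B by lra.
  have v0 : 0 < (x / B) ^+ n by rewrite exprn_gt0// divr_gt0//; lra.
  apply: (le_trans (pow_1subx_le (n := m) _ _)) => //.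
    by rewrite v0; case/andP: (u01 _ xx).
  rewrite invf_ple ?posrE ?mulr_gt0 ?ltr0n//; apply: le_trans h2 _.
  apply: (@le_trans _ _ ((y * (x2 / B)) ^+ n)).
    by apply: ler_weXn2l; rewrite ?(leqW (leq_maxr _ _))// ltW.
  rewrite exprMn ler_pM ?exprn_ge0 ?divr_ge0 ?(ltW B0)//; try lra.
  rewrite ler_pXn2r ?nnegrE ?divr_ge0 ?(ltW B0)//; try lra.
  by rewrite ler_pM2r ?invr_gt0.
Qed.

End ElementaryInequalities.

(** * Weights annihilating moments *)

Section LagrangeWeights.
Variable R : realType.

Lemma bin_le_exp2 n k : ('C(n, k) <= 2 ^ n)%N.
Proof.
have [nk|kn] := ltnP n k; first by rewrite bin_small.
rewrite -[2%N]/(1 + 1)%N expnDn (bigD1 (Ordinal (kn : (k < n.+1)%N)))//=.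
by rewrite !exp1n !muln1 leq_addr.
Qed.

(** With truncated subtraction, [(i - j) + (j - i)] is the distance |i - j|. The product is the
    denominator of the i-th Lagrange polynomial, up to sign and powers of K. *)
Lemma prod_dist (K i : nat) : (i <= K)%N ->
  (\prod_(0 <= j < K.+1 | j != i) ((i - j) + (j - i)) = i`! * (K - i)`!)%N.
Proof.
move=> iK; rewrite (@big_cat_nat _ _ _ i)//=; last exact: leqW.
rewrite [X in (_ * X)%N](@big_cat_nat _ _ _ i.+1)//=.
rewrite [X in (_ * (X * _))%N]big_nat_cond [X in (_ * (X * _))%N]big1 ?mul1n; last first.
  by move=> j /andP[h]; lia.
congr (_ * _)%N.
  rewrite fact_prod big_nat_rev /= add0n big_add1 /= big_nat_cond [RHS]big_nat_cond.
  by apply: eq_big => [j|j h]; lia.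
have e2 : K.+1 = ((K - i).+1 + i)%N by lia.
rewrite fact_prod -[i.+1 in LHS]/(1 + i)%N [in LHS]e2 big_addn addnK.
rewrite big_nat_cond [RHS]big_nat_cond.
by apply: eq_big => [j|j h]; lia.
Qed.

(** Restoring the omitted factor K + i turns the product into K (K + 1) ... (2K), and K <= K + i. *)
Lemma prod_shift (K i : nat) : (0 < K)%N -> (i <= K)%N ->
  (\prod_(0 <= j < K.+1 | j != i) (K + j) * K`! <= (2 * K)`!)%N.
Proof.
move=> K0 iK; rewrite -(@leq_pmul2l (K + i)%N); last by rewrite addn_gt0 K0.
rewrite mulnA.
have -> : ((K + i) * \prod_(0 <= j < K.+1 | j != i) (K + j) = \prod_(0 <= j < K.+1) (K + j))%N.
  by rewrite [RHS](bigD1_seq i) ?iota_uniq//= mem_index_iota.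
rewrite big_nat_recl//= addn0.
rewrite (@fact_split (2 * K) K); last lia.
have -> : (\prod_(K.+1 <= k < (2 * K).+1) k = \prod_(0 <= j < K) (K + j.+1))%N.
  rewrite (_ : (2 * K).+1 = (K + K.+1)%N); last lia.
  rewrite -{1}[K.+1]add0n big_addn addnK; apply: eq_bigr => j _; lia.
set P := (\prod_(_ <= _ < _) _)%N; rewrite [(K`! * P)%N]mulnC mulnA leq_mul2r.
by rewrite leq_mul2r leq_addr !orbT.
Qed.

(* Lagrange interpolation at the nodes [1 + i / K], evaluated at 0. *)
Lemma lagrange_weights (K : nat) : (0 < K)%N -> exists w : 'I_K.+1 -> R,
  \sum_i `|w i| <= 8 ^+ K /\
  forall k, (k <= K)%N -> \sum_i w i * (1 + i%:R / K%:R) ^+ k = (k == 0)%:R.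
Proof.
move=> K0; have KR : 0 < K%:R :> R by rewrite ltr0n.
pose x (l : nat) : R := 1 + l%:R / K%:R.
have xinj : injective x.
  move=> i j /addrI h; apply/eqP; rewrite -(eqr_nat R); apply/eqP.
  by apply: (mulIf _ h); rewrite invr_eq0 gt_eqF.
pose w (i : 'I_K.+1) := (tnth (lagrange K.+1 x) i : {poly R}).[0].
exists w; split; last first.
  move=> k kK; have := lagrange_gen (ltn0Sn K) xinj (p := 'X^k).
  rewrite size_polyXn => /(_ kK)/(congr1 (horner^~ 0)).
  rewrite hornerXn horner_sum expr0n => ->; apply: eq_bigr => i _.
  by rewrite hornerM hornerC hornerXn mulrC.
(* |w_i| is the product over j != i of (K + j) / |i - j|, at most (2K)! / (K! i! (K - i)!) = C(2K,
   K) C(K, i). Summing C(K, i) over i yields the remaining factor 2^K of 8^K. *)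
have bw (i : 'I_K.+1) : `|w i| <= 4 ^+ K * ('C(K, i))%:R.
  have iK : (i <= K)%N by rewrite -ltnS.
  have E : `|w i| * (i`! * (K - i)`!)%:R = (\prod_(0 <= j < K.+1 | j != i) (K + j))%:R.
    rewrite -prod_dist// !natr_prod /w lagrangeE// !hornerE /=.
    rewrite normrM normrV ?unitfE; last first.
      rewrite horner_prod; apply/prodf_neq0 => k ki.
      by rewrite hornerXsubC subr_eq0 (inj_eq xinj) eq_sym.
    rewrite !horner_prod !normr_prod !big_mkord.
    rewrite -prodfV mulrC mulrA -!big_split /=; apply: eq_bigr => j ji.
    rewrite !hornerXsubC /x sub0r normrN.
    have -> : (1 + i%:R / K%:R - (1 + j%:R / K%:R) : R) = (i%:R - j%:R) / K%:R by ring.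
    have -> : 1 + j%:R / K%:R = (K + j)%:R / K%:R :> R.
      by rewrite natrD; field; rewrite gt_eqF.
    have -> : (i - j + (j - i))%:R = `|i%:R - j%:R| :> R.
      have [ij|/ltnW ij] := leqP i j.
        rewrite (eqP ij) add0n natrB// ler0_norm ?opprB// subr_le0 ler_nat//.
      rewrite [X in (_ + X)%N](eqP ij) addn0 natrB// ger0_norm// subr_ge0 ler_nat//.
    rewrite !normrM !normfV !normr_nat.
    have ijn : `|i%:R - j%:R| != 0 :> R by rewrite normr_eq0 subr_eq0 eqr_nat eq_sym.
    by field; rewrite ijn gt_eqF.
  have f0 : 0 < (i`! * (K - i)`! * K`!)%:R :> R by rewrite ltr0n !muln_gt0 !fact_gt0.
  rewrite -(ler_pM2r f0) natrM mulrA E -!natrM.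
  rewrite -[4 in leRHS]/(4%:R) -natrX -!natrM ler_nat.
  apply: leq_trans (prod_shift K0 iK) _.
  have := @bin_fact (2 * K) K; rewrite (_ : (2 * K - K = K)%N); last lia.
  move=> <-; last lia.
  rewrite -(bin_fact iK).
  have := bin_le_exp2 (2 * K) K; rewrite expnM -[(2 ^ 2)%N]/4%N => h.
  by apply: leq_trans (leq_mul h (leqnn _)) _; lia.
apply: le_trans (ler_sum _ (fun i _ => bw i)) _.
rewrite -mulr_sumr -natr_sum.
have -> : (\sum_(i < K.+1) 'C(K, i) = 2 ^ K)%N.
  rewrite -[2%N]/(1 + 1)%N expnDn; apply: eq_bigr => i _.
  by rewrite !exp1n !muln1.
rewrite natrX -exprMn -natrM /=; apply: lexx.
Qed.

End LagrangeWeights.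

(** * Riesz products and their concentration *)

Section RealTrigPolynomials.
Variable R : realType.
Local Notation T := (circle R).
Local Notation C := R[i].
Local Notation nc := Normc.normc.
Implicit Types (u v : T -> R).

Definition cpx u : T -> C := fun t => (u t)%:C.

Definition trp u := exists N, tp N (cpx u).

Definition meanr u : R := complex.Re (mean (cpx u)).

Lemma trp_ct u : trp u -> ct (cpx u).
Proof. by move=> [N /tp_ct]. Qed.

Lemma trp_cst (a : R) : trp (fun=> a).
Proof. by exists 0%N; exact: tp_cst. Qed.

Lemma trpD u v : trp u -> trp v -> trp (fun t => u t + v t).
Proof.
move=> [N hu] [M hv]; exists (N + M)%N.
rewrite (_ : cpx _ = fun t => cpx u t + cpx v t).
  by apply: tpD; [apply: tp_le hu; exact: leq_addr|apply: tp_le hv; exact: leq_addl].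
by apply/funext => t; rewrite /cpx rmorphD.
Qed.

Lemma trpM u v : trp u -> trp v -> trp (fun t => u t * v t).
Proof.
move=> [N hu] [M hv]; exists (N + M)%N.
rewrite (_ : cpx _ = fun t => cpx u t * cpx v t); first exact: tpM.
by apply/funext => t; rewrite /cpx rmorphM.
Qed.

Lemma trpZ a u : trp u -> trp (fun t => a * u t).
Proof. by move=> hu; apply: trpM => //; exact: trp_cst. Qed.

Lemma tp_cpxZ N a u : tp N (cpx u) -> tp N (cpx (fun t => a * u t)).
Proof.
move=> hu; rewrite (_ : cpx _ = fun t => a%:C * cpx u t); first exact: tpZ.
by apply/funext => t; rewrite /cpx rmorphM.
Qed.

Lemma trpB u v : trp u -> trp v -> trp (fun t => u t - v t).
Proof.
move=> hu hv; have := trpD hu (trpZ (-1) hv).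
by under eq_fun do rewrite mulN1r.
Qed.

Lemma trpX n u : trp u -> trp (fun t => u t ^+ n).
Proof.
move=> hu; elim: n => [|n IH]; first by under eq_fun do rewrite expr0; exact: trp_cst.
by under eq_fun do rewrite exprS; exact: trpM.
Qed.

Lemma trp_dil D u : trp u -> trp (fun t => u (dil D t)).
Proof. by move=> [N hu]; exists (D * N)%N; exact: tp_dil hu. Qed.

Lemma trp_sum (I : Type) (s : seq I) (F : I -> T -> R) :
  (forall i, trp (F i)) -> trp (fun t => \sum_(i <- s) F i t).
Proof.
move=> hF; elim: s => [|i s IH]; first by under eq_fun do rewrite big_nil; exact: trp_cst.
by under eq_fun do rewrite big_cons; exact: trpD.
Qed.

Lemma trp_bounded u : trp u -> exists2 M, 0 < M & forall t, `|u t| <= M.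
Proof.
move=> [N hu]; have [M M0 h] := tp_bounded hu.
exists (M + 1); first by rewrite ltr_pwDr.
by move=> t; rewrite -ncR; apply: le_trans (h t) _; rewrite lerDl.
Qed.

Lemma meanr_cst (a : R) : meanr (fun=> a) = a.
Proof. by rewrite /meanr -[cpx _]/(fun=> a%:C) mean_cst. Qed.

Lemma meanrD u v : trp u -> trp v -> meanr (fun t => u t + v t) = meanr u + meanr v.
Proof.
move=> hu hv; rewrite /meanr -ReDc -meanD; try exact: trp_ct.
by congr (complex.Re (mean _)); apply/funext => t; rewrite /cpx rmorphD.
Qed.

Lemma meanrZ a u : trp u -> meanr (fun t => a * u t) = a * meanr u.
Proof.
move=> hu; rewrite /meanr.
rewrite (_ : cpx _ = fun t => a%:C * cpx u t); last first.
  by apply/funext => t; rewrite /cpx rmorphM.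
by rewrite meanZ ?ReMc /= ?mul0r ?subr0//; exact: trp_ct.
Qed.

Lemma meanr_le u v : trp u -> trp v -> (forall t, u t <= v t) -> meanr u <= meanr v.
Proof. by move=> hu hv h; apply: mean_le => //; exact: trp_ct. Qed.

Lemma meanr_sum (I : Type) (s : seq I) (F : I -> T -> R) :
  (forall i, trp (F i)) ->
  meanr (fun t => \sum_(i <- s) F i t) = \sum_(i <- s) meanr (F i).
Proof.
move=> hF; elim: s => [|i s IH].
  by under eq_fun do rewrite big_nil; rewrite meanr_cst big_nil.
under eq_fun do rewrite big_cons.
by rewrite meanrD ?IH ?big_cons//; exact: trp_sum.
Qed.

Lemma meanrE u : trp u -> mean (cpx u) = (meanr u)%:C.
Proof. by move=> hu; rewrite /meanr /cpx mean_real//; exact: trp_ct. Qed.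

Lemma meanr_dil D u : trp u -> (0 < D)%N -> meanr (fun t => u (dil D t)) = meanr u.
Proof.
move=> [N hu] D0; rewrite /meanr; congr complex.Re; exact: mean_dil hu D0.
Qed.

Lemma bessel_sqr u (M : R) : trp u -> 0 <= M -> meanr (fun t => u t ^+ 2) <= M ^+ 2 ->
  bd 2 (hat (cpx u)) M.
Proof.
move=> hu M0 h; apply: bessel => //; first exact: trp_ct.
rewrite (_ : (fun t => _) = cpx (fun t => u t ^+ 2))//.
by apply/funext => t; rewrite /cpx ncR real_normK ?num_real.
Qed.

End RealTrigPolynomials.

Section Tensor.
Variable R : realType.
Local Notation T := (circle R).
Local Notation C := R[i].
Local Notation nc := Normc.normc.

(* The dilates by 9^j of a polynomial of degree at most 8 behave like independent
   random variables. *)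
Fixpoint tens (A : nzRingType) (p : T -> A) (m : nat) (t : T) : A :=
  if m is m'.+1 then p t * tens p m' (dil 9 t) else 1.

Fixpoint tsum (u : T -> R) (m : nat) (t : T) : R :=
  if m is m'.+1 then u t + tsum u m' (dil 9 t) else 0.

Lemma tens_cpx (u : T -> R) m t : (tens u m t)%:C = tens (cpx u) m t.
Proof. by elim: m t => [//|m IH] t; rewrite -[RHS]/(cpx u t * tens (cpx u) m (dil 9 t)) -IH -rmorphM. Qed.

Lemma tp_tens N (p : T -> C) m : tp N p -> exists M, tp M (tens p m).
Proof.
move=> hp; elim: m => [|m [M IH]]; first by exists 0%N; exact: tp_cst.
by eexists; apply: tpM hp (tp_dil 9 IH).
Qed.

Lemma trp_tens (u : T -> R) m : trp u -> trp (tens u m).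
Proof.
move=> [N hu]; have [M h] := tp_tens m hu; exists M.
by rewrite (_ : cpx _ = tens (cpx u) m)//; apply/funext => t; exact: tens_cpx.
Qed.

Lemma meanr_tens N (u : T -> R) m : tp N (cpx u) -> (N < 9)%N ->
  meanr (tens u m) = meanr u ^+ m.
Proof.
move=> hu N9; have tu : trp u by exists N.
elim: m => [|m IH]; first by rewrite expr0 meanr_cst.
have [M hM] := trp_tens m tu.
have E : cpx (tens u m.+1) = fun t => cpx u t * cpx (tens u m) (dil 9 t).
  by apply/funext => t; rewrite /cpx /= rmorphM.
have : mean (cpx (tens u m.+1)) = (meanr u * meanr (tens u m))%:C.
  rewrite E (mean_tensor hu hM)// (meanrE tu) (meanrE (trp_tens m tu)).
  by rewrite -rmorphM.
by move=> E2; rewrite exprS -IH -[LHS]/(complex.Re (mean (cpx (tens u m.+1)))) E2.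
Qed.

Lemma tens_le (u v : T -> R) m t : (forall t, 0 <= u t <= v t) ->
  0 <= tens u m t <= tens v m t.
Proof.
move=> uv; elim: m t => [|m IH] t /=; first by rewrite ler01 lexx.
case/andP: (IH (dil 9 t)) => i1 i2; case/andP: (uv t) => u0 u1.
by rewrite mulr_ge0//= ler_pM.
Qed.

Lemma tens_sqr_expR (u v : T -> R) m t :
  tens (fun t => v t ^+ 2 * expR (u t)) m t = tens v m t ^+ 2 * expR (tsum u m t).
Proof.
elim: m t => [|m IH] t /=; first by rewrite expR0 expr1n mulr1.
by rewrite IH expRD; ring.
Qed.

Lemma tsum_aff (a b : R) u m t :
  tsum (fun t => a * u t + b) m t = a * tsum u m t + m%:R * b.
Proof.
elim: m t => [|m IH] t /=; first by rewrite mulr0 mul0r addr0.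
by rewrite IH -natr1; ring.
Qed.

Definition cs (t : T) : R := complex.Re (chi 1 t).

Lemma cs_le1 t : `|cs t| <= 1.
Proof. by rewrite -(nc_chi 1 t); exact: nc_Re. Qed.

Lemma csE t : (cs t)%:C = (chi 1 t + chi (-1) t) / 2.
Proof.
rewrite -chi_conj /cs; case: (chi 1 t) => a b.
apply: (mulIf (x := 2)); rewrite ?pnatr_eq0// divfK ?pnatr_eq0//.
by apply/eqP; rewrite eq_complex /=; apply/andP; split; apply/eqP; ring.
Qed.

Lemma tp_cs : tp 1 (cpx cs).
Proof.
rewrite (_ : cpx cs = fun t => 2^-1 * (chi 1 t + chi (-1) t)).
  by apply/tpZ/tpD; apply: tp_le (tp_chi _ _).
by apply/funext => t; rewrite /cpx csE mulrC.
Qed.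

Lemma trp_cs : trp cs.
Proof. by exists 1%N; exact: tp_cs. Qed.

Lemma tp_list N (l : seq (C * int)) : all (fun x => (absz x.2 <= N)%N) l ->
  tp N (fun t => \sum_(x <- l) x.1 * chi x.2 t).
Proof.
elim: l => [_|x l IH /= /andP[xN /IH hl]].
  by under eq_fun do rewrite big_nil; exact: Tp0.
under eq_fun do rewrite big_cons.
by apply: tpD => //; apply: tpZ; apply: tp_le (tp_chi _ _).
Qed.

Definition quartic (k0 k1 k2 k3 k4 : R) (x : R) :=
  k0 + k1 * x + k2 * x ^+ 2 + k3 * x ^+ 3 + k4 * x ^+ 4.

Lemma quartic_cs k0 k1 k2 k3 k4 :
  cpx (fun t => quartic k0 k1 k2 k3 k4 (cs t)) = fun t => \sum_(x <- [::
   ((k0 + k2 / 2 + 3 * k4 / 8)%:C, 0);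
   ((k1 / 2 + 3 * k3 / 8)%:C, 1); ((k1 / 2 + 3 * k3 / 8)%:C, -1);
   ((k2 / 4 + k4 / 4)%:C, 2); ((k2 / 4 + k4 / 4)%:C, -2);
   ((k3 / 8)%:C, 3); ((k3 / 8)%:C, -3);
   ((k4 / 16)%:C, 4); ((k4 / 16)%:C, -4)]) x.1 * chi x.2 t.
Proof.
apply/funext => t; rewrite !big_cons big_nil /=.
have zz : chi 1 t * chi (-1) t = 1 :> C by rewrite -chiD chi0.
have e2 : chi 2 t = chi 1 t ^+ 2 :> C by rewrite -[2]/(1 + 1) chiD expr2.
have e3 : chi 3 t = chi 1 t ^+ 3 :> C by rewrite -[3]/(1 + 2) chiD e2 -exprS.
have e4 : chi 4 t = chi 1 t ^+ 4 :> C by rewrite -[4]/(1 + 3) chiD e3 -exprS.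
have n2 : chi (-2) t = chi (-1) t ^+ 2 :> C by rewrite expr2 -chiD.
have n3 : chi (-3) t = chi (-1) t ^+ 3 :> C by rewrite exprS -n2 -chiD.
have n4 : chi (-4) t = chi (-1) t ^+ 4 :> C by rewrite exprS -n3 -chiD.
rewrite e2 e3 e4 n2 n3 n4 chi0 /cpx /quartic.
rewrite !(rmorphD, rmorphM, rmorphXn) /= !csE.
set z := chi 1 t in zz *; set z' := chi (-1) t in zz *.
have z0 : z != 0.
  by apply/eqP => z0; move/eqP: zz; rewrite z0 mul0r eq_sym oner_eq0.
have -> : z' = z^-1 by apply: (mulfI z0); rewrite zz divff.
rewrite !fmorphV !rmorph_nat /=.
by field.
Qed.

Lemma tp_quartic k0 k1 k2 k3 k4 : tp 4 (cpx (fun t => quartic k0 k1 k2 k3 k4 (cs t))).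
Proof.
by rewrite quartic_cs; apply: tp_list.
Qed.

Lemma meanr_quartic k0 k1 k2 k3 k4 :
  meanr (fun t => quartic k0 k1 k2 k3 k4 (cs t)) = k0 + k2 / 2 + 3 * k4 / 8.
Proof.
rewrite /meanr quartic_cs mean_sum; last by move=> x; exact/ctZ/ct_chi.
rewrite (eq_bigr (fun x => x.1 * (x.2 == 0)%:R)); last first.
  by move=> x _; rewrite meanZ ?mean_chi//; exact: ct_chi.
by rewrite !big_cons big_nil !mulr0 !addr0 mulr1.
Qed.

(* Exponential moment of [sum_j cos(9^j t)] under the density
   [prod_j (1 + a s cos(9^j t))^2], with [expR] replaced by a quadratic majorant. *)
Section Chernoff.
Variables (a l k s : R).
Hypotheses (s0 : 0 < s) (ls : `|l * s| <= 1 / 5).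

Definition chernoff m : T -> R := tens (fun t => (1 + a * s * cs t) ^+ 2 *
  (1 + l * s * cs t + 7 / 8 * (l * s * cs t) ^+ 2) * expR (- (l * k * s ^+ 2))) m.

Lemma chernoffE : (fun t => (1 + a * s * cs t) ^+ 2 *
  (1 + l * s * cs t + 7 / 8 * (l * s * cs t) ^+ 2) * expR (- (l * k * s ^+ 2))) =
  fun t => expR (- (l * k * s ^+ 2)) * quartic 1 (2 * a * s + l * s)
    ((a ^+ 2 + 2 * a * l + 7 / 8 * l ^+ 2) * s ^+ 2)
    ((a ^+ 2 * l + 7 / 4 * a * l ^+ 2) * s ^+ 3) (7 / 8 * a ^+ 2 * l ^+ 2 * s ^+ 4) (cs t).
Proof. by apply/funext => t; rewrite /quartic; field. Qed.

Lemma tp_chernoff1 : tp 4 (cpx (fun t => (1 + a * s * cs t) ^+ 2 *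
  (1 + l * s * cs t + 7 / 8 * (l * s * cs t) ^+ 2) * expR (- (l * k * s ^+ 2)))).
Proof.
rewrite chernoffE; exact/tp_cpxZ/tp_quartic.
Qed.

Lemma trp_chernoff m : trp (chernoff m).
Proof. by apply: trp_tens; exists 4%N; exact: tp_chernoff1. Qed.

(** Independence of the dilates gives an m-th power. In one factor the odd moments of the cosine
    vanish and the even ones are 1/2 and 3/8; then 1 + x <= exp x. *)
Lemma mean_chernoff m (d : R) :
  (a ^+ 2 / 2 + a * l + 7 / 16 * l ^+ 2 + 21 / 64 * a ^+ 2 * l ^+ 2 * s ^+ 2 - l * k) <= - d ->
  meanr (chernoff m) <= expR (- (d * s ^+ 2 * m%:R)).
Proof.
move=> h; rewrite (meanr_tens _ tp_chernoff1)//.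
have -> : - (d * s ^+ 2 * m%:R) = - (d * s ^+ 2) * m%:R by ring.
rewrite expRM_natr; set x := meanr _.
have E : x = expR (- (l * k * s ^+ 2)) * (1 +
   (a ^+ 2 / 2 + a * l + 7 / 16 * l ^+ 2 + 21 / 64 * a ^+ 2 * l ^+ 2 * s ^+ 2) * s ^+ 2).
  rewrite /x chernoffE meanrZ; last by eexists; exact: tp_quartic.
  by rewrite meanr_quartic; congr (_ * _); field.
have x0 : 0 <= x.
  rewrite -[0](@meanr_cst R) /x; apply: meanr_le; first exact: trp_cst.
    by eexists; exact: tp_chernoff1.
  move=> t; rewrite mulr_ge0 ?expR_ge0// mulr_ge0 ?sqr_ge0//.
  set y := l * s * cs t.
  have : 0 <= 1 + y + 7 / 8 * y ^+ 2.
    have -> : 1 + y + 7 / 8 * y ^+ 2 = 7 / 8 * (y + 4 / 7) ^+ 2 + 5 / 7 by field.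
    by rewrite addr_ge0// mulr_ge0// sqr_ge0.
  by [].
apply: lerXn2r; rewrite ?nnegrE ?expR_ge0//.
rewrite E; apply: le_trans (ler_wpM2l (expR_ge0 _) (expR_ge1Dx _)) _.
rewrite -expRD ler_expR.
have s2 : 0 <= s ^+ 2 by exact: sqr_ge0.
set b := a ^+ 2 / 2 + _ + _ + _ in h *.
by have := ler_wpM2r s2 h; lra.
Qed.

(** On this half-line the weight exp(l s (X - k s m)), with X the sum of the cosines, is at least 1;
    the quadratic majorant of the exponential is then applied factor by factor. *)
Lemma chernoff_le m t : 0 <= l * (tsum cs m t - k * s * m%:R) ->
  tens (fun t => 1 + a * s * cs t) m t ^+ 2 <= chernoff m t.
Proof.
move=> h; pose u t := l * s * cs t + - (l * k * s ^+ 2).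
apply: (@le_trans _ _ (tens (fun t => (1 + a * s * cs t) ^+ 2 * expR (u t)) m t)).
  have E : tsum u m t = l * s * tsum cs m t + m%:R * - (l * k * s ^+ 2).
    exact: tsum_aff.
  rewrite tens_sqr_expR E -[leLHS]mulr1 ler_wpM2l ?sqr_ge0//.
  rewrite -[leLHS]expR0 ler_expR.
  have -> : l * s * tsum cs m t + m%:R * - (l * k * s ^+ 2) =
    s * (l * (tsum cs m t - k * s * m%:R)) by ring.
  by rewrite mulr_ge0// ltW.
suff : 0 <= tens (fun t => (1 + a * s * cs t) ^+ 2 * expR (u t)) m t <= chernoff m t.
  by case/andP.
apply: tens_le => x; rewrite mulr_ge0 ?sqr_ge0 ?expR_ge0//=.
rewrite -[leRHS]mulrA ler_wpM2l ?sqr_ge0// expRD ler_wpM2r ?expR_ge0//.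
apply: expR_le_quad; rewrite normrM; apply: le_trans ls.
by rewrite ler_piMr// cs_le1.
Qed.

Lemma chernoff_ge0 m t : 0 <= chernoff m t.
Proof.
suff : 0 <= chernoff m t <= chernoff m t by case/andP.
apply: tens_le => x; rewrite lexx andbT mulr_ge0 ?expR_ge0// mulr_ge0 ?sqr_ge0//.
set y := l * s * cs x.
have -> : 1 + y + 7 / 8 * y ^+ 2 = 7 / 8 * (y + 4 / 7) ^+ 2 + 5 / 7 by field.
by rewrite addr_ge0// mulr_ge0// sqr_ge0.
Qed.

End Chernoff.

End Tensor.

(** * Spectra of Riesz products; the density and the oscillating factor *)

Section RieszProducts.
Variable R : realType.
Local Notation T := (circle R).
Local Notation C := R[i].
Local Notation nc := Normc.normc.

Lemma cRM (x y : R) : (x * y)%:C = x%:C * y%:C.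
Proof. exact: rmorphM. Qed.
Lemma cRX (x : R) k : (x ^+ k)%:C = x%:C ^+ k.
Proof. exact: rmorphXn. Qed.
Lemma cRB (x y : R) : (x - y)%:C = x%:C - y%:C.
Proof. exact: rmorphB. Qed.
Lemma cR_sum (I : Type) (l : seq I) (F : I -> R) :
  (\sum_(i <- l) F i)%:C = \sum_(i <- l) (F i)%:C.
Proof. exact: rmorph_sum. Qed.

Lemma powR_exprn (y r : R) k : 0 <= y -> (y ^+ k) `^ r = (y `^ r) ^+ k.
Proof.
move=> y0; elim: k => [|k IH]; first by rewrite !expr0 powR1.
by rewrite !exprS powRM ?exprn_ge0// IH.
Qed.

(* The frequencies [sum_j e_j 9^j], with digits e_j in {-1, 0, 1}, of a Riesz
   product, paired with their numbers of nonzero digits. *)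
Fixpoint spec m : seq (int * nat) :=
  if m is m'.+1 then
    [seq (9%:Z * y.1 + e.1, (y.2 + e.2)%N) | y <- spec m', e <- [:: (0, 0%N); (1, 1%N); (-1, 1%N)]]
  else [:: (0, 0%N)].

(** 9 n + e determines n and e when |e| <= 1, so distinct digit strings give distinct frequencies
    and the coefficients of [specf] can be read off. *)
Lemma spec_uniq m : uniq [seq x.1 | x <- spec m].
Proof.
elim: m => [//|m IH]; rewrite [spec m.+1]/(allpairs _ _ _) map_allpairs.
rewrite (_ : [seq _ | y <- spec m, e <- _] =
  [seq 9%:Z * n + e | n <- [seq x.1 | x <- spec m], e <- [:: 0; 1; -1]]); last first.
  by elim: (spec m) => //= y l ->.
apply: allpairs_uniq => // -[n e] [n' e'] /allpairsP[[a b] [_ hb [-> ->]]].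
move=> /allpairsP[[a' b'] [_ hb' [-> ->]]] /= h; rewrite /= in hb hb'.
move: hb hb'; rewrite !inE => /or3P[] /eqP hb /or3P[] /eqP hb'; subst b b';
  by (have -> : a = a' by lia); try (by []); exfalso; lia.
Qed.

Lemma spec_sum m (y : R) : \sum_(x <- spec m) y ^+ x.2 = (1 + 2 * y) ^+ m.
Proof.
elim: m => [|m IH]; first by rewrite big_seq1 !expr0.
rewrite [spec m.+1]/(allpairs _ _ _) big_allpairs_dep /= exprSr -IH mulr_suml; apply: eq_bigr => x _.
rewrite !big_cons big_nil /= addn0 addn1 exprS; ring.
Qed.

(** The coefficient depends only on the number of nonzero digits. Riesz products have this form, and
    so do [density - 1] and [osc], whose norms reduce to binomial sums. *)
Definition specf (d : nat -> C) m (t : T) : C := \sum_(x <- spec m) d x.2 * chi x.1 t.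

Lemma tp_specf d m : exists N, tp N (specf d m).
Proof.
rewrite /specf; elim: (spec m) => [|x l [N IH]].
  by exists 0%N; under eq_fun do rewrite big_nil; exact: Tp0.
exists (N + absz x.1)%N; under eq_fun do rewrite big_cons.
by apply: tpD; [apply: tpZ; apply: tp_le (tp_chi _ _); exact: leq_addl|apply: tp_le IH; exact: leq_addr].
Qed.

Lemma bd_specf r d m M : 0 < r -> 0 <= M ->
  \sum_(x <- spec m) nc (d x.2) `^ r <= M `^ r -> bd r (hat (specf d m)) M.
Proof.
move=> r0 M0 h.
have E n : hat (specf d m) n = \sum_(x <- spec m) d x.2 * (x.1 == n)%:R.
  rewrite /specf hat_sum; last by move=> x; exact/ctZ/ct_chi.
  by apply: eq_bigr => x _; rewrite hatZ ?hat_chi//; exact: ct_chi.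
apply: (@bd_supp _ _ [seq x.1 | x <- spec m]) => //; first exact: spec_uniq.
  move=> n nl; rewrite E big1_seq// => x /= xs.
  case: eqP => [xn|_]; last by rewrite mulr0.
  by exfalso; move/negP: nl; apply; rewrite -xn map_f.
rewrite big_map; apply: le_trans h; rewrite le_eqVlt; apply/orP; left; apply/eqP.
apply: eq_big_seq => x xs; rewrite E; congr (nc _ `^ r).
have us := map_uniq (spec_uniq m).
rewrite (bigD1_seq x)//= eqxx mulr1 big1_seq ?addr0// => y /andP[yx ys].
case: eqP => [e|_]; last by rewrite mulr0.
have := spec_uniq m; move/(uniqP 0) => inj.
exfalso; move/eqP: yx; apply.
have [i [j [hi hj xi yj]]] : exists i j, [/\ (i < size (spec m))%N, (j < size (spec m))%N,
    nth (0, 0%N) (spec m) i = x & nth (0, 0%N) (spec m) j = y].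
  by exists (index x (spec m)), (index y (spec m)); rewrite !index_mem !nth_index.
have : i = j.
  by apply: inj; rewrite ?inE ?size_map// !(nth_map (0, 0%N))// xi yj.
by rewrite -xi -yj => ->.
Qed.

(** A complex parameter serves both uses: u = a s / 2 gives the real Riesz products of the density,
    u = i b / 2 an approximation of exp(i b sum_j c_j). *)
Definition rz (u : C) m : T -> C := tens (fun t => 1 + u * (chi 1 t + chi (-1) t)) m.

Lemma rzE u m : rz u m = specf (fun k => u ^+ k) m.
Proof.
apply/funext => t; rewrite /specf /rz.
elim: m t => [|m IH] t; first by rewrite big_seq1 expr0 chi0 mulr1.
rewrite [spec m.+1]/(allpairs _ _ _) big_allpairs_dep [tens _ _ _]/= IH /= mulr_sumr; apply: eq_bigr => x _.
rewrite !big_cons big_nil /= chi_dil !chiD chi0 addn0 addn1 exprS; ring.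
Qed.

Lemma rz_conj u m t : (rz u m t)^*%C = rz u^*%C m t.
Proof.
rewrite /rz; elim: m t => [|m IH] t /=; first exact: conjc1.
by rewrite conjcM IH conjcD conjc1 conjcM conjcD !chi_conj opprK [_ + chi 1 t]addrC.
Qed.

Lemma rz_real (c : R) m t : tens (fun t => 1 + c * cs t) m t = 
  complex.Re (rz (c / 2)%:C m t) /\ cpx (tens (fun t => 1 + c * cs t) m) t = rz (c / 2)%:C m t.
Proof.
have E : cpx (tens (fun t => 1 + c * cs t) m) t = rz (c / 2)%:C m t.
  rewrite {1}/cpx tens_cpx /rz; congr (tens _ m t).
  apply/funext => x; rewrite /cpx rmorphD !rmorphM /= csE fmorphV rmorph_nat.
  by congr (1 + _); field.
by split => //; rewrite -E.
Qed.

Section Density.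
Variables (K m : nat) (w : 'I_K.+1 -> R) (s q : R).
Hypotheses (K0 : (0 < K)%N) (s0 : 0 < s) (q1 : 1 <= q).
Hypothesis sumw : \sum_i `|w i| <= 8 ^+ K.
Hypothesis mom : forall k, (k <= K)%N ->
  \sum_i w i * (1 + i%:R / K%:R) ^+ k = (k == 0)%:R.

Let a (i : 'I_K.+1) : R := 1 + i%:R / K%:R.

Lemma node_bounds i : 1 <= a i <= 2.
Proof.
have KR : 0 < K%:R :> R by rewrite ltr0n.
rewrite /a lerDl divr_ge0//=.
have -> : 2 = 1 + 1 :> R by [].
by rewrite lerD2l ler_pdivrMr// mul1r ler_nat -ltnS.
Qed.

Definition density (t : T) : R := \sum_i w i * tens (fun t => 1 + a i * s * cs t) m t.

Lemma trp_density : trp density.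
Proof.
apply: trp_sum => i; apply/trpZ/trp_tens/trpD; first exact: trp_cst.
exact/trpZ/trp_cs.
Qed.

(** Coefficient of [density - 1] at a frequency with k nonzero digits; the term [0 ^+ k] removes the
    constant 1. *)
Let dcoef k : C := (\sum_i w i * (a i * s / 2) ^+ k - 0 ^+ k)%:C.

Lemma densityE : cpx (fun t => density t - 1) = specf dcoef m.
Proof.
apply/funext => t; rewrite /cpx cRB -[1%:C]/(1 : C).
have one : 1 = \sum_(x <- spec m) (0 ^+ x.2) * chi x.1 t :> C.
  have := congr1 (fun f => f t) (rzE 0 m); rewrite /specf => <-.
  by rewrite /rz; elim: {+}m t => //= k IH t; rewrite mul0r addr0 mul1r -IH.
rewrite [X in _ - X]one /specf /density cR_sum.
rewrite (eq_bigr (fun i => \sum_(x <- spec m) (w i * (a i * s / 2) ^+ x.2)%:C * chi x.1 t)); last first.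
  move=> i _; rewrite cRM -[(tens _ m t)%:C]/(cpx (tens _ m) t) (rz_real _ m t).2 rzE /specf mulr_sumr.
  by apply: eq_bigr => x _; rewrite [in RHS]cRM [in RHS]cRX mulrA.
rewrite exchange_big /= -sumrB; apply: eq_bigr => x _.
by rewrite -mulr_suml -mulrBl /dcoef cRB cR_sum cRX.
Qed.

(** Since k > K for the surviving coefficients, a factor 8^q per digit pays for the total weight
    8^K, and a further factor 2 per digit leaves the gain 2^(-K). *)
Let lam : R := 2 * 8 `^ q.

(** For k <= K the coefficient vanishes by the moment conditions. For k > K the nodes are at most 2,
    so it is at most 8^K s^k. *)
Lemma dcoef_le k : nc (dcoef k) `^ q <= (1 / 2) ^+ K * (lam * s `^ q) ^+ k.
Proof.
have q0 : 0 < q by apply: lt_le_trans q1.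
have R0 : 0 <= (1 / 2) ^+ K * (lam * s `^ q) ^+ k.
  by rewrite mulr_ge0// exprn_ge0// mulr_ge0 ?powR_ge0// mulr_ge0// powR_ge0.
have [kK|Kk] := leqP k K.
  rewrite /dcoef (_ : _ - _ = 0) ?nc0 ?powR0 ?gt_eqF//.
  under eq_bigr do rewrite -mulrA exprMn mulrA.
  rewrite -mulr_suml mom// expr0n; case: k kK {R0} => [|k] _ /=.
    by rewrite expr0 mulr1 subrr.
  by rewrite mul0r subrr.
have B : nc (dcoef k) <= 8 ^+ K * s ^+ k.
  rewrite /dcoef expr0n (_ : (k == 0)%N = false) ?subr0; last by case: k Kk {R0}.
  rewrite ncR; apply: le_trans (ler_norm_sum _ _ _) _.
  apply: le_trans (ler_wpM2r (exprn_ge0 k (ltW s0)) sumw).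
  rewrite mulr_suml; apply: ler_sum => i _.
  rewrite normrM ler_wpM2l// normrX lerXn2r ?nnegrE ?(ltW s0)//.
  have /andP[a1 a2] := node_bounds i.
  have ap : 0 <= a i * s / 2 by rewrite divr_ge0// mulr_ge0 ?(ltW s0)//; lra.
  by rewrite ger0_norm// ler_pdivrMr// [s * 2]mulrC ler_pM2r.
apply: (@le_trans _ _ ((8 ^+ K * s ^+ k) `^ q)).
  by rewrite ge0_ler_powR ?nnegrE ?nc_ge0 ?(ltW q0)// mulr_ge0 ?exprn_ge0 ?(ltW s0).
rewrite powRM ?exprn_ge0 ?(ltW s0)// !powR_exprn ?(ltW s0)//.
have -> : (lam * s `^ q) ^+ k = lam ^+ k * (s `^ q) ^+ k by rewrite exprMn.
rewrite mulrA ler_wpM2r ?exprn_ge0 ?powR_ge0//.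
have e1 : 1 <= 8 `^ q :> R.
  rewrite -[leLHS](powRr0 8) ler_powR ?(ltW q0)//; lra.
have -> : lam ^+ k = 2 ^+ k * (8 `^ q) ^+ k by rewrite exprMn.
rewrite mulrA.
have h1 : (8 `^ q) ^+ K <= (8 `^ q) ^+ k by apply: ler_weXn2l => //; exact: ltnW.
have h2 : 1 <= (1 / 2) ^+ K * 2 ^+ k :> R.
  rewrite -(subnK (ltnW Kk)) exprD mulrCA -exprMn (_ : 1 / 2 * 2 = 1) ?expr1n ?mulr1; last by field.
  by apply: exprn_ege1; lra.
apply: le_trans h1 _; rewrite -[leLHS]mul1r ler_wpM2r// exprn_ge0// powR_ge0.
Qed.

(** Summing [dcoef_le] over the spectrum gives 2^(-K) (1 + 2 lam s^q)^m. *)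
Lemma bd_density (e : R) : 0 <= e ->
  (1 / 2) ^+ K * expR (2 * lam * (m%:R * s `^ q)) <= e `^ q ->
  bd q (hat (cpx (fun t => density t - 1))) e.
Proof.
have q0 : 0 < q by apply: lt_le_trans q1.
move=> e0 h; rewrite densityE; apply: bd_specf => //.
apply: le_trans h; apply: le_trans (ler_sum _ (fun x _ => dcoef_le x.2)) _.
rewrite -mulr_sumr ler_wpM2l ?exprn_ge0// spec_sum.
have -> : 2 * lam * (m%:R * s `^ q) = m%:R * (2 * (lam * s `^ q)) by ring.
rewrite expRM_natl lerXn2r ?nnegrE ?expR_ge0 ?expR_ge1Dx//.
by rewrite addr_ge0// mulr_ge0// mulr_ge0 ?powR_ge0// mulr_ge0// powR_ge0.
Qed.

End Density.

Section Oscillation.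
Variables (b : R) (m : nat).
Hypotheses (b0 : 0 <= b) (b1 : b <= 1).

Let u : C := 0 +i* (b / 2).

Lemma rz_osc_step (t : T) : 1 + u * (chi 1 t + chi (-1) t) = 1 +i* (b * cs t).
Proof.
have -> : chi 1 t + chi (-1) t = 2 * (cs t)%:C by rewrite csE mulrC divfK// pnatr_eq0.
by apply/eqP; rewrite eq_complex /=; apply/andP; split; apply/eqP; field.
Qed.

Lemma osc_error y : `|y| <= b -> nc ((1 +i* y) - (cos y +i* sin y)) <= b ^+ 2.
Proof.
move=> yb; apply: le_trans (nc_ReIm _) _ => /=.
have y2 : y ^+ 2 <= b ^+ 2 by rewrite -real_normK ?num_real// lerXn2r ?nnegrE.
have h1 := cos_sub1_le y; have h2 := sin_sub_le y.
have c1 := cos_le1 y; rewrite ger0_norm ?subr_ge0// [`|y - _|]distrC.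
have : `|y| ^+ 3 <= b ^+ 2.
  rewrite exprS -[leRHS]mul1r ler_pM ?exprn_ge0//; first exact: le_trans b1.
  by rewrite lerXn2r ?nnegrE.
lra.
Qed.

(** Each factor 1 + i b c_j is within b^2 of exp(i b c_j), hence of modulus at most 1 + b^2;
    replacing the factors one at a time accumulates (1 + b^2)^m - 1. *)
Lemma rz_osc (t : T) : nc (rz u m t) <= (1 + b ^+ 2) ^+ m /\
  nc (rz u m t - (cos (b * tsum (@cs R) m t) +i* sin (b * tsum (@cs R) m t))) <= (1 + b ^+ 2) ^+ m - 1.
Proof.
rewrite /rz; elim: m t => [|k IH] t /=.
  rewrite nc1 expr0 mulr0 cos0 sin0 -[1 +i* 0]/(1 : C) !subrr nc0; split => //.
have [i1 i2] := IH (dil 9 t); rewrite rz_osc_step.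
set A := tens _ k _ in i1 i2 *; set f := b * tsum _ _ _ in i2 *.
set y := b * cs t; have yb : `|y| <= b.
  by rewrite normrM ger0_norm// ler_piMr// cs_le1.
have -> : b * (cs t + tsum (@cs R) k (dil 9 t)) = y + f by rewrite mulrDr.
have e := osc_error yb.
have nE (x : R) : nc (cos x +i* sin x) = 1 by rewrite /Normc.normc cos2Dsin2 sqrtr1.
have n1 : nc (1 +i* y) <= 1 + b ^+ 2.
  have -> : 1 +i* y = (cos y +i* sin y) + ((1 +i* y) - (cos y +i* sin y)) by rewrite addrC subrK.
  by apply: le_trans (ncD _ _) _; rewrite nE lerD2l.
split; first by rewrite ncM exprS ler_pM ?nc_ge0.
have -> : cos (y + f) +i* sin (y + f) = (cos y +i* sin y) * (cos f +i* sin f).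
  by apply/eqP; rewrite eq_complex /= cosD sinD; apply/andP; split; apply/eqP; ring.
set E := cos y +i* sin y in e *; set G := cos f +i* sin f in i2 *.
have -> : (1 +i* y) * A - E * G = E * (A - G) + ((1 +i* y) - E) * A by ring.
apply: le_trans (ncD _ _) _; rewrite !ncM nE mul1r exprS.
have := ler_pM (nc_ge0 _) (nc_ge0 A) e i1.
by have := nc_ge0 A; lra.
Qed.

(** The factor 1/2 keeps the values below 3/4, so that multiplying [g] by 1 - T F preserves
    positivity. *)
Definition osc (t : T) : R := 1 / 2 * complex.Im (rz u m t).

Let ocoef k : C := (1 / 2 * complex.Im (u ^+ k))%:C.

Lemma Im_conj (z : C) : (complex.Im z)%:C = (0 -i* (1 / 2)) * (z - z^*%C).
Proof.
by case: z => x y; apply/eqP; rewrite eq_complex /=; apply/andP; split; apply/eqP; field.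
Qed.

(** Conjugation exchanges the two characters of each factor, so it acts on the parameter u alone.
    Taking the imaginary part of the function therefore takes that of each u^k. *)
Lemma oscE : cpx osc = specf ocoef m.
Proof.
apply/funext => t; rewrite /cpx /osc cRM (Im_conj (rz u m t)) rz_conj !rzE /specf.
rewrite -sumrB !mulr_sumr; apply: eq_bigr => x _.
have -> : ocoef x.2 = (1 / 2)%:C * ((0 -i* (1 / 2)) * (u ^+ x.2 - (u ^+ x.2)^*%C)).
  by rewrite -Im_conj -cRM.
rewrite -mulrBl !mulrA.
by congr (_ * (_ - _) * _); rewrite [RHS]rmorphXn.
Qed.

Lemma trp_osc : trp osc.
Proof. by have [N h] := tp_specf ocoef m; exists N; rewrite oscE. Qed.

(** The constant term has imaginary part 0, which accounts for the subtracted 1; the other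
    coefficients are at most (b / 2)^k. *)
Lemma bd_osc (p e : R) : 1 <= p -> 0 <= e -> (1 + 2 * (b / 2) `^ p) ^+ m - 1 <= e `^ p ->
  bd p (hat (cpx osc)) e.
Proof.
move=> p1 e0 h; have p0 : 0 < p by apply: lt_le_trans p1.
rewrite oscE; apply: bd_specf => //; apply: le_trans h.
have one : \sum_(x <- spec m) 0 ^+ x.2 = 1 :> R.
  by rewrite spec_sum mulr0 addr0 expr1n.
rewrite -spec_sum -[X in _ - X]one.
rewrite -sumrB; apply: ler_sum => x _; case: x.2 => [|k].
  by rewrite /ocoef !expr0 /= mulr0 nc0 powR0 ?subrr// gt_eqF.
rewrite [0 ^+ _]expr0n subr0 -powR_exprn ?divr_ge0//.
rewrite ge0_ler_powR ?nnegrE ?nc_ge0 ?exprn_ge0 ?divr_ge0 ?(ltW p0)//.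
have nu : nc u = b / 2 by rewrite /u /Normc.normc expr0n /= add0r sqrtr_sqr ger0_norm// divr_ge0.
rewrite -nu -ncX /ocoef ncR normrM; apply: le_trans (nc_Im _).
by rewrite ler_piMl// ger0_norm; lra.
Qed.

End Oscillation.

End RieszProducts.

(** * The block: choice of parameters and estimates *)

Section Block.
Variable R : realType.
Local Notation T := (circle R).
Implicit Types (p q e : R).

Lemma powR_div (x y r : R) : 0 <= x -> 0 < y -> (x / y) `^ r = x `^ r / y `^ r.
Proof.
move=> x0 y0; have yr : y `^ r != 0 by rewrite gt_eqF ?powR_gt0.
by apply: (mulIf yr); rewrite divfK// -powRM ?divr_ge0 ?(ltW y0)// divfK// gt_eqF.
Qed.

Lemma powRVK (x r : R) : 0 <= x -> r != 0 -> (x `^ r^-1) `^ r = x.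
Proof. by move=> x0 r0; rewrite -powRrM mulVf// powRr1. Qed.

(** Take s with s^(q - 2) <= 1 / Z and m just above L / s^q. Then s^2 m = m s^q / s^(q - 2) >= L Z,
    and rounding m up adds at most s^q <= 1 to m s^q. *)
Lemma choose_sm (q L Z : R) : 2 < q -> 1 <= L -> 1 <= Z ->
  exists (s : R) (m : nat), [/\ 0 < s <= 1 / 10, (0 < m)%N, m%:R * s `^ q <= 2 * L,
    L <= m%:R * s `^ q & Z <= s ^+ 2 * m%:R].
Proof.
move=> q2 L1 Z1; have qp : 0 < q - 2 by rewrite subr_gt0.
have Z0 : 0 < Z by apply: lt_le_trans Z1.
pose s0 := (Z^-1) `^ (q - 2)^-1; pose s := Num.min (1 / 10) s0.
have s00 : 0 < s0 by rewrite powR_gt0 ?invr_gt0.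
have sp : 0 < s by rewrite lt_min s00 andbT.
have s10 : s <= 1 / 10 by rewrite ge_min lexx.
have sq : 0 < s `^ q by rewrite powR_gt0.
have sq1 : s `^ q <= 1.
  have -> : 1 = 1 `^ q :> R by rewrite powR1.
  by rewrite ge0_ler_powR ?nnegrE//; lra.
have Ls : 0 <= L / s `^ q by rewrite divr_ge0 ?(ltW sq)//; lra.
pose m := (Num.truncn (L / s `^ q)).+1.
have m1 : L / s `^ q <= m%:R by rewrite ltW// truncnS_gt.
have m2 : m%:R <= L / s `^ q + 1.
  by rewrite /m -natr1 lerD2r truncn_le.
have Lm : L <= m%:R * s `^ q by rewrite -ler_pdivrMr.
exists s, m; split => //; first by rewrite sp.
  apply: le_trans (ler_wpM2r (ltW sq) m2) _.
  by rewrite mulrDl divfK ?gt_eqF// mul1r; lra.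
have sq2 : s `^ (q - 2) <= Z^-1.
  rewrite -[leRHS](powRVK (r := q - 2)) ?invr_ge0 ?(ltW Z0) ?gt_eqF//.
  by rewrite ge0_ler_powR ?nnegrE ?powR_ge0 ?(ltW qp) ?(ltW sp)// ge_min lexx orbT.
have sE : s `^ q = s ^+ 2 * s `^ (q - 2).
  by rewrite -powR2 ?(ltW sp)// -powRD ?(gt_eqF sp) ?implybT// addrC subrK.
have : L <= (s ^+ 2 * m%:R) * Z^-1.
  apply: le_trans Lm _; rewrite sE mulrA [m%:R * _]mulrC ler_wpM2l//.
  by rewrite mulr_ge0 ?sqr_ge0.
rewrite ler_pdivlMr// => h; apply: le_trans h; nra.
Qed.

Lemma expR_le_double (y : R) : 0 <= y -> y <= 1 / 5 -> expR y <= 1 + 2 * y.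
Proof.
by move=> y0 y5; apply: le_trans (expR_le_quad _) _; [rewrite ger0_norm|nra].
Qed.

(** Half of 1/384 - 1/768: the lower bound of [sin_lower] minus the error allowed by [block_pow],
    with the factor 1/2 of [osc]. *)
Definition c0 : R := 1 / 1536.

Lemma sin_lower (f : R) : 1 / 192 <= f <= 1 -> 1 / 384 <= sin f.
Proof.
move=> /andP[f1 f2]; have fp : 0 <= f by lra.
have := sin_sub_le f; rewrite (ger0_norm fp).
rewrite ler_norml => /andP[h _].
have : f ^+ 3 <= f.
  rewrite exprS -[leRHS]mulr1 ler_wpM2l ?exprn_ile1//; lra.
lra.
Qed.

Section BlockEstimates.
Variables (K m : nat) (w : 'I_K.+1 -> R) (s : R).
Hypotheses (K0 : (0 < K)%N) (m0 : (0 < m)%N) (s0 : 0 < s) (s10 : s <= 1 / 10).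
Hypothesis sumw : \sum_i `|w i| <= 8 ^+ K.
Hypothesis Zm : 28 <= s ^+ 2 * m%:R.

Let a (i : 'I_K.+1) : R := 1 + i%:R / K%:R.
Let W : R := 8 ^+ K.
Let mR : 0 < m%:R :> R. Proof. by rewrite ltr0n. Qed.
Let W0 : 0 < W. Proof. by rewrite exprn_gt0. Qed.

(** Normalized so that b X <= 1 on the window s m / 32 < X < 6 s m for the sum X of the cosines;
    there b X >= 1/192 as well. *)
Definition block_b : R := 1 / (6 * s * m%:R).
Local Notation b := block_b.

Lemma block_b_ge0 : 0 <= b.
Proof. by rewrite divr_ge0// -mulrA mulr_ge0// mulr_ge0// ltW. Qed.

Lemma block_b_sqr : m%:R * b ^+ 2 <= 1 / 1000.
Proof.
have -> : m%:R * b ^+ 2 = 1 / (36 * (s ^+ 2 * m%:R)).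
  by rewrite /b; field; rewrite !gt_eqF.
have z0 : 0 < s ^+ 2 * m%:R by rewrite mulr_gt0// exprn_gt0.
move: Zm z0; set z := s ^+ 2 * m%:R; clearbody z => z28 z0.
rewrite ler_pdivrMr ?mulr_gt0//; lra.
Qed.

Lemma block_b_le1 : b <= 1.
Proof.
rewrite -(ler_pXn2r (n := 2)) ?nnegrE ?block_b_ge0// expr1n.
apply: (@le_trans _ _ (m%:R * b ^+ 2)); first by rewrite ler_peMl ?sqr_ge0// ler1n.
apply: le_trans block_b_sqr _; lra.
Qed.

Lemma block_pow : (1 + b ^+ 2) ^+ m <= 1 + 1 / 768.
Proof.
apply: (@le_trans _ _ (expR (m%:R * b ^+ 2))).
  rewrite expRM_natl lerXn2r ?nnegrE ?expR_ge0 ?expR_ge1Dx//.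
  by rewrite addr_ge0// sqr_ge0.
have y0 : 0 <= m%:R * b ^+ 2 by rewrite mulr_ge0 ?sqr_ge0.
have := block_b_sqr; set y := m%:R * b ^+ 2 in y0 *; clearbody y => y1.
apply: le_trans (expR_le_quad _) _; first by rewrite ger0_norm//; lra.
nra.
Qed.

(** Majorant of the squared density outside the window: weighted Cauchy-Schwarz, then for each node
    one Chernoff weight per tail. It is a trigonometric polynomial, so the next step can use it. *)
Definition block_Psi (t : T) : R := W * \sum_i `|w i| *
  (chernoff (a i) (- a i) (1 / 32) s m t + chernoff (a i) 1 6 s m t).

Let tr1 i : trp (fun t => `|w i| *
  (chernoff (a i) (- a i) (1 / 32) s m t + chernoff (a i) 1 6 s m t)).
Proof. by apply/trpZ/trpD; exact: trp_chernoff. Qed.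

Lemma trp_block_Psi : trp block_Psi.
Proof. exact/trpZ/trp_sum. Qed.

Lemma block_Psi_ge0 t : 0 <= block_Psi t.
Proof.
rewrite mulr_ge0 ?(ltW W0)// sumr_ge0// => i _.
by rewrite mulr_ge0// addr_ge0// chernoff_ge0.
Qed.

(** The mean square of a Riesz product grows like exp(c^2 s^2 m / 2), so each tilt must beat c^2 /
    2. In the lower tail l = - c leaves c^2 / 2 - c^2 + 7 c^2 / 16 = - c^2 / 16; a quadratic
    majorant with coefficient 1 instead of 7/8 would leave nothing. The upper tail has ample
    room. *)
Lemma chernoff_means (c s2 : R) : 1 <= c <= 2 -> 0 <= s2 <= 1 / 100 ->
  (c ^+ 2 / 2 + c * - c + 7 / 16 * (- c) ^+ 2 + 21 / 64 * c ^+ 2 * (- c) ^+ 2 * s2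
    - - c * (1 / 32) <= - (1 / 64)) /\
  (c ^+ 2 / 2 + c * 1 + 7 / 16 * 1 ^+ 2 + 21 / 64 * c ^+ 2 * 1 ^+ 2 * s2
    - 1 * 6 <= - (1 / 64)).
Proof.
move=> /andP[c1 c2] /andP[s20 s21]; have A : 1 <= c ^+ 2 <= 4 by nra.
case/andP: A => A1 A2; have AS : 0 <= c ^+ 2 * s2 <= 4 / 100 by nra.
case/andP: AS => AS1 AS2; split.
  have -> : c ^+ 2 / 2 + c * - c + 7 / 16 * (- c) ^+ 2 +
    21 / 64 * c ^+ 2 * (- c) ^+ 2 * s2 - - c * (1 / 32) =
    c ^+ 2 * (- (1 / 16) + 21 / 64 * (c ^+ 2 * s2)) + c / 32 by field.
  nra.
have -> : c ^+ 2 / 2 + c * 1 + 7 / 16 * 1 ^+ 2 + 21 / 64 * c ^+ 2 * 1 ^+ 2 * s2 - 1 * 6 =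
  c ^+ 2 / 2 + c + 7 / 16 + 21 / 64 * (c ^+ 2 * s2) - 6 by field.
lra.
Qed.

Lemma meanr_block_Psi : meanr block_Psi <= 2 * W ^+ 2 * expR (- (1 / 64 * s ^+ 2 * m%:R)).
Proof.
rewrite /block_Psi meanrZ ?meanr_sum//; last exact: trp_sum.
set E := expR _; have E0 : 0 <= E by exact: expR_ge0.
have Ei i : meanr (fun t => `|w i| * (chernoff (a i) (- a i) (1 / 32) s m t +
    chernoff (a i) 1 6 s m t)) <= `|w i| * (2 * E).
  rewrite meanrZ ?meanrD//; try exact: trp_chernoff; last by apply: trpD; exact: trp_chernoff.
  rewrite ler_wpM2l// mulr_natl mulr2n.
  have s2 : 0 <= s ^+ 2 <= 1 / 100.
    rewrite sqr_ge0/= (_ : 1 / 100 = (1 / 10) ^+ 2 :> R); last by field.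
    by rewrite lerXn2r ?nnegrE// ltW.
  have [h1 h2] := chernoff_means (node_bounds R K0 i) s2.
  by apply: lerD; apply: mean_chernoff.
apply: (@le_trans _ _ (W * (W * (2 * E)))).
  rewrite ler_pM2l//; apply: le_trans (ler_sum _ (fun i _ => Ei i)) _.
  by rewrite -mulr_suml ler_wpM2r// mulr_ge0.
by rewrite le_eqVlt; apply/orP; left; apply/eqP; ring.
Qed.

Lemma osc_le t : `|osc b m t| <= 3 / 4.
Proof.
have [h _] := rz_osc m block_b_ge0 block_b_le1 t.
have := block_pow; have := nc_Im (rz (0 +i* (b / 2)) m t).
by rewrite /osc normrM (ger0_norm (_ : 0 <= 1 / 2))//; lra.
Qed.

(** Outside the window one of the two Chernoff weights dominates every squared Riesz product. Inside
    it b X lies in [1/192, 1], and [osc] follows sin(b X) / 2. *)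
Lemma block_event t : c0 <= osc b m t \/ density m w s t ^+ 2 <= block_Psi t.
Proof.
set X := tsum (@cs R) m t.
have phi2 : density m w s t ^+ 2 <=
    W * \sum_i `|w i| * tens (fun t => 1 + a i * s * cs t) m t ^+ 2.
  apply: le_trans (weighted_cauchy_schwarz _ _) _.
  by rewrite ler_wpM2r// sumr_ge0// => i _; rewrite mulr_ge0// sqr_ge0.
have Psi_ge : (forall i, tens (fun t => 1 + a i * s * cs t) m t ^+ 2 <=
    chernoff (a i) (- a i) (1 / 32) s m t + chernoff (a i) 1 6 s m t) ->
    density m w s t ^+ 2 <= block_Psi t.
  move=> h; apply: le_trans phi2 _; rewrite /block_Psi ler_pM2l//.
  by apply: ler_sum => i _; rewrite ler_wpM2l.
have [X1|X1] := leP X (1 / 32 * s * m%:R).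
  right; apply: Psi_ge => i; apply: (@le_trans _ _ (chernoff (a i) (- a i) (1 / 32) s m t)).
    have /andP[a1 a2] := node_bounds R K0 i; rewrite -/(a i) in a1 a2.
    apply: chernoff_le => //.
      rewrite mulNr normrN ger0_norm ?mulr_ge0 ?(ltW s0) ?(le_trans ler01 a1)//.
      apply: (@le_trans _ _ (2 * (1 / 10))); last by lra.
      by rewrite ler_pM ?(ltW s0) ?(le_trans ler01 a1).
    rewrite -/X mulNr -mulrN mulr_ge0 ?(le_trans ler01 a1)//.
    by rewrite oppr_ge0 subr_le0.
  by rewrite lerDl chernoff_ge0.
have [X2|X2] := leP (6 * s * m%:R) X.
  right; apply: Psi_ge => i; apply: (@le_trans _ _ (chernoff (a i) 1 6 s m t)).
    have ls : `|1 * s| <= 1 / 5.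
      rewrite mul1r (gtr0_norm s0); apply: le_trans s10 _; lra.
    by apply: chernoff_le => //; rewrite -/X mul1r subr_ge0.
  by rewrite lerDr chernoff_ge0.
left; have [_ h] := rz_osc m block_b_ge0 block_b_le1 t; rewrite -/X in h.
have bX : 1 / 192 <= b * X <= 1.
  have sm6 : 0 < 6 * s * m%:R by rewrite -mulrA mulr_gt0// mulr_gt0.
  have -> : b * X = X / (6 * s * m%:R) by rewrite /b mul1r mulrC.
  apply/andP; split; last by rewrite ler_pdivrMr// mul1r ltW.
  rewrite ler_pdivlMr//; apply: le_trans (ltW X1).
  by rewrite le_eqVlt; apply/orP; left; apply/eqP; field.
have := sin_lower bX; have := le_trans (nc_Im _) h; have := block_pow.
rewrite ImDc ler_norml /= /osc /c0 => h0 /andP[h1 _]; lra.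
Qed.

(** Since q (p - 1) = p, (s m)^p = m (m s^q)^(p - 1) >= m L^(p - 1), and b / 2 <= 1 / (s m). Hence m
    (b / 2)^p <= L^(-(p - 1)). *)
Lemma bd_osc_block (p L d e : R) : 1 < p -> 1 <= L -> 0 < e -> 0 < d ->
  2 / d <= L `^ (p - 1) -> L <= m%:R * s `^ (p / (p - 1)) ->
  d <= 1 / 5 -> d <= e `^ p / 2 -> bd p (hat (cpx (osc b m))) e.
Proof.
move=> p1 L1 e0 d0 Ld Lm dd1 dd2; set q := p / (p - 1) in Lm.
have p0 : 0 < p by apply: lt_trans p1.
have pm : 0 < p - 1 by rewrite subr_gt0.
have sm0 : 0 < s * m%:R by rewrite mulr_gt0.
have L0 : 0 < L by apply: lt_le_trans L1.
apply: bd_osc; [exact: block_b_ge0|exact: ltW|exact: ltW|].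
have by0 : 0 <= (b / 2) `^ p by exact: powR_ge0.
have key : 2 * (m%:R * (b / 2) `^ p) <= d.
  have bs : b / 2 <= 1 / (s * m%:R).
    rewrite /b; apply: (@le_trans _ _ ((1 / (s * m%:R)) / 12)).
      by rewrite le_eqVlt; apply/orP; left; apply/eqP; field; rewrite !gt_eqF.
    by rewrite ler_pdivrMr// ler_peMr ?ler1n// divr_ge0// ltW.
  have h1 : (b / 2) `^ p <= 1 / (s * m%:R) `^ p.
    apply: (@le_trans _ _ ((1 / (s * m%:R)) `^ p)); last by rewrite powR_div// powR1.
    have b20 : 0 <= b / 2 by rewrite divr_ge0 ?block_b_ge0.
    have is0 : 0 <= 1 / (s * m%:R) by rewrite divr_ge0// ltW.
    by rewrite ge0_ler_powR ?nnegrE ?(ltW p0).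
  have spq : s `^ p = (s `^ q) `^ (p - 1).
    by rewrite -powRrM /q divfK// gt_eqF.
  have h2 : m%:R * L `^ (p - 1) <= (s * m%:R) `^ p.
    rewrite powRM ?(ltW s0)// spq.
    have -> : m%:R `^ p = m%:R * m%:R `^ (p - 1) :> R.
      have := @powRD _ m%:R 1 (p - 1); rewrite (gt_eqF mR) implybT addrC subrK => /(_ isT) ->.
      by rewrite powRr1.
    rewrite [leRHS]mulrCA ler_wpM2l// -powRM ?powR_ge0//.
    by rewrite ge0_ler_powR ?nnegrE ?mulr_ge0 ?powR_ge0 ?(ltW pm) ?(ltW L0)// mulrC.
  have Lp : 0 < L `^ (p - 1) by rewrite powR_gt0.
  have h3 : m%:R * (b / 2) `^ p <= 1 / L `^ (p - 1).
    apply: le_trans (ler_wpM2l (ler0n _ _) h1) _.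
    rewrite mulrA mulr1 ler_pdivrMr ?powR_gt0// mulrAC mul1r.
    by rewrite ler_pdivlMr.
  apply: le_trans (ler_wpM2l (ler0n _ 2) h3) _.
  by rewrite mulrA mulr1 ler_pdivrMr// -ler_pdivrMl// mulrC.
rewrite lerBlDr; apply: (@le_trans _ _ (expR (m%:R * (2 * (b / 2) `^ p)))).
  rewrite expRM_natl lerXn2r ?nnegrE ?expR_ge0 ?expR_ge1Dx//.
  by rewrite addr_ge0// mulr_ge0.
rewrite mulrCA; set y := 2 * _ in key *; have y0 : 0 <= y by rewrite mulr_ge0// mulr_ge0.
have yd1 : y <= 1 / 5 by exact: le_trans dd1.
have yd2 : y <= e `^ p / 2 by exact: le_trans dd2.
have := expR_le_double y0 yd1; lra.
Qed.

End BlockEstimates.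

(* The parameters are chosen in the order [L], [K], [s]: [L] makes [F] small in A_p,
   [K] then kills enough moments of the density, and [s] tends to 0 with [m] about
   [L / s ^ q]. *)
Lemma block p e : 1 < p < 2 -> 0 < e -> exists phi F Psi : T -> R,
  [/\ trp phi, trp F, trp Psi, bd (p / (p - 1)) (hat (cpx (fun t => phi t - 1))) e &
      bd p (hat (cpx F)) e] /\
  [/\ forall t, `|F t| <= 3 / 4, forall t, 0 <= Psi t, meanr Psi <= e &
      forall t, c0 <= F t \/ phi t ^+ 2 <= Psi t].
Proof.
move=> /andP[p1 p2] e0; set q := p / (p - 1).
have pm : 0 < p - 1 by rewrite subr_gt0.
have q2 : 2 < q by rewrite /q ltr_pdivlMr//; lra.
have ep : 0 < e `^ p by rewrite powR_gt0.
have eq' : 0 < e `^ q by rewrite powR_gt0.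
pose d := Num.min (1 / 5) (e `^ p / 2).
have d0 : 0 < d by rewrite lt_min divr_gt0//= divr_gt0.
pose L := Num.max 1 ((2 / d) `^ (p - 1)^-1).
have L1 : 1 <= L by rewrite le_max lexx.
have L0 : 0 <= L by exact: le_trans L1.
have Ld : 2 / d <= L `^ (p - 1).
  rewrite -[leLHS](powRVK (r := p - 1)) ?divr_ge0 ?(ltW d0) ?gt_eqF//.
  by rewrite ge0_ler_powR ?nnegrE ?powR_ge0 ?(ltW pm)// le_max lexx orbT.
pose lam : R := 2 * 8 `^ q.
have lam0 : 0 <= lam by rewrite mulr_ge0 ?powR_ge0.
pose Y := expR (2 * lam * (2 * L)).
have Y0 : 0 < Y by exact: expR_gt0.
have half : 0 <= (1 / 2 : R) < 1 by lra.
have [K' hK'] := exprn_small half (divr_gt0 eq' Y0).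
pose K := K'.+1.
have hK : (1 / 2) ^+ K * Y <= e `^ q.
  rewrite -ler_pdivlMr//; apply: le_trans hK'.
  by case/andP: half => h1 h2; rewrite exprS ler_piMl ?exprn_ge0// ltW.
have [w [sw mom]] := @lagrange_weights R K isT.
pose W : R := 8 ^+ K.
have W0 : 0 < W by rewrite exprn_gt0.
(* The value 28 serves [block_b_sqr], as 36 * 28 > 1000; the second one makes 2 W^2 exp(- s^2 m /
   64) at most e, by exp x >= 1 + x. *)
pose Z := Num.max 28 (64 * (2 * W ^+ 2 / e)).
have Z28 : 28 <= Z by rewrite le_max lexx.
have ZW : 64 * (2 * W ^+ 2 / e) <= Z by rewrite le_max lexx orbT.
have Z1 : 1 <= Z by lra.
have [s [m [/andP[s0 s10] m0 m2 Lm Zm]]] := choose_sm q2 L1 Z1.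
have Zm' : 28 <= s ^+ 2 * m%:R by exact: le_trans Zm.
exists (density m w s), (osc (block_b m s) m), (block_Psi m w s); split; split.
- exact: trp_density.
- exact: trp_osc.
- exact: trp_block_Psi.
- apply: bd_density => //; [|exact: ltW|].
    by apply: ltW; apply: lt_trans q2; rewrite ltr1n.
  apply: le_trans hK; rewrite ler_wpM2l ?exprn_ge0//.
  by rewrite ler_expR ler_wpM2l// mulr_ge0.
- apply: (bd_osc_block m0 s0 p1 L1 e0 d0 Ld Lm); by rewrite ge_min lexx ?orbT.
- exact: osc_le.
- exact: block_Psi_ge0.
- have K0 : (0 < K)%N by [].
  apply: (le_trans (meanr_block_Psi m K0 s0 s10 sw)); rewrite -/W.
  have w2 : 0 < 2 * W ^+ 2 by rewrite mulr_gt0 ?exprn_gt0.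
  rewrite mulrC -ler_pdivlMr// expRN -[leRHS]invrK lef_pV2 ?posrE ?expR_gt0 ?invr_gt0 ?divr_gt0//.
  rewrite invf_div; apply: le_trans (expR_ge1Dx _).
  have := le_trans ZW Zm; set x := 2 * W ^+ 2 / e; set z := s ^+ 2 * m%:R.
  have -> : 1 / 64 * s ^+ 2 * m%:R = z / 64 by rewrite /z; field.
  clearbody x z; lra.
- exact: block_event.
Qed.

End Block.

(** * The inductive construction *)

Section Inverse.
Variable R : realType.
Local Notation T := (circle R).
Local Notation C := R[i].
Local Notation nc := Normc.normc.

Definition multiplier (P : T -> C) (L : R) := 0 <= L /\
  forall r g M, 1 <= r -> ct g -> bd r (hat g) M -> bd r (hat (fun t => P t * g t)) (L * M).

Lemma multiplier_le P L L' : L <= L' -> multiplier P L -> multiplier P L'.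
Proof.
move=> LL [L0 h]; split; first exact: le_trans LL.
move=> r g M r1 cg hg; apply: bd_le (h _ _ _ r1 cg hg); first exact: le_trans r1.
by apply: ler_wpM2r => //; case: hg.
Qed.

Lemma trp_multiplier (u : T -> R) : trp u -> exists L, multiplier (cpx u) L.
Proof. by move=> [N hu]; have [L L0 h] := tp_multiplier hu; exists L. Qed.

Lemma size_rng N : size (rng N) = (N.*2).+1.
Proof. by rewrite size_map size_iota. Qed.

Lemma tpX N (f : T -> C) n : tp N f -> tp (n * N) (fun t => f t ^+ n).
Proof.
move=> hf; elim: n => [|n IH]; first by under eq_fun do rewrite expr0; exact: tp_cst.
by under eq_fun do rewrite exprS; rewrite mulSn; exact: tpM.
Qed.

Lemma bd_sup (p : R) N (f : T -> C) (M e : R) : 1 <= p -> tp N f -> 0 <= M <= 1 -> 0 <= e ->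
  (forall t, nc (f t) <= M) -> (N.*2.+1)%:R * M <= e `^ p -> bd p (hat f) e.
Proof.
move=> p1 hf /andP[M0 M1] e0 fM h; have p0 : 0 < p by apply: lt_le_trans p1.
apply: (@bd_supp _ _ (rng N)) => //; first exact: rng_uniq.
  by move=> n; rewrite mem_rng -ltnNge => /(tp_hat0 hf).
apply: le_trans h; rewrite -size_rng -sum1_size natr_sum mulr_suml; apply: ler_sum => n _.
rewrite mul1r; apply: (@le_trans _ _ (M `^ p)).
  rewrite ge0_ler_powR ?nnegrE ?nc_ge0 ?(ltW p0)//.
  exact: nc_hat (tp_ct hf) fM.
have [->|Mn0] := eqVneq M 0; first by rewrite powR0// gt_eqF.
have Mp : 0 < M by rewrite lt_neqAle eq_sym Mn0.
have := @powRD _ M 1 (p - 1); rewrite Mn0 implybT addrC subrK => /(_ isT) ->.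
rewrite powRr1// ler_piMr//.
apply: (@le_trans _ _ (1 `^ (p - 1))); last by rewrite powR1.
by rewrite ge0_ler_powR ?nnegrE ?subr_ge0.
Qed.

Lemma neumann_degree N k : (0 < k)%N -> (((k + k) * N).*2.+1 <= (4 * N + 1) * k)%N.
Proof. by move=> k0; rewrite -mul2n mulnA mulnDl mul1n mulnDr mulnDl; lia. Qed.

(* The Neumann series for 1/g: the error r^n, r = 1 - g/B, has sup norm
   exponentially small and degree linear in n, so it is small in A_p. *)
Lemma approx_inverse (p b e : R) (g : T -> R) : 1 <= p -> trp g -> 0 < b ->
  (forall t, b <= g t) -> 0 < e ->
  exists2 P : T -> R, trp P & bd p (hat (cpx (fun t => P t * g t - 1))) e.
Proof.
move=> p1 hg b0 bg e0; have [B B0 gB] := trp_bounded hg.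
have p0 : 0 < p by apply: lt_le_trans p1.
have gt0 t : 0 < g t by exact: lt_le_trans (bg t).
have bB : b <= B.
  have t := (\pi_(circle R) 0 : T)%qT.
  by apply: le_trans (bg t) _; rewrite -(gtr0_norm (gt0 t)).
pose y := b / B.
have y0 : 0 < y by rewrite divr_gt0.
have y1 : y <= 1 by rewrite ler_pdivrMr// mul1r.
pose r t := 1 - B^-1 * g t.
have hr : trp r by apply: trpB; [exact: trp_cst|exact: trpZ].
have r01 t : 0 <= r t <= 1 - y.
  rewrite /r subr_ge0 lerD2l lerN2 mulrC ler_pdivrMr// mul1r /y ler_pM2r ?invr_gt0//.
  by rewrite bg andbT -(gtr0_norm (gt0 t)).
have [N hN] := hr.
have ep : 0 < e `^ p by rewrite powR_gt0.
have th : 0 <= 1 - y < 1 by rewrite subr_ge0 y1/= ltrBlDr ltrDl.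
have N1 : 0 < (4 * N + 1)%:R :> R by rewrite ltr0n addn1.
have ey : 0 < e `^ p * y / (4 * N + 1)%:R by rewrite divr_gt0// mulr_gt0.
have [k' hk'] := exprn_small th ey; pose k := k'.+1.
have hk : (1 - y) ^+ k <= e `^ p * y / (4 * N + 1)%:R.
  apply: le_trans hk'; case/andP: th => t1 t2.
  by rewrite exprS ler_piMl ?exprn_ge0// ltW.
(* One half of the exponent beats the number of coefficients, which is linear in k; the other half
   provides the smallness. *)
pose n := (k + k)%N.
exists (fun t => B^-1 * \sum_(j < n) r t ^+ j).
  by apply/trpZ/trp_sum => j; exact: trpX.
have E t : B^-1 * (\sum_(j < n) r t ^+ j) * g t - 1 = - 1 * (r t ^+ n).
  have h := subrX1 (r t) n.
  have e1 : r t - 1 = - (B^-1 * g t) by rewrite /r; ring.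
  rewrite e1 in h; set Sm := \sum_(j < n) _ in h *.
  have -> : B^-1 * Sm * g t = - (- (B^-1 * g t) * Sm) by ring.
  by rewrite -h; ring.
rewrite (_ : cpx _ = fun t => -1 * (cpx r t ^+ n)); last first.
  apply/funext => t; rewrite /cpx E rmorphM rmorphN rmorph1; congr (_ * _).
  exact: rmorphXn.
have tpr : tp (n * N) (fun t => -1 * (cpx r t ^+ n)) by exact/tpZ/tpX.
case/andP: th => th0 th1.
apply: (bd_sup (M := (1 - y) ^+ n) p1 tpr) => //.
- by rewrite exprn_ge0//= exprn_ile1// ltW.
- exact: ltW.
- move=> t; rewrite ncM ncN nc1 mul1r ncX ncR; case/andP: (r01 t) => r0 r1.
  by rewrite ger0_norm// lerXn2r ?nnegrE.
have k0 : 0 < k%:R :> R by rewrite ltr0n.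
have hb : (1 - y) ^+ k <= (k%:R * y)^-1 by apply: pow_1subx_le => //; rewrite y0.
rewrite exprD.
apply: (@le_trans _ _ (((4 * N + 1)%:R * k%:R) * ((k%:R * y)^-1 * (e `^ p * y / (4 * N + 1)%:R)))).
  apply: ler_pM => //; first by rewrite mulr_ge0 ?exprn_ge0.
    by rewrite -natrM ler_nat; exact: neumann_degree.
  by apply: ler_pM; rewrite ?exprn_ge0.
rewrite le_eqVlt; apply/orP; left; apply/eqP.
move: N1 k0; set X := (4 * N + 1)%:R; set Y := k%:R; clearbody X Y => X0 Y0.
by field; rewrite !gt_eqF.
Qed.

End Inverse.

Section Step.
Variable R : realType.
Local Notation T := (circle R).
Implicit Types (g S Psi : T -> R).

(** Where T >= 1/2 and F >= c0, [g] is multiplied by at most 1 - c0 / 2 <= sigma^2. This takes g < x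
    to g' <= sigma (sigma x), the same invariant at the level sigma x. *)
Definition sigma : R := 1 - c0 R / 4.

Lemma sigma_bounds : 0 < sigma < 1.
Proof. by rewrite /sigma /c0; lra. Qed.

Lemma trp_cutoff g (B : R) n m : trp g -> trp (fun t => (1 - (g t / B) ^+ n) ^+ m).
Proof.
move=> hg; apply/trpX/trpB; first exact: trp_cst.
by apply: trpX; apply: trpM => //; exact: trp_cst.
Qed.

Lemma hatB_cpx (u v : T -> R) n : trp u -> trp v ->
  hat (cpx (fun t => u t - v t)) n = hat (cpx u) n - hat (cpx v) n.
Proof.
move=> hu hv; rewrite -hatB; try exact: trp_ct.
by congr (hat _ n); apply/funext => t; rewrite /cpx rmorphB.
Qed.

(* The order of choices matters: first the cutoff of [g], then the block, whose
   smallness depends on [g] and [S], then the cutoff of [S], which depends on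
   sup |phi|, and finally the dilation [M], which decouples [phi] from [S]. *)
Lemma step p g S Psi (x b eta d : R) : 1 < p < 2 ->
  [/\ trp g, trp S, trp Psi & 0 < x] -> [/\ 0 < b, 0 <= eta & 0 < d] ->
  (forall t, b <= g t) -> (forall t, 0 <= Psi t) -> meanr Psi <= eta ^+ 2 ->
  (forall t, g t <= sigma * x \/ S t ^+ 2 <= Psi t) ->
  exists g' S' Psi',
  [/\ trp g', trp S', trp Psi', forall t, b / 4 <= g' t & forall t, 0 <= Psi' t] /\
  [/\ meanr Psi' <= d ^+ 2,
      forall t, g' t <= sigma * (sigma * x) \/ S' t ^+ 2 <= Psi' t &
      forall t, `|g' t - g t| <= 2 * x] /\
  [/\ bd p (hat (cpx (fun t => g' t - g t))) d,
      bd (p / (p - 1)) (hat (cpx (fun t => S' t - S t))) (eta + 2 * d) &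
      forall t, x <= g t -> `|S' t| <= `|S t| / 2].
Proof.
move=> p12 [hg hS hPsi x0] [b0 eta0 d0] bg Psi0 mPsi alt.
have [p1 p2] := andP p12.
have q2 : 2 < p / (p - 1) by rewrite ltr_pdivlMr ?subr_gt0//; lra.
have [s0 s1] := andP sigma_bounds.
have gt0 t : 0 < g t by exact: lt_le_trans (bg t).
have [Bg Bg0 gBg] := trp_bounded hg.
pose B := Bg + 2 * x.
have B0 : 0 < B by rewrite addr_gt0// mulr_gt0.
have gB t : 0 <= g t <= B.
  rewrite ltW//= -(gtr0_norm (gt0 t)); apply: le_trans (gBg t) _.
  by rewrite lerDl mulr_ge0// ltW.
have x2B : 2 * x <= B by rewrite lerDr ltW.
have x1B : x <= B by apply: le_trans x2B; rewrite ler_peMl ?(ltW x0)// ler1n.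
(* 1/2 ensures T >= 1/2 where g <= x; x / B ensures g T <= x where g >= 2 x. *)
pose d1 := Num.min (1 / 2) (x / B).
have d10 : 0 < d1 by rewrite lt_min !divr_gt0.
have x12 : x < 2 * x by rewrite ltr_pMl// ltr1n.
have [n1 [m1 [T01 Tlow Thigh]]] := cutoff_polynomial x0 x12 x2B d10.
set pT := fun z : R => (1 - (z / B) ^+ n1) ^+ m1 in T01 Tlow Thigh.
pose Tg t := pT (g t).
have hTg : trp Tg by exact: trp_cutoff.
have Tg01 t : 0 <= Tg t <= 1 by exact: T01.
have gTg t : g t * Tg t <= 2 * x.
  have /andP[T0 T1] := Tg01 t; have /andP[g0 g1] := gB t.
  have [gx|gx] := leP (g t) (2 * x).
    by rewrite -[leRHS]mulr1 ler_pM.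
  apply: (@le_trans _ _ (B * d1)).
    by rewrite ler_pM// Thigh// (ltW gx).
  apply: (@le_trans _ _ (B * (x / B))); last by rewrite mulrC divfK ?gt_eqF// ltW.
  by rewrite ler_wpM2l ?(ltW B0)// ge_min lexx orbT.
have [L1 hL1] := trp_multiplier (trpM hg hTg).
have L10 : 0 < L1 + 1 by rewrite ltr_wpDl// hL1.1.
have [BS BS0 SBS] := trp_bounded hS.
(* The three bounds control, in order, g' - g in A_p, the effect of phi - 1 on S in A_q, and the
   mean of the new majorant. *)
pose eb := Num.min (d / (L1 + 1)) (Num.min (d / BS) (d ^+ 2 / (2 * BS ^+ 2))).
have eb0 : 0 < eb by rewrite !lt_min !divr_gt0// ?exprn_gt0// mulr_gt0// exprn_gt0.
have eb1 : eb * (L1 + 1) <= d by rewrite -ler_pdivlMr// ge_min lexx.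
have eb2 : eb * BS <= d by rewrite -ler_pdivlMr// !ge_min lexx !orbT.
have eb3 : BS ^+ 2 * eb <= d ^+ 2 / 2.
  apply: (@le_trans _ _ (BS ^+ 2 * (d ^+ 2 / (2 * BS ^+ 2)))).
    by rewrite ler_wpM2l ?sqr_ge0// !ge_min lexx !orbT.
  by rewrite le_eqVlt; apply/orP; left; apply/eqP; field; rewrite gt_eqF.
have [phi [F [Pb [[hphi hF hPb bphi bF] [F34 Pb0 mPb good]]]]] := block p12 eb0.
have F1 t : `|F t| <= 1.
  by apply: le_trans (F34 t) _; rewrite ler_pdivrMr// mul1r ler_nat.
have [Bp Bp0 phiBp] := trp_bounded hphi.
(* The three bounds give |S (1 - X)| <= d where g <= sigma x and, where g >= x, |S'| <= |S| / 2 and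
   |S'| <= d / 2. *)
pose d2 := Num.min (d / BS) (Num.min (1 / (2 * Bp)) (d / (2 * BS * Bp))).
have d20 : 0 < d2 by rewrite !lt_min !divr_gt0// ?mulr_gt0// mulr_gt0.
have d2a : BS * d2 <= d by rewrite mulrC -ler_pdivlMr// ge_min lexx.
have d2b : d2 * Bp <= 1 / 2.
  apply: (@le_trans _ _ (1 / (2 * Bp) * Bp)); last first.
    by rewrite le_eqVlt; apply/orP; left; apply/eqP; field; rewrite gt_eqF.
  by rewrite ler_wpM2r ?(ltW Bp0)// !ge_min lexx !orbT.
have d2c : BS * d2 * Bp <= d / 2.
  apply: (@le_trans _ _ (BS * (d / (2 * BS * Bp)) * Bp)).
    by rewrite ler_wpM2r ?(ltW Bp0)// ler_wpM2l ?(ltW BS0)// !ge_min lexx !orbT.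
  by rewrite le_eqVlt; apply/orP; left; apply/eqP; field; rewrite !gt_eqF.
have sx0 : 0 < sigma * x by rewrite mulr_gt0.
have sx : sigma * x < x by rewrite gtr_pMl.
have [n2 [m2 [X01 Xlow Xhigh]]] := cutoff_polynomial sx0 sx x1B d20.
set pX := fun z : R => (1 - (z / B) ^+ n2) ^+ m2 in X01 Xlow Xhigh.
pose Xg t := pX (g t).
have hXg : trp Xg by exact: trp_cutoff.
have Xg01 t : 0 <= Xg t <= 1 by exact: X01.
pose SX t := S t * Xg t.
have hSX : trp SX by exact: trpM.
have [N hN] := hSX; pose M := (N.*2).+1.
pose g' t := g t - (g t * Tg t) * F (dil M t).
pose S' t := SX t * phi (dil M t).
pose Psi' t := d ^+ 2 / 2 + BS ^+ 2 * Pb (dil M t).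
have hFM : trp (fun t => F (dil M t)) by exact: trp_dil.
have hPM : trp (fun t => phi (dil M t)) by exact: trp_dil.
have hPbM : trp (fun t => Pb (dil M t)) by exact: trp_dil.
have hg' : trp g' by apply: trpB => //; apply: trpM => //; exact: trpM.
have hS' : trp S' by exact: trpM.
have hPsi' : trp Psi' by apply: trpD; [exact: trp_cst|exact: trpZ].
have SXle t : `|SX t| <= BS.
  have /andP[X0 X1] := Xg01 t.
  by rewrite normrM (ger0_norm X0) -[leRHS]mulr1 ler_pM.
have Xx t : x <= g t -> Xg t <= d2.
  by move=> xg; apply: Xhigh; rewrite xg; case/andP: (gB t).
have d22 : 0 <= d ^+ 2 / 2 by rewrite divr_ge0// sqr_ge0.
exists g', S', Psi'; split; [split|split; split] => //.
- move=> t; rewrite /g'.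
  have -> : g t - g t * Tg t * F (dil M t) = g t * (1 - Tg t * F (dil M t)) by ring.
  have : Tg t * F (dil M t) <= 3 / 4.
    apply: le_trans (ler_norm _) _; rewrite normrM -[leRHS]mul1r.
    by have /andP[T0 T1] := Tg01 t; rewrite ler_pM// ger0_norm.
  move=> h; apply: ler_pM; rewrite ?(ltW b0)//; lra.
- by move=> t; rewrite addr_ge0// mulr_ge0// sqr_ge0.
- rewrite meanrD ?meanr_cst ?meanrZ ?meanr_dil//; try exact: trp_cst; last exact: trpZ.
  apply: (@le_trans _ _ (d ^+ 2 / 2 + d ^+ 2 / 2)); last by rewrite -mulrDl -mulr2n -[X in X / 2]mulr_natr mulfK.
  rewrite lerD2l; apply: le_trans eb3; rewrite ler_wpM2l ?sqr_ge0//.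
- move=> t; have /andP[X0 X1] := Xg01 t; have /andP[T0 T1] := Tg01 t.
  (* Where g >= x the cutoff X makes S' small. Where g < x the block decides at the dilated point:
     either F >= c0 lowers g, or phi^2 is at most its majorant. *)
  have [xg|gx] := leP x (g t).
    right; apply: (@le_trans _ _ (d ^+ 2 / 2)); last by rewrite lerDl mulr_ge0 ?sqr_ge0.
    apply: (@le_trans _ _ ((d / 2) ^+ 2)); last first.
      by rewrite expr_div_n ler_wpM2l ?sqr_ge0// lef_pV2 ?posrE ?exprn_gt0//; lra.
    rewrite -real_normK ?num_real// lerXn2r ?nnegrE ?divr_ge0 ?(ltW d0)//.
    apply: le_trans d2c; rewrite /S' normrM ler_pM// normrM ler_pM//.
    by rewrite ger0_norm// Xx.
  have [cF|hP] := good (dil M t); [left|right].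
    have Th : 1 / 2 <= Tg t.
      apply: (@le_trans _ _ (1 - d1)); last by apply: Tlow; rewrite (ltW gx) ltW.
      have : d1 <= 1 / 2 by rewrite ge_min lexx.
      lra.
    rewrite /g'.
    have -> : g t - g t * Tg t * F (dil M t) = g t * (1 - Tg t * F (dil M t)) by ring.
    have cT : 1 / 2 * c0 R <= Tg t * F (dil M t) by rewrite ler_pM// /c0; lra.
    have TF1 : 0 <= 1 - Tg t * F (dil M t).
      rewrite subr_ge0; apply: le_trans (ler_norm _) _; rewrite normrM -[leRHS]mul1r.
      have nT : `|Tg t| <= 1 by rewrite ger0_norm.
      have nF : `|F (dil M t)| <= 1 by exact: F1.
      by rewrite ler_pM.
    have -> : sigma * (sigma * x) = x * sigma ^+ 2 by ring.
    apply: ler_pM => //; rewrite ?ltW//.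
    by rewrite /sigma; move: cT; rewrite /c0; lra.
  apply: (@le_trans _ _ (BS ^+ 2 * Pb (dil M t))); last by rewrite lerDr.
  rewrite /S' exprMn ler_pM ?sqr_ge0//.
  by rewrite -real_normK ?num_real// lerXn2r ?nnegrE// ltW.
- move=> t; rewrite /g' addrAC subrr sub0r normrN normrM -[leRHS]mulr1.
  have /andP[T0 T1] := Tg01 t.
  have a1 : `|g t * Tg t| <= 2 * x by rewrite ger0_norm// mulr_ge0// ltW.
  by have a2 := F1 (dil M t); rewrite ler_pM.
- have -> : cpx (fun t => g' t - g t) =
      fun t => -1 * (cpx (fun t => g t * Tg t) t * cpx (fun t => F (dil M t)) t).
    apply/funext => t; rewrite mulN1r /cpx -cRM.
    have -> : g' t - g t = - (g t * Tg t * F (dil M t)) by rewrite /g'; ring.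
    exact: rmorphN.
  have p0 : 1 <= p by exact: ltW.
  have hm := hL1.2 _ _ _ p0 (trp_ct hFM) (_ : bd p (hat (cpx (fun t => F (dil M t)))) eb).
  have [NF hNF] := hF.
  have {}hm := hm (bd_dil p0 hNF (ltn0Sn _) bF).
  have cm := ctM (trp_ct (trpM hg hTg)) (trp_ct hFM).
  rewrite (_ : hat _ = fun n => -1 * hat (fun t => cpx (fun t => g t * Tg t) t * cpx (fun t => F (dil M t)) t) n); last first.
    by apply/funext => n; rewrite -hatZ.
  have := bdZ (-1) (le_trans ler01 p0) hm.
  rewrite ncN nc1 mul1r; apply: bd_le; first exact: (le_trans ler01 p0).
  by apply: le_trans eb1; rewrite mulrC ler_wpM2l ?(ltW eb0)// lerDl.
- have q1 : 1 <= p / (p - 1) by apply: ltW; apply: lt_trans q2; rewrite ltr1n.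
  have q0 : 0 <= p / (p - 1) := le_trans ler01 q1.
  (* S' - S = D1 - D2. The tensor bound makes D1 cost d in A_q. D2 is estimated in L^2: where g <=
     sigma x the cutoff X is close to 1, elsewhere S^2 <= Psi. *)
  pose D1 t := SX t * (phi (dil M t) - 1).
  pose D2 t := S t * (1 - Xg t).
  have hphi1 : trp (fun t => phi t - 1) by apply: trpB => //; exact: trp_cst.
  have hD1 : trp D1 by apply: trpM => //; apply: trpB => //; exact: trp_cst.
  have hD2 : trp D2 by apply: trpM => //; apply: trpB => //; exact: trp_cst.
  have -> : hat (cpx (fun t => S' t - S t)) = fun n => hat (cpx D1) n - hat (cpx D2) n.
    apply/funext => n; rewrite -hatB_cpx//; congr (hat (cpx _) n); apply/funext => t.
    by rewrite /S' /D1 /D2 /SX; ring.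
  have b1 : bd (p / (p - 1)) (hat (cpx D1)) d.
    have bSX : bd (p / (p - 1)) (hat (cpx SX)) BS.
      apply: bd2q (ltW q2) _; apply: bessel_sqr => //; first exact: ltW.
      rewrite -[leRHS](meanr_cst (R := R)); apply: meanr_le; [exact: trpX|exact: trp_cst|].
      by move=> t; rewrite -real_normK ?num_real// lerXn2r ?nnegrE// ltW.
    have [Np hNp] := hphi1.
    have := bd_tensor q1 hN hNp (ltnSn _) bSX bphi.
    rewrite (_ : (fun t => _) = cpx D1); last first.
      by apply/funext => t; rewrite /cpx -rmorphM.
    by apply: bd_le => //; rewrite mulrC.
  have b2 : bd (p / (p - 1)) (hat (cpx D2)) (eta + d).
    apply: bd2q (ltW q2) _; apply: bessel_sqr => //; first by rewrite addr_ge0// ltW.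
    apply: (@le_trans _ _ (meanr (fun t => Psi t + d ^+ 2))).
      apply: meanr_le; [exact: trpX|apply: trpD => //; exact: trp_cst|].
      move=> t; have /andP[X0 X1] := Xg01 t.
      rewrite /D2 exprMn.
      have Y01 : 0 <= (1 - Xg t) ^+ 2 <= 1.
        by rewrite sqr_ge0/= exprn_ile1// ?subr_ge0// lerBlDr lerDl.
      case/andP: Y01 => Y0 Y1.
      have [gs|SP] := alt t.
        apply: (@le_trans _ _ (d ^+ 2)); last by rewrite lerDr.
        rewrite -exprMn -real_normK ?num_real// lerXn2r ?nnegrE ?(ltW d0)//.
        apply: le_trans d2a; rewrite normrM ler_pM// ger0_norm ?subr_ge0//.
        by rewrite lerBlDl -lerBlDr; apply: Xlow; rewrite ltW.
      apply: (@le_trans _ _ (Psi t)); last by rewrite lerDl sqr_ge0.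
      by rewrite -[leRHS]mulr1 ler_pM// sqr_ge0.
    rewrite meanrD ?meanr_cst//; last exact: trp_cst.
    rewrite sqrrD lerD2r; apply: le_trans mPsi _.
    by rewrite lerDl mulrn_wge0// mulr_ge0// ltW.
  have := bdB q1 b1 b2; apply: bd_le => //; lra.
- move=> t xg; rewrite /S' /SX !normrM -mulrA ler_wpM2l//.
  have /andP[X0 X1] := Xg01 t.
  rewrite -[_^-1]mul1r; apply: le_trans d2b; rewrite ler_pM//.
  by rewrite ger0_norm// Xx.
Qed.

End Step.

(** * Limits of geometrically convergent sequences *)

Section GeometricLimits.
Variable R : realType.
Local Notation C := R[i].
Local Notation nc := Normc.normc.

(** The intervals [u_k - e_k, u_k + e_k], with e_k the remainder of the geometric series, are
    nested; the supremum of the left ends lies in all of them. *)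
Lemma geometric_limit (u : nat -> R) (A r : R) : 0 <= r < 1 -> 
  (forall k, `|u k.+1 - u k| <= A * r ^+ k) ->
  exists l, forall k, `|l - u k| <= A * r ^+ k / (1 - r).
Proof.
move=> /andP[r0 r1] h; have d0 : 0 < 1 - r by rewrite subr_gt0.
pose e k := A * r ^+ k / (1 - r).
have eS k : A * r ^+ k + e k.+1 = e k.
  by rewrite /e exprS; field; rewrite gt_eqF.
have dec k : u k.+1 + e k.+1 <= u k + e k.
  by rewrite -(eS k); have := h k; rewrite ler_norml => /andP[_]; lra.
have inc k : u k - e k <= u k.+1 - e k.+1.
  by rewrite -(eS k); have := h k; rewrite ler_norml => /andP[+ _]; lra.
have e0 k : 0 <= e k.
  by rewrite divr_ge0 ?(ltW d0)//; apply: le_trans (h k).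
have dec' i j : (i <= j)%N -> u j + e j <= u i + e i.
  move=> ij; rewrite -(subnK ij); elim: (j - i)%N => [//|n IH].
  by rewrite addSn; exact: le_trans (dec _) IH.
have inc' i j : (i <= j)%N -> u i - e i <= u j - e j.
  move=> ij; rewrite -(subnK ij); elim: (j - i)%N => [//|n IH].
  by rewrite addSn; exact: le_trans IH (inc _).
have ub i j : u i - e i <= u j + e j.
  have [ij|/ltnW ji] := leqP i j.
    by apply: le_trans (inc' _ _ ij) _; rewrite lerD2l; have := e0 j; lra.
  by apply: le_trans (dec' _ _ ji); rewrite lerD2l; have := e0 i; lra.
pose E : set R := [set x | exists k, x = u k - e k].
exists (sup E) => k; rewrite -/(e k) ler_norml; apply/andP; split.
  have : u k - e k <= sup E.
    apply: ub_le_sup; last by exists k.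
    by exists (u 0 + e 0) => _ [i ->].
  lra.
rewrite lerBlDl; apply: ge_sup; first by exists (u 0%N - e 0%N), 0%N.
by move=> _ [i ->].
Qed.

Lemma geometric_limit_cpx (u : nat -> C) (A r : R) : 0 <= r < 1 ->
  (forall k, nc (u k.+1 - u k) <= A * r ^+ k) ->
  exists l, forall k, nc (l - u k) <= 2 * A * r ^+ k / (1 - r).
Proof.
move=> r01 h.
have ReB (z w : C) : complex.Re (z - w) = complex.Re z - complex.Re w by case: z w => [? ?] [? ?].
have ImB (z w : C) : complex.Im (z - w) = complex.Im z - complex.Im w by case: z w => [? ?] [? ?].
have [|a ha] := @geometric_limit (fun k => complex.Re (u k)) A r r01.
  by move=> k; rewrite -ReB; exact: le_trans (nc_Re _) (h k).
have [|b hb] := @geometric_limit (fun k => complex.Im (u k)) A r r01.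
  by move=> k; rewrite -ImB; exact: le_trans (nc_Im _) (h k).
exists (a +i* b) => k; apply: le_trans (nc_ReIm _) _; rewrite ReB ImB /=.
have := lerD (ha k) (hb k); have -> : 2 * A * r ^+ k / (1 - r) =
  A * r ^+ k / (1 - r) + A * r ^+ k / (1 - r) by ring.
by [].
Qed.

Lemma geometric_zero (x A r : R) : 0 <= r < 1 -> 0 <= x ->
  (forall k, x <= A * r ^+ k) -> x = 0.
Proof.
move=> r01 x0 h; apply/eqP; rewrite eq_le x0 andbT leNgt; apply/negP => xp.
have A0 : 0 < A by have := h 0%N; rewrite expr0 mulr1; exact: lt_le_trans.
have [k hk] := exprn_small r01 (divr_gt0 xp (mulr_gt0 (ltr0n R 2) A0)).
have := le_trans (h k) (ler_wpM2l (ltW A0) hk).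
have -> : A * (x / (2 * A)) = x / 2 by field; rewrite gt_eqF.
lra.
Qed.

Lemma geometric_eventually (A r e : R) : 0 <= r < 1 -> 0 < e ->
  exists k0, forall k, (k0 <= k)%N -> A * r ^+ k <= e.
Proof.
move=> r01 e0; have A1 : 0 < `|A| + 1 by rewrite ltr_wpDl.
have [k0 hk] := exprn_small r01 (divr_gt0 e0 A1).
exists k0 => k kk; case/andP: r01 => r0 r1.
apply: (@le_trans _ _ ((`|A| + 1) * r ^+ k0)).
  apply: (@le_trans _ _ ((`|A| + 1) * r ^+ k)).
    by rewrite ler_wpM2r ?exprn_ge0//; apply: le_trans (ler_norm _) _; rewrite lerDl.
  by rewrite ler_wpM2l ?(ltW A1)// ler_wiXn2l// ltW.
by rewrite mulrC -ler_pdivlMr.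
Qed.

End GeometricLimits.

Section Construction.
Variable R : realType.
Local Notation T := (circle R).

(** Besides the two functions, the state keeps what the next step needs: a majorant of S^2 above the
    current level of [g], a positive lower bound of [g], and the accumulated multiplier bound
    [st_L]. *)
Record state := State { st_g : T -> R; st_S : T -> R; st_Psi : T -> R;
  st_b : R; st_L : R; st_k : nat }.

(** Shifted by one power so that sigma * thr 0 = 1: for [g] equal to 1 the initial invariant then
    holds through its first alternative. *)
Definition thr (k : nat) : R := @sigma R ^+ k / @sigma R.
(** A step with d <= eta (k + 1) moves S by at most eta k + 2 d <= (1/32) 2^(-k) in A_q. The total,
    1/16, is less than the mean 1 of the initial function, so the limit is nonzero. *)
Definition eta (k : nat) : R := 1 / 64 * (1 / 2) ^+ k.

Definition valid (st : state) : Prop :=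
  [/\ trp (st_g st), trp (st_S st), trp (st_Psi st), 0 < st_b st & 0 <= st_L st] /\
  [/\ forall t, st_b st <= st_g st t, forall t, 0 <= st_Psi st t,
      meanr (st_Psi st) <= eta (st_k st) ^+ 2 &
      forall t, st_g st t <= @sigma R * thr (st_k st) \/ st_S st t ^+ 2 <= st_Psi st t].

(** [st_L] dominates the multiplier bounds of all approximate inverses found so far. Dividing the
    displacement of [g] by 1 + [st_L] makes every later change of [g] harmless for each earlier
    product P g. *)
Definition transition (p : R) (s s' : state) : Prop :=
  [/\ st_k s' = (st_k s).+1, st_L s <= st_L s',
      forall t, `|st_g s' t - st_g s t| <= 2 * thr (st_k s) &
      forall t, thr (st_k s) <= st_g s t -> `|st_S s' t| <= `|st_S s t| / 2] /\
  [/\ bd p (hat (cpx (fun t => st_g s' t - st_g s t))) ((1 / 2) ^+ st_k s / (1 + st_L s')),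
      bd (p / (p - 1)) (hat (cpx (fun t => st_S s' t - st_S s t))) (1 / 32 * (1 / 2) ^+ st_k s) &
      exists P, [/\ trp P, multiplier (cpx P) (st_L s') &
        bd p (hat (cpx (fun t => P t * st_g s t - 1))) ((1 / 2) ^+ st_k s)]].

Lemma sigma_thr k : @sigma R * thr k = thr k.+1.
Proof. by rewrite /thr exprS mulrA. Qed.

Lemma thr_gt0 k : 0 < thr k.
Proof. by have /andP[s0 s1] := sigma_bounds R; rewrite divr_gt0// exprn_gt0. Qed.

Lemma eta_gt0 k : 0 < eta k.
Proof. by rewrite mulr_gt0// ?divr_gt0// exprn_gt0// divr_gt0. Qed.

Lemma transition_exists p s : 1 < p < 2 -> valid s ->
  exists2 s', valid s' & transition p s s'.
Proof.
case: s => g S Psi b L k p12 [[/= hg hS hPsi b0 L0] [bg Psi0 mPsi alt]].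
have [p1 p2] := andP p12.
have half0 : 0 < (1 / 2) ^+ k :> R by rewrite exprn_gt0// divr_gt0.
(* The inverse is fixed before the step, so that the size d of the step may depend on its multiplier
   bound. *)
have [P hP bP] := approx_inverse (ltW p1) hg b0 bg half0.
have [L1 hL1] := trp_multiplier hP.
pose L' := L + L1.
have L10 : 0 <= L1 by case: hL1.
have L'0 : 0 < 1 + L' by rewrite ltr_pwDl// addr_ge0.
pose d := Num.min ((1 / 2) ^+ k / (1 + L')) (eta k.+1).
have d0 : 0 < d by rewrite lt_min divr_gt0//= eta_gt0.
have [g' [S' [Psi' [[hg' hS' hPsi' bg' Psi'0] [[mPsi' alt' dg] [bdg bdS Sx]]]]]] :=
  step p12 (And4 hg hS hPsi (thr_gt0 k)) (And3 b0 (ltW (eta_gt0 k)) d0) bg Psi0 mPsi alt.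
exists (State g' S' Psi' (b / 4) L' k.+1).
  split; split => //=; first by rewrite divr_gt0.
  - by rewrite addr_ge0.
  - by apply: le_trans mPsi' _; rewrite lerXn2r ?nnegrE ?(ltW d0) ?(ltW (eta_gt0 _))// ge_min lexx orbT.
  - by move=> t; rewrite -sigma_thr; exact: alt'.
split; split => //=.
- by rewrite lerDl.
- by apply: bd_le bdg; [exact: le_trans (ltW p1)|rewrite ge_min lexx].
- apply: bd_le bdS; first by rewrite divr_ge0// ?subr_ge0 ltW// (lt_trans ltr01).
  have : d <= eta k.+1 by rewrite ge_min lexx orbT.
  rewrite /eta exprS; lra.
- exists P; split => //; apply: multiplier_le hL1.
  by rewrite /L' lerDr.
Qed.

Lemma construction p : 1 < p < 2 -> exists (g S : nat -> T -> R) (L : nat -> R),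
  [/\ forall k, trp (g k), forall k, trp (S k), g 0%N = fun=> 1, S 0%N = fun=> 1 & forall k t, 0 <= g k t] /\
  [/\ forall k, 0 <= L k, forall k, L k <= L k.+1, 
      forall k t, `|g k.+1 t - g k t| <= 2 * thr k &
      forall k t, thr k <= g k t -> `|S k.+1 t| <= `|S k t| / 2] /\
  [/\ forall k, bd p (hat (cpx (fun t => g k.+1 t - g k t))) ((1 / 2) ^+ k / (1 + L k.+1)),
      forall k, bd (p / (p - 1)) (hat (cpx (fun t => S k.+1 t - S k t))) (1 / 32 * (1 / 2) ^+ k) &
      forall k, exists P, [/\ trp P, multiplier (cpx P) (L k.+1) &
        bd p (hat (cpx (fun t => P t * g k t - 1))) ((1 / 2) ^+ k)]].
Proof.
move=> p12; have [s0 s1] := andP (sigma_bounds R).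
pose st0 := State (fun=> 1) (fun=> 1) (fun=> 0) 1 0 0.
have v0 : valid st0.
  split; split => //=; try exact: trp_cst.
  - by rewrite meanr_cst sqr_ge0.
  - by move=> t; left; rewrite sigma_thr /thr expr1 divff// gt_eqF.
have next (x : {s | valid s}) : {y : {s | valid s} | transition p (sval x) (sval y)}.
  apply: cid; case: x => s vs; have [s' vs' h] := transition_exists p12 vs.
  by exists (exist _ s' vs').
have [f [f0 fS]] := dependent_choice next (exist _ st0 v0).
have kE k : st_k (sval (f k)) = k.
  elim: k => [|k IH]; first by rewrite f0.
  by have [[-> _ _ _] _] := fS k; rewrite IH.
exists (fun k => st_g (sval (f k))), (fun k => st_S (sval (f k))), (fun k => st_L (sval (f k))).
split; [split|split; split].
- by move=> k; have [[]] := svalP (f k).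
- by move=> k; have [[]] := svalP (f k).
- by rewrite f0.
- by rewrite f0.
- move=> k t; have [[_ _ _ b0 _] [h _ _ _]] := svalP (f k).
  by apply: le_trans (h t); exact: ltW.
- by move=> k; have [[]] := svalP (f k).
- by move=> k; have [[]] := fS k.
- by move=> k; have [[_ _ + _] _] := fS k; rewrite kE.
- by move=> k; have [[_ _ _ +] _] := fS k; rewrite kE.
- by move=> k; have [_ [+ _ _]] := fS k; rewrite kE.
- by move=> k; have [_ [_ + _]] := fS k; rewrite kE.
- by move=> k; have [_ [_ _ +]] := fS k; rewrite kE.
Qed.

End Construction.

(** * Topology of the circle and decay of Fourier coefficients *)

Section CircleTopology.
Variable R : realType.
Local Notation T := (circle R).
Local Notation C := R[i].
Local Notation nc := Normc.normc.
Local Notation qpi := (\pi_(circle R))%qT.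

Lemma shift_period (x : R) : exists k : int, 0 <= x + k%:~R * (2 * pi) <= 2 * pi.
Proof.
exists (- Num.floor (x / (2 * pi))).
have p0 := twopi_gt0 R.
have /andP[h1 h2] := Num.Theory.floor_itv (x / (2 * pi)).
rewrite mulrNz mulNr; rewrite ler_pdivlMr// in h1.
rewrite subr_ge0 h1 /= lerBlDr -[X in X + _]mul1r -mulrDl -ler_pdivrMr//.
by rewrite addrC -[1]/(1%:~R) -intrD ltW.
Qed.

Lemma qpi_period x k : qpi (x + k%:~R * (2 * pi)) = qpi x.
Proof.
apply/eqmodP/asboolP; exists k; by rewrite addrAC subrr add0r.
Qed.

Lemma circle_repr (t : T) : exists2 x : R, 0 <= x <= 2 * pi & t = qpi x.
Proof.
have [x ->] := circleP t; have [k hk] := shift_period x.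
by exists (x + k%:~R * (2 * pi)); rewrite ?qpi_period.
Qed.

Lemma continuous_bounded_segment (h : R -> R) : continuous (h : R -> R^o) ->
  exists M, forall x, 0 <= x <= 2 * pi -> `|h x| <= M.
Proof.
move=> ch; have cn : continuous ((fun x => `|h x|) : R -> R^o).
  by move=> x; apply: (continuous_comp (ch x)); exact: norm_continuous.
have [c _ hc] := EVT_max (ltW (twopi_gt0 R)) (continuous_subspaceT cn).
by exists `|h c| => x hx; apply: hc; rewrite in_itv.
Qed.

Lemma ct_bounded (f : T -> C) : ct f -> exists2 M, 0 < M & forall t, nc (f t) <= M.
Proof.
move=> [cr ci]; have [A hA] := continuous_bounded_segment cr.
have [B hB] := continuous_bounded_segment ci.
exists (`|A| + `|B| + 1); first by rewrite ltr_wpDl ?addr_ge0.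
move=> t; have [x hx ->] := circle_repr t.
apply: le_trans (nc_ReIm _) _; have := hA _ hx; have := hB _ hx; rewrite /repull /impull.
have := ler_norm A; have := ler_norm B; lra.
Qed.

Lemma pi_cts : continuous (qpi : R -> T).
Proof. exact: pi_continuous. Qed.

(** It is the image, under the quotient map, of the compact set of zeros of the lift in
    [0, 2 pi]. *)
Lemma compact_zero_set (f : T -> R) : continuous ((fun x => f (qpi x)) : R -> R^o) ->
  compact [set t | f t = 0].
Proof.
move=> cf.
have -> : [set t | f t = 0] =
    [set qpi x | x in `[0, 2 * pi]%classic `&` [set x | f (qpi x) = 0]].
  apply/seteqP; split => [t /= ft|_ /= [x [_ hx] <-]//].
  have [x hx tx] := circle_repr t; exists x; last by rewrite tx.
  by split; [rewrite /= in_itv|rewrite /= -tx].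
apply: continuous_compact; first exact/continuous_subspaceT/pi_cts.
apply: (subclosed_compact _ (@segment_compact R 0 (2 * pi))); last by move=> x [].
apply: closedI; first exact: interval_closed.
rewrite (_ : [set x | _] = (fun x => f (qpi x)) @^-1` [set 0])//.
by apply: preimage_closed; [move=> x _; exact: cf|exact: closed_eq].
Qed.

Lemma continuous_cpx (f : T -> R) : continuous ((fun x => f (qpi x)) : R -> R^o) ->
  continuous (fun t => (f t)%:C).
Proof.
move=> cf; apply/quotient_continuous => x /=.
apply/cvgrPdist_lt => e e0.
have e1 : 0 < complex.Re e by move: e0; rewrite ltcE => /andP[].
have eI : complex.Im e = 0 by move: e0; rewrite ltcE => /andP[/eqP].
have /cvgrPdist_lt/(_ _ e1) := cf x.
apply: filterS => y h; rewrite /= -[X in X < _]/(`|(f (qpi x))%:C - (f (qpi y))%:C|).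
rewrite -nc_normr -rmorphB ncR ltcE /= eI eqxx /=; exact: h.
Qed.

Lemma open_superlevel (f : T -> R) (c : R) : continuous ((fun x => f (qpi x)) : R -> R^o) ->
  open [set t | c < f t].
Proof.
move=> cf; rewrite /open /= /quotient_open.
rewrite (_ : _ @^-1` _ = (fun x => f (qpi x)) @^-1` [set y | c < y])//.
by apply: open_comp; [move=> x _; exact: cf|exact: open_gt].
Qed.

Lemma ct_uniform_limit (f : nat -> T -> R) (g : T -> R) (e : nat -> R) :
  (forall k, ct (fun t => (f k t)%:C)) -> (forall k t, `|g t - f k t| <= e k) ->
  (forall d, 0 < d -> exists k, e k <= d) -> ct (fun t => (g t)%:C).
Proof.
move=> cf h eps; split; last by move=> x; exact: cst_continuous.
move=> x; apply/cvgrPdist_lt => d d0.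
have [k hk] := eps (d / 3) (divr_gt0 d0 (ltr0n R 3)).
have d3 : 0 < d / 3 by rewrite divr_gt0.
have /cvgrPdist_lt/(_ _ d3) := (cf k).1 x.
apply: filterS => y hy; rewrite /repull /= in hy *.
have h1 := le_trans (h k (qpi x)) hk; have h2 := le_trans (h k (qpi y)) hk.
rewrite ler_norml in h1; rewrite ler_norml in h2.
move: hy; rewrite !ltr_norml => /andP[y1 y2]; move/andP: h1 => [a1 a2]; move/andP: h2 => [b1 b2].
apply/andP; split; lra.
Qed.

End CircleTopology.

(** * Seminorms and Fourier decay of test functions *)

Section TestFunctions.
Variable R : realType.
Local Notation T := (circle R).
Local Notation C := R[i].
Local Notation nc := Normc.normc.
Local Notation qpi := (\pi_(circle R))%qT.

Implicit Types h : R -> R.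

Definition periodic h := forall x, h (x + 2 * pi) = h x.

Lemma periodicz h k x : periodic h -> h (x + k%:~R * (2 * pi)) = h x.
Proof.
move=> hp; have P (m : nat) y : h (y + m%:R * (2 * pi)) = h y.
  by elim: m => [|m IH]; rewrite ?mul0r ?addr0// -natr1 mulrDl mul1r addrA hp.
case: k => m; first exact: P.
rewrite NegzE mulrNz mulNr -pmulrn.
by rewrite -(P m.+1 (x - m.+1%:R * (2 * pi))) subrK.
Qed.

Lemma periodic_derive1 h : smoothR h -> periodic h -> periodic (derive1 h).
Proof.
move=> sh hp x; have d0 (y : R) : derivable h y 1 by have := sh 0%N y.
have dh (y : R) : is_derive y 1 h (derive1 h y).
  by apply: DeriveDef => //; rewrite derive1E.
have dl : is_derive x 1 (fun y : R => y + 2 * pi) 1.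
  by apply: is_derive_eq; rewrite addr0.
have := is_derive1_comp (g := fun y : R => y + 2 * pi) (dh (x + 2 * pi)) dl.
rewrite (_ : h \o _ = h); last by apply/funext => y /=; exact: hp.
by move=> /(@derive_val _ _ _ _ _ _ _) e; rewrite [RHS]derive1E e mulr1.
Qed.

Lemma smoothR_derive1 h : smoothR h -> smoothR (derive1 h).
Proof. by move=> sh j x; have := sh j.+1 x; rewrite derive1Sn. Qed.

Lemma smoothR_continuous h : smoothR h -> continuous (h : R -> R^o).
Proof.
by move=> sh x; exact/differentiable_continuous/derivable1_diffP/(sh 0%N).
Qed.

Lemma periodic_derive1n h j : smoothR h -> periodic h ->
  periodic (derive1n j h) /\ continuous (derive1n j h : R -> R^o).
Proof.
elim: j h => [|j IH] h sh ph; first by split => //; exact: smoothR_continuous.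
by rewrite derive1Sn; apply: IH; [exact: smoothR_derive1|exact: periodic_derive1].
Qed.

Lemma periodic_bounded h : periodic h -> continuous (h : R -> R^o) ->
  exists M, forall x, `|h x| <= M.
Proof.
move=> ph ch; have [M hM] := continuous_bounded_segment ch.
by exists M => x; have [k hk] := shift_period x; rewrite -(periodicz k x ph); exact: hM.
Qed.

Lemma repull_periodic (f : T -> C) : periodic (repull f) /\ periodic (impull f).
Proof.
split => x; rewrite /repull /impull.
  by have := qpi_period x 1; rewrite mul1r => ->.
by have := qpi_period x 1; rewrite mul1r => ->.
Qed.

(** [sup] dominates the values only on bounded sets; derivatives of all orders are bounded because
    they are continuous and periodic. *)
Lemma seminorm_ge (N j : nat) (phi : testfun R) x : (j <= N)%N ->
  nc (derive1n j (repull phi) x +i* derive1n j (impull phi) x) <= test_seminorm N phi.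
Proof.
move=> jN; have /asboolP[sr si] := testfun_smooth phi.
have [pr pim] := repull_periodic phi.
have ub i : has_ubound [set nc (derive1n i (repull phi) x +i* derive1n i (impull phi) x) | x in [set: R]].
  have [p1 c1] := periodic_derive1n i sr pr; have [p2 c2] := periodic_derive1n i si pim.
  have [A hA] := periodic_bounded p1 c1; have [B hB] := periodic_bounded p2 c2.
  exists (A + B) => _ [y _ <-]; apply: le_trans (nc_ReIm _) _.
  exact: lerD (hA y) (hB y).
have S0 i : 0 <= sup [set nc (derive1n i (repull phi) x +i* derive1n i (impull phi) x) | x in [set: R]].
  by apply: le_trans (nc_ge0 _) (ub_le_sup (ub i) _); exists 0.
rewrite /test_seminorm (bigD1 (Ordinal (jN : (j < N.+1)%N)))//=.
apply: (@le_trans _ _ (sup [set nc (derive1n j (repull phi) x +i* derive1n j (impull phi) x) | x in [set: R]])).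
  by apply: ub_le_sup => //; exists x.
by rewrite lerDl sumr_ge0.
Qed.

Lemma seminorm_sup (N : nat) (phi : testfun R) t : nc (phi t) <= test_seminorm N phi.
Proof.
have [x ->] := circleP t.
have := seminorm_ge phi x (leq0n N); rewrite /= /repull /impull.
by case: (testfun_val phi _).
Qed.

Lemma seminorm_ge0 N (phi : testfun R) : 0 <= test_seminorm N phi.
Proof. by apply: le_trans (nc_ge0 _) (seminorm_sup N phi (qpi 0)). Qed.

Lemma IR_abs_le h M : continuous (h : R -> R^o) -> (forall x, `|h x| <= M) ->
  `|IR h| <= M * (2 * pi).
Proof.
move=> ch hM; have cc (a : R) : continuous ((fun=> a) : R -> R^o).
  by move=> x; exact: cst_continuous.
have h1 : IR h <= IR (fun=> M).
  by apply: IR_le => // x; exact: le_trans (ler_norm _) (hM x).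
have h2 : IR (fun=> - M) <= IR h.
  by apply: IR_le => // x; have := hM x; rewrite ler_norml => /andP[].
by rewrite ler_norml; rewrite IR_cst in h1; rewrite IR_cst mulNr in h2; rewrite h2.
Qed.

Lemma trig_continuous (a b c : R) (h : R -> R) : continuous (h : R -> R^o) ->
  continuous ((fun x => h x * (a * cos (c * x) + b * sin (c * x))) : R -> R^o).
Proof.
move=> ch; pose u x := a * cos (c * x) + b * sin (c * x).
have cu : continuous (u : R -> R^o) := smoothR_continuous (@smoothR_cos_sin R a b c).
rewrite (_ : (fun x => _) = h \* u)// => x.
by apply: continuousM; [exact: ch|exact: cu].
Qed.

Lemma IR_by_parts (h : R -> R) (n : int) (a b : R) : smoothR h -> periodic h ->
  IR (fun x => h x * ((b * n%:~R) * cos (n%:~R * x) + (- (a * n%:~R)) * sin (n%:~R * x))) =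
  - IR (fun x => derive1 h x * (a * cos (n%:~R * x) + b * sin (n%:~R * x))).
Proof.
move=> sh ph; pose c : R := n%:~R.
pose u x := a * cos (c * x) + b * sin (c * x).
pose u' x := (b * c) * cos (c * x) + (- (a * c)) * sin (c * x).
have ch := smoothR_continuous sh.
have ch' := smoothR_continuous (smoothR_derive1 sh).
have dh (y : R) : is_derive y 1 h (derive1 h y).
  by apply: DeriveDef; [exact: sh 0%N y|rewrite derive1E].
have du (x : R) : is_derive x 1 u (u' x).
  have dl : is_derive x 1 (fun x => c * x) c.
    by apply: is_derive_eq; rewrite /GRing.scale /=; ring.
  have dc := is_derive1_comp (is_derive_cos (c * x)) dl.
  have ds := is_derive1_comp (is_derive_sin (c * x)) dl.
  have hh := is_deriveD (is_deriveZ a dc) (is_deriveZ b ds).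
  by apply: (is_derive_eq hh); rewrite /GRing.scale /= /u'; ring.
have dF (x : R) : is_derive x 1 (h * u) (1 * (h x * u' x) + 1 * (derive1 h x * u x)).
  have hh := is_deriveM (dh x) (du x).
  by apply: (is_derive_eq hh); rewrite /GRing.scale /=; ring.
have c1 : continuous ((fun x => h x * u' x) : R -> R^o) by exact: trig_continuous.
have c2 : continuous ((fun x => derive1 h x * u x) : R -> R^o) by exact: trig_continuous.
have := IR_derive dF; rewrite IR_lin// !mul1r => H.
apply/eqP; rewrite -addr_eq0; apply/eqP; apply: H.
  move=> x; apply: (continuousD (f := fun x => 1 * (h x * u' x) : R^o));
    apply: continuousM; try exact: cst_continuous; [exact: c1|exact: c2].
rewrite /= -[(h * u) _]/(h _ * u _) -[(h * u) 0]/(h 0 * u 0).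
have := ph 0; rewrite add0r => ->; congr (_ * _).
have [hc hs] := cos_sin_periodz n (0 : R); rewrite add0r in hc hs.
by rewrite /u /c hc hs mulr0.
Qed.

(* Two integrations by parts. *)
Lemma IR_decay (h : R -> R) (n : int) (a b M : R) : smoothR h -> periodic h -> n != 0 ->
  `|a| + `|b| <= 1 -> (forall x, `|derive1n 2 h x| <= M) ->
  `|IR (fun x => h x * (a * cos (n%:~R * x) + b * sin (n%:~R * x)))| <=
    M * (2 * pi) / n%:~R ^+ 2.
Proof.
move=> sh ph n0 ab hM; pose c : R := n%:~R.
have c0 : c != 0 by rewrite intr_eq0.
have sh' := smoothR_derive1 sh; have ph' := periodic_derive1 sh ph.
have e1 := IR_by_parts n (- b / c) (a / c) sh ph.
have e2 := IR_by_parts n (- a / c ^+ 2) (- b / c ^+ 2) sh' ph'.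
have c2 := smoothR_continuous (smoothR_derive1 sh').
rewrite (_ : (fun x => h x * _) =
  fun x => h x * (a / c * n%:~R * cos (n%:~R * x) + - (- b / c * n%:~R) * sin (n%:~R * x))); last first.
  by apply/funext => x; rewrite -/c; congr (_ * (_ * _ + _ * _)); field.
rewrite e1.
rewrite (_ : (fun x => derive1 h x * _) =
  fun x => derive1 h x * (- b / c ^+ 2 * n%:~R * cos (n%:~R * x) + - (- a / c ^+ 2 * n%:~R) * sin (n%:~R * x))); last first.
  by apply/funext => x; rewrite -/c; congr (_ * (_ * _ + _ * _)); field.
rewrite e2 opprK mulrAC; apply: IR_abs_le; first exact: trig_continuous.
move=> x; rewrite normrM.
have M0 : 0 <= M by apply: le_trans (hM 0).
apply: ler_pM => //; first by have := hM x; rewrite derive1Sn derive1n1.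
have c2p : 0 < c ^+ 2 by rewrite lt_neqAle eq_sym expf_neq0//= sqr_ge0.
rewrite -/c; apply: (@le_trans _ _ ((`|a| + `|b|) / c ^+ 2)); last first.
  by rewrite ler_pdivrMr// mulVf// gt_eqF.
have -> : - a / c ^+ 2 * cos (c * x) + - b / c ^+ 2 * sin (c * x) =
  - (a * cos (c * x) + b * sin (c * x)) / c ^+ 2 by field.
rewrite normrM normfV (gtr0_norm c2p) ler_pM2r ?invr_gt0// normrN.
apply: le_trans (ler_normD _ _) _; rewrite !normrM lerD// ler_piMr//.
  by rewrite ler_norml cos_geN1 cos_le1.
by rewrite ler_norml sin_geN1 sin_le1.
Qed.

(** The factor 4 counts the real integrals of [repull phi] and [impull phi] against cosine and
    sine. *)
Lemma hat_decay (phi : testfun R) n : n != 0 ->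
  nc (hat phi n) <= 4 * test_seminorm 2 phi / n%:~R ^+ 2.
Proof.
move=> n0; have /asboolP[sr si] := testfun_smooth phi.
have [pr pim] := repull_periodic phi; have p0 := twopi_gt0 R.
set H := test_seminorm 2 phi.
have Hr x : `|derive1n 2 (repull phi) x| <= H.
  by apply: le_trans (seminorm_ge phi x (leqnn 2)); exact: (nc_Re (_ +i* _)).
have Hi x : `|derive1n 2 (impull phi) x| <= H.
  by apply: le_trans (seminorm_ge phi x (leqnn 2)); exact: (nc_Im (_ +i* _)).
have D h a b := @IR_decay h n a b H.
have z1 : `|1 : R| + `|0 : R| <= 1 by rewrite normr1 normr0 addr0.
have z2 : `|0 : R| + `|1 : R| <= 1 by rewrite normr1 normr0 add0r.
have z3 : `|0 : R| + `|-1 : R| <= 1 by rewrite normrN normr1 normr0 add0r.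
have d1 := D _ 1 0 sr pr n0 z1 Hr; have d2 := D _ 0 1 si pim n0 z2 Hi.
have d3 := D _ 0 (-1) sr pr n0 z3 Hr; have d4 := D _ 1 0 si pim n0 z1 Hi.
have cr := smoothR_continuous sr; have ci := smoothR_continuous si.
have chiN x : chi (- n) (qpi x) = cos (n%:~R * x) -i* sin (n%:~R * x).
  by rewrite chi_pi mulrNz mulNr cosN sinN.
have Er : repull (fun t => phi t * chi (- n) t) = fun x =>
   1 * (repull phi x * (1 * cos (n%:~R * x) + 0 * sin (n%:~R * x)))
   + 1 * (impull phi x * (0 * cos (n%:~R * x) + 1 * sin (n%:~R * x))).
  by apply/funext => x; rewrite -[LHS]/(complex.Re (phi (qpi x) * chi (- n) (qpi x))) ReMc chiN /repull /impull /=; ring.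
have Ei : impull (fun t => phi t * chi (- n) t) = fun x =>
   1 * (repull phi x * (0 * cos (n%:~R * x) + (-1) * sin (n%:~R * x)))
   + 1 * (impull phi x * (1 * cos (n%:~R * x) + 0 * sin (n%:~R * x))).
  by apply/funext => x; rewrite -[LHS]/(complex.Im (phi (qpi x) * chi (- n) (qpi x))) ImMc chiN /repull /impull /=; ring.
rewrite /hat /mean /circle_integral Er Ei -![Rintegral _ _ _]/(IR _).
rewrite !IR_lin; do ?exact: trig_continuous.
rewrite ncM ncR ger0_norm ?invr_ge0 ?(ltW p0)// mulrC ler_pdivrMr//.
apply: le_trans (nc_ReIm _) _; rewrite /= !mul1r.
set X1 := IR _ in d1 *; set X2 := IR _ in d2 *; set X3 := IR _ in d3 *; set X4 := IR _ in d4 *.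
have := ler_normD X1 X2; have := ler_normD X3 X4.
have -> : 4 * H / n%:~R ^+ 2 * (2 * pi) = 4 * (H * (2 * pi) / n%:~R ^+ 2) by ring.
lra.
Qed.

(** Both signs contribute equally, and 1 / (x + 1)^2 <= 1 / x - 1 / (x + 1) telescopes. *)
Lemma sum_inv_sqr N : \sum_(n <- rng N | n != 0) (n%:~R ^+ 2)^-1 <= 4 :> R.
Proof.
have -> : \sum_(n <- rng N | n != 0) (n%:~R ^+ 2)^-1 =
    \sum_(1 <= i < N.+1) (2 * (i%:R ^+ 2)^-1) :> R.
  have P : perm_eq [seq n <- rng N | n != 0] ([seq Posz i | i <- index_iota 1 N.+1] ++ [seq - Posz i | i <- index_iota 1 N.+1]).
    apply: uniq_perm; first by rewrite filter_uniq ?rng_uniq.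
      rewrite cat_uniq !map_inj_uniq ?iota_uniq//=; [|by move=> i j /oppr_inj[]|by move=> i j []].
      rewrite andbT; apply/hasPn => x /mapP[i hi ->]; apply/negP => /mapP[j hj e].
      by move: hi hj; rewrite !mem_index_iota; lia.
    move=> n; rewrite mem_filter mem_rng mem_cat; apply/andP/orP => [[n0 nN]|[] /mapP[j]].
    - have [n1|n1] := leP 0 n; [left|right]; apply/mapP; exists (absz n);
        rewrite ?mem_index_iota; lia.
    - by rewrite mem_index_iota => hi ->; split; lia.
    - by rewrite mem_index_iota => hi ->; split; lia.
  rewrite -big_filter (perm_big _ P) big_cat /= !big_map -big_split /=.
  by apply: eq_bigr => i _; rewrite mulrNz sqrrN -pmulrn; ring.
have [->|N0] := posnP N; first by rewrite big_geq.
case: N N0 => // N _; suff : \sum_(1 <= i < N.+2) (2 * (i%:R ^+ 2)^-1) <= 2 * (2 - N.+1%:R^-1) :> R.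
  move=> h; apply: le_trans h _.
  have : 0 <= (N.+1%:R : R)^-1 by rewrite invr_ge0.
  set v := (_^-1) => v0; lra.
elim: N => [|N IH]; first by rewrite big_nat1 !mulr1n expr1n !invr1; lra.
rewrite big_nat_recr//=; apply: le_trans (lerD IH (lexx _)) _.
rewrite -mulrDr ler_pM2l// -lerBrDl.
have n0 : 0 < N.+1%:R :> R by rewrite ltr0n.
have -> : (N.+2%:R : R) = N.+1%:R + 1 by rewrite natr1.
set x := (N.+1%:R : R) in n0 *; clearbody x.
have x1 : 0 < x + 1 by rewrite addr_gt0.
have -> : 2 - (x + 1)^-1 - (2 - x^-1) = (x * (x + 1))^-1 by field; rewrite !gt_eqF.
by rewrite lef_pV2 ?posrE ?exprn_gt0 ?mulr_gt0// expr2 ler_pM2r// lerDl.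
Qed.

End TestFunctions.

(** * Finiteness and tails of the A_r norm *)

Section ANorm.
Variable R : realType.
Local Notation T := (circle R).
Local Notation C := R[i].
Local Notation nc := Normc.normc.
Implicit Types (S : testfun R -> C) (r e M : R).

Let term r S n : \bar R := (nc (fourier S n) `^ r)%:E.

Let sum_term r S (A : set int) : finite_set A ->
  (\sum_(n \in A) term r S n)%E =
  (\sum_(n <- finmap.enum_fset (fset_set A)) nc (fourier S n) `^ r)%:E.
Proof. by move=> fA; rewrite fsbig_finite// sumEFin. Qed.

Lemma A_norm_le r S M : 0 < r -> bd r (fourier S) M -> (A_norm r S <= M%:E)%E.
Proof.
move=> r0 [M0 h]; have h1 : (\esum_(n in [set: int]) term r S n <= (M `^ r)%:E)%E.
  apply: ge_ereal_sup => _ [A [fA _] <-].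
  by rewrite sum_term// lee_fin h// finmap.fset_uniq.
have h0 : (0 <= \esum_(n in [set: int]) term r S n)%E.
  by apply: esum_ge0 => n _; rewrite lee_fin powR_ge0.
have -> : A_norm r S = ((\esum_(n in [set: int]) term r S n) `^ r^-1)%E by [].
move: h1 h0; set X := (\esum_(n in [set: int]) term r S n)%E.
case: X => [v||] //; rewrite !lee_fin => h1 h0.
have -> : M = (M `^ r) `^ r^-1 by rewrite -powRrM divff ?powRr1// gt_eqF.
by rewrite ge0_ler_powR ?nnegrE ?invr_ge0 ?powR_ge0 ?(ltW r0).
Qed.

(** Take a finite set whose partial sum is within e^r of the supremum defining [esum]. In effect,
    trigonometric polynomials are dense in A_r. *)
Lemma A_norm_tail r S e : 0 < r -> (A_norm r S < +oo)%E -> 0 < e ->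
  exists2 s : seq int, uniq s & bd r (fun n => if n \in s then 0 else fourier S n) e.
Proof.
move=> r0 h e0; have er : 0 < e `^ r by rewrite powR_gt0.
have h1 : (\esum_(n in [set: int]) term r S n < +oo)%E.
  by apply: lty_poweRy h; rewrite invr_eq0 gt_eqF.
have h0 : (0 <= \esum_(n in [set: int]) term r S n)%E.
  by apply: esum_ge0 => n _; rewrite lee_fin powR_ge0.
have fn : (\esum_(n in [set: int]) term r S n)%E \is a fin_num.
  by rewrite ge0_fin_numE.
have [_ [A [fA _] <-]] := ub_ereal_sup_adherent er fn.
rewrite sum_term//; set s : seq int := finmap.enum_fset _ => hs.
exists s; first exact: finmap.fset_uniq.
split; first exact: ltW.
move=> s' us'; pose l := [seq n <- s' | n \notin s].
rewrite (_ : \sum_(n <- s') _ = \sum_(n <- l) nc (fourier S n) `^ r); last first.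
  rewrite /l big_filter [RHS]big_mkcond /=; apply: eq_bigr => n _.
  by case: ifP => //= _; rewrite nc0 powR0// gt_eqF.
have ul : uniq (s ++ l).
  rewrite cat_uniq finmap.fset_uniq filter_uniq// andbT.
  by apply/hasPn => n; rewrite mem_filter => /andP[].
have : ((\sum_(n <- s ++ l) nc (fourier S n) `^ r)%:E <= \esum_(n in [set: int]) term r S n)%E.
  apply: ereal_sup_ubound; exists [set` s ++ l]; first by split => //; exact: finite_seq.
  by rewrite -fsbig_seq// sumEFin.
move: hs; rewrite -[ereal_sup _]/(\esum_(n in [set: int]) term r S n)%E.
move: fn; set X := (\esum_(n in [set: int]) term r S n)%E.
case: X => [v||] // _.
by rewrite -EFinB lte_fin lee_fin big_cat /= => a b; lra.
Qed.

Lemma bd_finite_norm r S M : 0 < r -> bd r (fourier S) M -> (A_norm r S < +oo)%E.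
Proof. by move=> r0 h; apply: le_lt_trans (A_norm_le r0 h) _; exact: ltry. Qed.

End ANorm.

Section Distributions.
Variable R : realType.
Local Notation T := (circle R).
Local Notation C := R[i].
Local Notation nc := Normc.normc.

Lemma dist_ofE (f : T -> C) phi : dist_of f phi = mean (fun t => f t * phi t).
Proof. by []. Qed.

Lemma testfun_lin (a : C) (phi psi : testfun R) t :
  (a *: phi + psi) t = a * phi t + psi t.
Proof. by []. Qed.

Lemma dist_of_scalar (f : T -> C) : ct f -> scalar (dist_of f).
Proof.
move=> cf a phi psi; rewrite !dist_ofE.
have cp := ctM cf (ct_test phi); have cq := ctM cf (ct_test psi).
rewrite -[RHS]/(a * mean (fun t => f t * phi t) + mean (fun t => f t * psi t)).
rewrite -meanZ// -meanD//; last exact: ctZ.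
by congr mean; apply/funext => t; rewrite testfun_lin; ring.
Qed.

Lemma dist_of_schwartz (f : T -> C) : ct f -> schwartz_distribution (dist_of f).
Proof.
move=> cf; split; first exact: dist_of_scalar.
have [M M0 fM] := ct_bounded cf.
exists 0%N, M => phi; apply: nc_mean; first exact: ctM (ct_test _).
by move=> t; rewrite ncM ler_pM ?nc_ge0 ?seminorm_sup.
Qed.

(** The coefficients of a test function are absolutely summable, with sum at most 1 + 4 * 4 = 17
    seminorms: 1 for n = 0, the rest by [hat_decay] and [sum_inv_sqr]. So coefficient bounds alone
    give convergence as distributions. *)
Lemma pairing_bound N (u : T -> C) (A : R) (phi : testfun R) : tp N u ->
  (forall n, nc (hat u n) <= A) ->
  nc (dist_of u phi) <= A * (17 * test_seminorm 2 phi).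
Proof.
move=> hu hA; have A0 : 0 <= A by apply: le_trans (hA 0); exact: nc_ge0.
set H := test_seminorm 2 phi; have H0 : 0 <= H by exact: seminorm_ge0.
have cc (n : int) : ct (fun t => chi n t * phi t) by apply: ctM; [exact: ct_chi|exact: ct_test].
rewrite dist_ofE {1}(tp_expand hu).
rewrite (_ : (fun t => _) = fun t => \sum_(n <- rng N) hat u n * (chi n t * phi t)); last first.
  by apply/funext => t; rewrite mulr_suml; apply: eq_bigr => n _; rewrite mulrA.
rewrite mean_sum; last by move=> n; exact: ctZ.
apply: le_trans (nc_sum _ _ _) _.
have b n : nc (mean (fun t => hat u n * (chi n t * phi t))) <= A * nc (hat phi (- n)).
  rewrite meanZ// ncM ler_pM ?nc_ge0//.
  rewrite (_ : mean _ = hat phi (- n))//; congr mean; apply/funext => t.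
  by rewrite opprK mulrC.
apply: le_trans (ler_sum _ (fun n _ => b n)) _.
rewrite -mulr_sumr ler_wpM2l// (bigD1_seq 0) ?rng_uniq ?mem_rng//= oppr0.
have h0 : nc (hat phi 0) <= H by apply: nc_hat (ct_test _) _ => t; exact: seminorm_sup.
have h1 : \sum_(n <- rng N | n != 0) nc (hat phi (- n)) <= 4 * H * 4.
  apply: le_trans (ler_wpM2l _ (sum_inv_sqr R N)); last by rewrite mulr_ge0.
  rewrite mulr_sumr; apply: ler_sum => n n0.
  have := hat_decay phi (n := - n); rewrite oppr_eq0 => /(_ n0).
  by rewrite mulrNz sqrrN.
lra.
Qed.

End Distributions.

(** * Passage to the limit *)

Section Limits.
Variable R : realType.
Local Notation T := (circle R).
Local Notation C := R[i].
Local Notation nc := Normc.normc.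
Local Notation qpi := (\pi_(circle R))%qT.

Lemma half_lt1 : 0 <= (1 / 2 : R) < 1.
Proof. lra. Qed.

Lemma halfX_ge0 k : 0 <= (1 / 2 : R) ^+ k.
Proof. by rewrite exprn_ge0. Qed.

Lemma bd_one r : 0 < r -> bd r (hat (fun=> 1 : C) : int -> C) 1.
Proof.
move=> r0; apply: (@bd_supp _ _ [:: 0]) => //.
  move=> n; rewrite inE => n0; apply: (tp_hat0 (tp_cst (1 : C))).
  by rewrite lt0n absz_eq0.
by rewrite big_seq1 hat_0 mean_cst nc1.
Qed.

Lemma le_geometric (x A r B : R) : 0 <= r < 1 -> (forall k, x <= A * r ^+ k + B) -> x <= B.
Proof.
move=> r01 h; rewrite leNgt; apply/negP => xB.
have d0 : 0 < (x - B) / 2 by rewrite divr_gt0// subr_gt0.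
have [k0 /(_ k0 (leqnn _)) hk] := geometric_eventually A r01 d0.
have := h k0; lra.
Qed.

Lemma bd_telescope r (u : nat -> T -> R) k (A : R) : 1 <= r -> (forall k, trp (u k)) -> 0 <= A ->
  (forall j, (k <= j)%N -> bd r (hat (cpx (fun t => u j.+1 t - u j t))) (A * (1 / 2) ^+ j)) ->
  forall i, bd r (hat (cpx (fun t => u (k + i)%N t - u k t))) (2 * A * (1 / 2) ^+ k).
Proof.
move=> r1 hu A0 h i; have r0 : 0 < r by apply: lt_le_trans r1.
(* The exact partial sum of the geometric series is kept, which makes the induction on i close. *)
suff : bd r (hat (cpx (fun t => u (k + i)%N t - u k t))) (2 * A * ((1 / 2) ^+ k - (1 / 2) ^+ (k + i))).
  apply: bd_le; first exact: ltW.
  by rewrite ler_wpM2l ?mulr_ge0// gerBl halfX_ge0.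
elim: i => [|i IH].
  rewrite addn0 subrr mulr0 (_ : hat _ = fun=> 0); first exact: bd0.
  by apply/funext => n; rewrite hatB_cpx// subrr.
have := bdD r1 (h _ (leq_addr i k)) IH; rewrite addnS.
rewrite (_ : (fun n => _) = hat (cpx (fun t => u (k + i).+1 t - u k t))); last first.
  by apply/funext => n; rewrite !hatB_cpx// addrA subrK.
apply: bd_le; first exact: ltW.
by rewrite le_eqVlt; apply/orP; left; apply/eqP; rewrite exprS; field.
Qed.

(** The limit is taken for each test function separately; linearity and order 2 pass to it from the
    rate of convergence. That rate has constant 2 (17/32) / (1 - 1/2) = 17/8. *)
Lemma limit_distribution q (S : nat -> T -> R) : 2 <= q -> (forall k, trp (S k)) ->
  S 0%N = (fun=> 1) ->
  (forall k, bd q (hat (cpx (fun t => S k.+1 t - S k t))) (1 / 32 * (1 / 2) ^+ k)) ->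
  exists Sd : testfun R -> C, [/\ schwartz_distribution Sd, Sd <> 0, A_space q Sd &
    forall phi k, nc (Sd phi - dist_of (cpx (S k)) phi) <=
      17 / 8 * test_seminorm 2 phi * (1 / 2) ^+ k].
Proof.
move=> q2 hS S0 bS; have q1 : 1 <= q by lra.
have q0 : 0 < q by lra.
have cS k := trp_ct (hS k).
have ex (phi : testfun R) : exists l : C, forall k,
    nc (l - dist_of (cpx (S k)) phi) <= 17 / 8 * test_seminorm 2 phi * (1 / 2) ^+ k.
  have [k|l hl] := @geometric_limit_cpx R (fun k => dist_of (cpx (S k)) phi)
      (1 / 32 * (17 * test_seminorm 2 phi)) (1 / 2) half_lt1.
    have [N hN] := trpB (hS k.+1) (hS k).
    rewrite (_ : _ - _ = dist_of (cpx (fun t => S k.+1 t - S k t)) phi); last first.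
      rewrite !dist_ofE -meanB; try exact: ctM (ct_test _).
      by congr mean; apply/funext => t; rewrite /cpx rmorphB mulrBl.
    apply: le_trans (pairing_bound phi hN (fun n => bd_coef n q0 (bS k))) _.
    by rewrite mulrAC.
  exists l => k; apply: le_trans (hl k) _.
  by rewrite le_eqVlt; apply/orP; left; apply/eqP; field.
have [Sd hSd] := choice ex.
have fE n k : nc (fourier Sd n - hat (cpx (S k)) n) <=
    17 / 8 * test_seminorm 2 (chi_test R (- n)) * (1 / 2) ^+ k by exact: hSd.
have schw : schwartz_distribution Sd.
  split.
    move=> a phi psi; apply/eqP; rewrite -subr_eq0 -nc_eq0; apply/eqP.
    set A := 17 / 8 * (test_seminorm 2 (a *: phi + psi) +
      nc a * test_seminorm 2 phi + test_seminorm 2 psi).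
    apply: (@geometric_zero R _ A (1 / 2)); [exact: half_lt1|exact: nc_ge0|].
    move=> k.
    have zl := dist_of_scalar (cS k) a phi psi.
    rewrite -[_ (a *: phi + psi)]/(dist_of (cpx (S k)) (a *: phi + psi)) in zl.
    have -> : Sd (a *: phi + psi) - (a * Sd phi + Sd psi) =
      (Sd (a *: phi + psi) - dist_of (cpx (S k)) (a *: phi + psi)) -
      (a * (Sd phi - dist_of (cpx (S k)) phi)) - (Sd psi - dist_of (cpx (S k)) psi).
      by rewrite zl; ring.
    apply: le_trans (ncB _ _) _; apply: le_trans (lerD (ncB _ _) (lexx _)) _.
    rewrite ncM; have h1 := hSd (a *: phi + psi) k; have h2 := hSd psi k.
    have h3 := ler_wpM2l (nc_ge0 a) (hSd phi k).
    apply: le_trans (lerD (lerD h1 h3) h2) _.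
    by rewrite le_eqVlt; apply/orP; left; apply/eqP; rewrite /A; ring.
  exists 2%N, 4 => phi.
  have -> : Sd phi = (Sd phi - dist_of (cpx (S 0%N)) phi) + dist_of (cpx (S 0%N)) phi by rewrite subrK.
  apply: le_trans (ncD _ _) _.
  have h1 := hSd phi 0%N; rewrite expr0 mulr1 in h1.
  have h2 : nc (dist_of (cpx (S 0%N)) phi) <= test_seminorm 2 phi.
    apply: nc_mean; first exact: ctM (cS 0%N) (ct_test _).
    by move=> t; rewrite S0 /cpx rmorph1 mul1r; exact: seminorm_sup.
  have := seminorm_ge0 2 phi; lra.
have c32 : 0 <= 1 / 32 :> R by lra.
have bd1 k : bd q (hat (cpx (fun t => S k t - 1))) (1 / 16).
  have := bd_telescope (k := 0) q1 hS c32 (fun j _ => bS j) k.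
  rewrite add0n expr0 mulr1 S0; apply: bd_le; [exact: ltW|lra].
have cpx1 : cpx (fun=> 1) = (fun=> 1 : C) :> (T -> C) by apply/funext => t; exact: rmorph1.
have bdS k : bd q (hat (cpx (S k))) 2.
  have := bdD q1 (bd1 k) (bd_one q0).
  rewrite (_ : (fun n => _) = hat (cpx (S k))); last first.
    by apply/funext => n; rewrite hatB_cpx//; [rewrite cpx1 subrK|exact: trp_cst].
  apply: bd_le; [exact: ltW|lra].
(* The constant in [fE] depends on n. Comparing with S_(k+i) and letting i grow removes it, and
   [bd_approx] needs this uniformity in n. *)
have fU n k : nc (fourier Sd n - hat (cpx (S k)) n) <= 1 / 16 * (1 / 2) ^+ k.
  apply: (@le_geometric _ (17 / 8 * test_seminorm 2 (chi_test R (- n)) * (1 / 2) ^+ k) (1 / 2)).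
    exact: half_lt1.
  move=> i; have := bd_telescope q1 hS c32 (fun j _ => bS j) i (k := k).
  move=> /(bd_coef n q0); rewrite hatB_cpx// => h1.
  have h2 := fE n (k + i)%N.
  have -> : fourier Sd n - hat (cpx (S k)) n = (fourier Sd n - hat (cpx (S (k + i)%N)) n) +
    (hat (cpx (S (k + i)%N)) n - hat (cpx (S k)) n) by rewrite addrA subrK.
  apply: le_trans (ncD _ _) _; rewrite exprD mulrA in h2.
  by apply: le_trans (lerD h2 h1) _; rewrite lerD2l (_ : 2 * (1 / 32) = 1 / 16)//; field.
have bdF : bd q (fourier Sd) 2.
  apply: bd_approx => // e e0.
  have [k hk] := geometric_eventually (1 / 16) half_lt1 e0.
  by exists (hat (cpx (S k))); split => // n; apply: le_trans (fU n k) _; exact: hk.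
exists Sd; split => //.
- move=> Sd0; have F0 : fourier Sd 0 = 0 by rewrite Sd0.
  have h1 := fU 0 0%N; have h2 := bd_coef 0 q0 (bd1 0%N).
  rewrite F0 sub0r ncN S0 cpx1 hat_0 mean_cst nc1 expr0 mulr1 in h1.
  lra.
- by split => //; exact: bd_finite_norm bdF.
Qed.

(** Uniform convergence gives continuity and uniform convergence of the coefficients, so [bd_approx]
    carries the A_p bounds to the limit. As [L] is nondecreasing, all displacements after k share
    the denominator 1 + L_(k+1). *)
Lemma limit_function p (g : nat -> T -> R) (L : nat -> R) (A s : R) :
  1 <= p -> 0 <= s < 1 -> (forall k, trp (g k)) -> g 0%N = (fun=> 1) ->
  (forall k, 0 <= L k) -> (forall k, L k <= L k.+1) ->
  (forall k t, `|g k.+1 t - g k t| <= A * s ^+ k) ->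
  (forall k, bd p (hat (cpx (fun t => g k.+1 t - g k t))) ((1 / 2) ^+ k / (1 + L k.+1))) ->
  exists G : T -> R, [/\ ct (cpx G), forall k t, `|G t - g k t| <= A * s ^+ k / (1 - s),
    exists M, bd p (hat (cpx G)) M &
    forall k, bd p (hat (fun t => cpx G t - cpx (g k) t)) (2 / (1 + L k.+1) * (1 / 2) ^+ k)].
Proof.
move=> p1 s01 hg g0 L0 Lm dg bg; have p0 : 0 < p by apply: lt_le_trans p1.
have ex t : exists l, forall k, `|l - g k t| <= A * s ^+ k / (1 - s).
  by apply: geometric_limit => // k; exact: dg.
have [G hG] := choice ex.
have s1 : 0 < 1 - s by case/andP: s01 => _; rewrite subr_gt0.
have conv d : 0 < d -> exists k0, forall k, (k0 <= k)%N -> A * s ^+ k / (1 - s) <= d.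
  move=> d0; have [k0 hk] := geometric_eventually (A / (1 - s)) s01 d0.
  by exists k0 => k kk; rewrite mulrAC; exact: hk.
have cG : ct (cpx G).
  apply: (ct_uniform_limit (f := g) (e := fun k => A * s ^+ k / (1 - s))).
  - by move=> k; exact: trp_ct.
  - by move=> k t; exact: hG.
  - by move=> d /conv[k0 hk]; exists k0; exact: hk.
have L1 k : 0 < 1 + L k by rewrite ltr_pwDl.
have Lmono i k : L k <= L (k + i)%N.
  by elim: i => [|i IH]; rewrite ?addn0// addnS; exact: le_trans IH (Lm _).
have bG k : bd p (hat (fun t => cpx G t - cpx (g k) t)) (2 / (1 + L k.+1) * (1 / 2) ^+ k).
  apply: bd_approx => //.
    by rewrite mulr_ge0 ?halfX_ge0// divr_ge0// ltW.
  move=> e e0; have [k0 hk] := conv e e0.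
  exists (hat (cpx (fun t => g (k + k0)%N t - g k t))); split.
    rewrite -[2 / _]/(2 * (1 + L k.+1)^-1); apply: bd_telescope => //.
      by rewrite invr_ge0 ltW.
    move=> j kj; apply: bd_le (bg j); first exact: ltW.
    rewrite mulrC ler_wpM2r ?halfX_ge0// lef_pV2 ?posrE// lerD2l.
    by rewrite -(subnK kj) addnC -addSn; exact: Lmono.
  move=> n; rewrite hatB_cpx// hatB//; try exact: trp_ct.
  set x := hat (cpx G) n; set y := hat (cpx (g k)) n; set z := hat _ n.
  have -> : x - y - (z - y) = x - z by ring.
  rewrite /x /z -hatB//; try exact: trp_ct.
  apply: le_trans (hk _ (leq_addl k k0)); apply: nc_hat.
    by apply: ctB => //; exact: trp_ct.
  by move=> t; rewrite /cpx -rmorphB ncR.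
exists G; split => //.
exists (2 / (1 + L 1%N) * (1 / 2) ^+ 0 + 1).
have cpx1 : cpx (fun=> 1) = (fun=> 1 : C) :> (T -> C) by apply/funext => t; exact: rmorph1.
have := bdD p1 (bG 0%N) (bd_one p0); rewrite g0 cpx1.
rewrite (_ : (fun n => _) = hat (cpx G))//; apply/funext => n.
by rewrite hatB ?subrK//; exact: ct_cst.
Qed.

End Limits.

(** * Cyclicity of the limit function and support of the limit distribution *)

Section Cyclicity.
Variable R : realType.
Local Notation T := (circle R).
Local Notation C := R[i].
Local Notation nc := Normc.normc.

Lemma A_space_mul (p : R) (P g : T -> C) (M : R) : 1 <= p -> trigpoly P -> ct g ->
  bd p (hat g) M -> A_space p (dist_of (fun t => P t * g t)).
Proof.
move=> p1 /trigpoly_tp[N hP] cg bg; have p0 : 0 < p by apply: lt_le_trans p1.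
have [L L0 hL] := tp_multiplier hP; split.
  by apply: dist_of_schwartz; exact: ctM (tp_ct hP) cg.
exact: bd_finite_norm p0 (hL _ _ _ p1 cg bg).
Qed.

(** It suffices to approximate 1: truncating the Fourier series of S gives a polynomial Q, and Q (P
    g - 1) is small because Q is a multiplier whose bound is known before P is chosen. *)
Lemma cyclic_dense (p : R) (g : T -> C) (M : R) : 1 <= p -> ct g -> bd p (hat g) M ->
  (forall e, 0 < e -> exists2 P, trigpoly P & bd p (hat (fun t => P t * g t - 1)) e) ->
  A_dense p [set dist_of (fun t => P t * g t) | P in trigpoly (R := R)].
Proof.
move=> p1 cg bg inv; have p0 : 0 < p by apply: lt_le_trans p1.
split; first by move=> _ [P hP <-]; exact: A_space_mul bg.
move=> S [_ fS] e e0; have e4 : 0 < e / 4 by rewrite divr_gt0.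
have [s us tail] := A_norm_tail p0 fS e4.
pose Q t : C := \sum_(n <- s) fourier S n * chi n t.
have tQ : trigpoly Q by exists s, (fourier S).
have [N hQ] := trigpoly_tp tQ.
have hatQ n : hat Q n = if n \in s then fourier S n else 0.
  rewrite hat_sum; last by move=> m; exact/ctZ/ct_chi.
  rewrite (eq_bigr (fun m => fourier S m * (m == n)%:R)); last first.
    by move=> m _; rewrite hatZ ?hat_chi//; exact: ct_chi.
  case: ifPn => [ns|ns].
    rewrite (bigD1_seq n)//= eqxx mulr1 big1 ?addr0// => m /negPf mn.
    by rewrite mn mulr0.
  rewrite big1_seq// => m /= ms; case: eqP => [mn|_]; last by rewrite mulr0.
  by rewrite -mn ms in ns.
have [L L0 hL] := tp_multiplier hQ.
have d0 : 0 < e / 4 / (L + 1) by rewrite divr_gt0// ltr_wpDl.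
have [P tP bP] := inv _ d0; have [NP hP] := trigpoly_tp tP.
have cPg : ct (fun t => P t * g t - 1).
  by apply: ctB; [exact: ctM (tp_ct hP) cg|exact: ct_cst].
have cQ := tp_ct hQ.
exists (dist_of (fun t => Q t * P t * g t)).
  by exists (fun t => Q t * P t) => //; exact: tp_trigpoly (tpM hQ hP).
apply: (@le_lt_trans _ _ (e / 2)%:E); last by rewrite lte_fin; lra.
apply: A_norm_le => //.
have := bdB p1 tail (hL _ _ _ p1 cPg bP).
rewrite (_ : (fun n => _) = fourier (S - dist_of (fun t => Q t * P t * g t))); last first.
  apply/funext => n.
  rewrite -[RHS]/(fourier S n - hat (fun t => Q t * P t * g t) n).
  have -> : (fun t => Q t * (P t * g t - 1)) = fun t => Q t * P t * g t - Q t.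
    by apply/funext => t; ring.
  rewrite hatB//; last by apply: ctM => //; exact: ctM (tp_ct hP).
  by rewrite hatQ; case: ifP => _; ring.
apply: bd_le; first exact: ltW.
have L1 : 0 < L + 1 by rewrite ltr_wpDl.
have h : L * (e / 4 / (L + 1)) <= e / 4.
  by rewrite mulrCA ler_piMr ?(ltW e4)// ler_pdivrMr// mul1r lerDl.
lra.
Qed.

(* Off the zero set of [G] the functions [g k] stay above the thresholds, hence
   [S k] tends to 0 there uniformly. *)
Lemma limit_support (G : T -> R) (g S : nat -> T -> R) (A B s : R) (Sd : testfun R -> C)
    (H : testfun R -> R) :
  0 <= s < 1 -> ct (cpx G) -> (forall k t, 0 <= g k t) ->
  (forall k t, `|G t - g k t| <= A * s ^+ k) -> (forall k, trp (S k)) ->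
  (forall k t, B * s ^+ k <= g k t -> `|S k.+1 t| <= `|S k t| / 2) ->
  (forall phi k, nc (Sd phi - dist_of (cpx (S k)) phi) <= H phi * (1 / 2) ^+ k) ->
  dist_support Sd `<=` [set t | (G t)%:C = 0].
Proof.
move=> s01 cG g0 hG hS Sx hSd t; apply: contraPP => /= Gt.
have G0 x : 0 <= G x.
  suff : - G x <= 0 by lra.
  apply: (@le_geometric _ _ A s) => // k; rewrite addr0.
  by have := hG k x; have := g0 k x; rewrite ler_norml => g1 /andP[g2 g3]; lra.
have Gp : 0 < G t.
  rewrite lt_neqAle G0 andbT eq_sym; apply/eqP => Gt0; apply: Gt.
  by rewrite Gt0.
pose c := G t / 2; have c0 : 0 < c by rewrite divr_gt0.
move=> /(_ _); apply; exists [set x | c < G x]; last by rewrite /= /c; lra.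
split; first by apply: open_superlevel; exact: cG.1.
move=> phi supp.
(* A s^k pays for the passage from [G] to [g k], B s^k is the threshold above which S is halved. *)
have [k0 hk0] := geometric_eventually (A + B) s01 c0.
have above k x : (k0 <= k)%N -> c < G x -> B * s ^+ k <= g k x.
  move=> /hk0 hk cx; have := hG k x; rewrite ler_norml => /andP[_].
  by rewrite mulrDl in hk; lra.
have [MS MS0 hMS] := trp_bounded (hS k0).
have small i x : c < G x -> `|S (k0 + i)%N x| <= MS * (1 / 2) ^+ i.
  move=> cx; elim: i => [|i IH]; first by rewrite addn0 expr0 mulr1.
  rewrite addnS; apply: le_trans (Sx _ _ (above _ _ (leq_addr _ _) cx)) _.
  by rewrite exprS; have := IH; lra.
have [Mp Mp0 hMp] := ct_bounded (ct_test phi).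
apply/eqP; rewrite -nc_eq0; apply/eqP.
apply: (@geometric_zero _ _ (H phi * (1 / 2) ^+ k0 + MS * Mp) (1 / 2)); [exact: half_lt1|exact: nc_ge0|].
move=> i.
have z : nc (dist_of (cpx (S (k0 + i)%N)) phi) <= MS * Mp * (1 / 2) ^+ i.
  apply: nc_mean; first exact: ctM (trp_ct (hS _)) (ct_test _).
  move=> x; rewrite ncM ncR.
  have [p0|pn0] := eqVneq (phi x) 0.
    by rewrite p0 nc0 mulr0 mulr_ge0 ?halfX_ge0// mulr_ge0 ?ltW.
  rewrite mulrAC ler_pM ?nc_ge0//; apply: small.
  by apply: supp; exact: subset_closure.
have := hSd phi (k0 + i)%N; rewrite exprD mulrA mulrDl => h.
have -> : Sd phi = (Sd phi - dist_of (cpx (S (k0 + i)%N)) phi) + dist_of (cpx (S (k0 + i)%N)) phi.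
  by rewrite subrK.
by apply: le_trans (ncD _ _) _; exact: lerD.
Qed.

End Cyclicity.

Theorem theorem3p3 (R : realType) (p : R) (hp : 1 < p < 2) :
  exists (E : set (circle R)) (g : circle R -> R[i]),
    [/\ compact E, continuous g & A_space p (dist_of g)] /\
    [/\ [set t | g t = 0] = E,
        A_dense p [set dist_of (fun t => P t * g t) | P in trigpoly (R := R)]
      & exists S : testfun R -> R[i],
          [/\ schwartz_distribution S, S <> 0, dist_support S `<=` E
            & A_space (p / (p - 1)) S]].
Proof.
have [p1 p2] := andP hp; have p1' := ltW p1.
have p0 : 0 < p by apply: lt_trans p1.
have q2 : 2 <= p / (p - 1) by rewrite ler_pdivlMr ?subr_gt0//; lra.
have [s0 s1] := andP (sigma_bounds R); pose s := @sigma R.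
have s01 : 0 <= s < 1 by rewrite ltW.
have [g [S [L [[hg hS g0 S0 gge] [[L0 Lm dg dS] [bg bS inv]]]]]] := construction hp.
have dg' k t : `|g k.+1 t - g k t| <= 2 / s * s ^+ k.
  by apply: le_trans (dg k t) _; rewrite /thr mulrA mulrAC.
have [G [cG dG [M bM] bG]] := limit_function p1' s01 hg g0 L0 Lm dg' bg.
have [Sd [schw Sd0 Sq hSd]] := limit_distribution q2 hS S0 bS.
have cont : continuous ((fun x => G (\pi_(circle R) x)%qT) : R -> R^o) by exact: cG.1.
exists [set t | (G t)%:C = 0], (fun t => (G t)%:C); split; split => //.
- rewrite (_ : [set t | _] = [set t | G t = 0]); first exact: compact_zero_set.
  by apply/seteqP; split => t /=; [case|move=> ->].
- exact: continuous_cpx.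
- by split; [exact: dist_of_schwartz|exact: bd_finite_norm p0 bM].
- apply: (cyclic_dense (M := M)) => // e e0.
  (* P G - 1 = P (G - g_k) + (P g_k - 1). The first term is at most L_(k+1) 2 / (1 + L_(k+1)) 2^(-k)
     <= 2 * 2^(-k) in A_p, the second at most 2^(-k). *)
  have [k /(_ k (leqnn k)) hk] := geometric_eventually 3 (half_lt1 R) e0.
  have [P [hP mP bP]] := inv k; have [N hN] := hP.
  exists (cpx P); first exact: tp_trigpoly hN.
  have cGg : ct (fun t => cpx G t - cpx (g k) t) by apply: ctB => //; exact: trp_ct.
  have := bdD p1' (mP.2 _ _ _ p1' cGg (bG k)) bP.
  rewrite (_ : (fun n => _) = hat (fun t => cpx P t * (G t)%:C - 1)); last first.
    have h1 : trp (fun t => P t * g k t - 1) by apply: trpB; [exact: trpM|exact: trp_cst].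
    apply/funext => n; rewrite -hatD; [|exact: ctM (trp_ct hP) cGg|exact: trp_ct].
    congr (hat _ n); apply/funext => t; rewrite /cpx rmorphB rmorphM rmorph1 /=.
    ring.
  apply: bd_le; first exact: ltW.
  apply: le_trans hk; have L1 : 0 < 1 + L k.+1 by rewrite ltr_pwDl.
  have h : L k.+1 * (2 / (1 + L k.+1) * (1 / 2) ^+ k) <= 2 * (1 / 2) ^+ k.
    rewrite mulrA ler_wpM2r ?halfX_ge0// mulrCA ler_piMr// ler_pdivrMr// mul1r.
    by rewrite lerDr.
  lra.
exists Sd; split => //.
apply: (@limit_support R G g S (2 / s / (1 - s)) s^-1 s Sd
  (fun phi => 17 / 8 * test_seminorm 2 phi)) => //.
- by move=> k t; apply: le_trans (dG k t) _; rewrite mulrAC.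
- by move=> k t h; apply: dS; rewrite /thr mulrC.
Qed.
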